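(* There exists a polynomial-time $O(1)$-approximation algorithm for the $\emptyset$-facility location problem, i.e., the $O$-facility location problem with $O=\emptyset$ (every open facility must be assigned an even number of clients).
   Context: An instance of the $O$-facility location problem consists of a finite set $F$ of facilities, a finite set $D$ of clients, a metric $c$ on $F\cup D$, opening costs $f:F\to\mathbb{Q}_{\ge 0}$, and a subset $O\subseteq F$. A feasible solution is a set $S\subseteq F$ of open facilities together with an assignment $\sigma:D\to S$ such that for every $i\in S$, $|\sigma^{-1}(i)|$ is odd if $i\in O$ and even if $i\notin O$. Its cost is $f(S)+\sum_{j\in D}c(\sigma(j),j)$, where $f(S)=\sum_{i\in S}f(i)$; the goal is to minimize the cost. An $\alpha$-approximation algorithm is a polynomial-time algorithm that, on every instance admitting a feasible solution, outputs a feasible solution of cost at most $\alpha$ times the optimum; an $O(1)$-approximation algorithm is an $\alpha$-approximation algorithm for some constant $\alpha$. *)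

(* Defs.v *)
From mathcomp Require Import all_boot all_order all_algebra.

Set Implicit Arguments.
Unset Strict Implicit.
Unset Printing Implicit Defensive.

Import Order.TTheory GRing.Theory Num.Theory.

(* Model of computation: a random access machine over the natural numbers with
   structured control flow, under the logarithmic cost criterion (every number
   that is read, written, computed or used as an address is charged its binary
   length).  Its running time is polynomially related to that of multitape
   Turing machines. *)

Definition memory := nat -> nat.

Inductive binop := Add | Monus | Mul | Div.

Definition eval_binop (o : binop) : nat -> nat -> nat :=
  match o with
  | Add => addn
  | Monus => subn
  | Mul => muln
  | Div => divn
  end.

(* [Read e] is the content of the register whose address is the value of [e];
   nesting it gives indirect addressing. *)
Inductive expr :=
| Const of nat
| Read of expr
| Binop of binop & expr & expr.

(* [Assign a e] writes the value of [e] to the register addressed by the value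
   of [a]; a test succeeds when its value is nonzero. *)
Inductive program :=
| Skip
| Assign of expr & expr
| Seq of program & program
| If of expr & program & program
| While of expr & program.

Fixpoint eval (m : memory) (e : expr) : nat :=
  match e with
  | Const n => n
  | Read a => m (eval m a)
  | Binop o e1 e2 => eval_binop o (eval m e1) (eval m e2)
  end.

(* Number of binary digits, with [bitlen 0 = 1]. *)
Definition bitlen (n : nat) : nat := (trunc_log 2 n).+1.

(* Operands and addresses are charged as the values of the subexpressions. *)
Fixpoint expr_cost (m : memory) (e : expr) : nat :=
  bitlen (eval m e) +
  match e with
  | Const _ => 0
  | Read a => expr_cost m a
  | Binop _ e1 e2 => expr_cost m e1 + expr_cost m e2
  end.

Definition update (m : memory) (a v : nat) : memory :=
  fun x => if x == a then v else m x.

(* [exec p m t m']: started in memory [m], the program [p] halts after time [t]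
   in memory [m']. *)
Inductive exec : program -> memory -> nat -> memory -> Prop :=
| exec_Skip m : exec Skip m 1 m
| exec_Assign a e m :
    exec (Assign a e) m (1 + expr_cost m a + expr_cost m e)
      (update m (eval m a) (eval m e))
| exec_Seq p q m1 t1 m2 t2 m3 :
    exec p m1 t1 m2 -> exec q m2 t2 m3 -> exec (Seq p q) m1 (t1 + t2) m3
| exec_If_true b p q m t m' :
    eval m b != 0 -> exec p m t m' ->
    exec (If b p q) m (1 + expr_cost m b + t) m'
| exec_If_false b p q m t m' :
    eval m b = 0 -> exec q m t m' ->
    exec (If b p q) m (1 + expr_cost m b + t) m'
| exec_While_true b p m1 t1 m2 t2 m3 :
    eval m1 b != 0 -> exec p m1 t1 m2 -> exec (While b p) m2 t2 m3 ->
    exec (While b p) m1 (1 + expr_cost m1 b + t1 + t2) m3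
| exec_While_false b p m :
    eval m b = 0 -> exec (While b p) m (1 + expr_cost m b) m.

(* A finite sequence is held in memory as its length in register 0, followed by
   its items; all the other registers are initially 0. *)
Definition init_memory (s : seq nat) : memory := nth 0 (size s :: s).

Definition read_output (m : memory) : seq nat := mkseq (fun i => m i.+1) (m 0).

Definition runs (p : program) (inp : seq nat) (t : nat) (out : seq nat) : Prop :=
  exists2 m, exec p (init_memory inp) t m & read_output m = out.

Definition input_size (s : seq nat) : nat := \sum_(x <- s) bitlen x.

Definition polynomial_time (p : program) (dom : seq nat -> Prop) : Prop :=
  exists a k : nat, forall inp, dom inp ->
    exists t out, runs p inp t out /\ t <= a * input_size inp ^ k + a.

Lemma exec_det p m t1 m1 t2 m2 :
  exec p m t1 m1 -> exec p m t2 m2 -> t1 = t2 /\ m1 = m2.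
Proof.
move=> H; elim: H t2 m2 => {p m t1 m1}.
- by move=> m t2 m2 H; inversion H.
- by move=> a e m t2 m2 H; inversion H.
- move=> p q m1 t1 m2 t2 m3 _ IHp _ IHq t m H; inversion H; subst.
  match goal with Hp : exec p _ _ _, Hq : exec q _ _ _ |- _ =>
    by case: (IHp _ _ Hp) => ? ?; subst; case: (IHq _ _ Hq) => -> -> end.
- move=> b p q m t m' b1 _ IH t2 m2 H; inversion H; subst.
    by match goal with Hp : exec p _ _ _ |- _ => case: (IH _ _ Hp) => -> -> end.
  by match goal with Hb : eval m b = 0 |- _ => rewrite Hb in b1 end.
- move=> b p q m t m' b0 _ IH t2 m2 H; inversion H; subst.
    by match goal with Hb : is_true (eval m b != 0) |- _ => rewrite b0 in Hb end.
  by match goal with Hp : exec q _ _ _ |- _ => case: (IH _ _ Hp) => -> -> end.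
- move=> b p m1 t1 m2 t2 m3 b1 _ IHp _ IHw t m H; inversion H; subst.
    match goal with Hp : exec p _ _ _, Hq : exec (While b p) _ _ _ |- _ =>
      by case: (IHp _ _ Hp) => ? ?; subst; case: (IHw _ _ Hq) => -> -> end.
  by match goal with Hb : eval _ b = 0 |- _ => rewrite Hb in b1 end.
- move=> b p m b0 t m' H; inversion H; subst => //.
  by match goal with Hb : is_true (eval m b != 0) |- _ => rewrite b0 in Hb end.
Qed.

Local Open Scope ring_scope.

(* The ground set, the union of the facilities and the clients, is numbered
   0, ..., npts - 1.  A point may be both a facility and a client.  The values
   of [opening] outside [fac] are irrelevant. *)
Record instance := Instance {
  npts : nat;
  fac : {set 'I_npts};
  cli : {set 'I_npts};
  dist : 'I_npts -> 'I_npts -> rat;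
  opening : 'I_npts -> rat;
  oddset : {set 'I_npts};
  fac_cli_cover : fac :|: cli = [set: 'I_npts];
  dist_ge0 : forall x y, 0 <= dist x y;
  dist_eq0 : forall x y, dist x y = 0 <-> x = y;
  dist_sym : forall x y, dist x y = dist y x;
  dist_triangle : forall x y z, dist x z <= dist x y + dist y z;
  opening_ge0 : forall i, i \in fac -> 0 <= opening i;
  oddset_fac : oddset \subset fac
}.

(* A solution consists of the set [S] of open facilities and of an assignment
   [sigma], whose values outside the set of clients are irrelevant. *)
Definition feasible (I : instance) (S : {set 'I_(npts I)})
    (sigma : {ffun 'I_(npts I) -> 'I_(npts I)}) : Prop :=
  [/\ S \subset fac I,
      forall j, j \in cli I -> sigma j \in S
    & forall i, i \in S ->
        odd #|[set j in cli I | sigma j == i]| = (i \in oddset I)].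
Arguments feasible : clear implicits.

Definition cost (I : instance) (S : {set 'I_(npts I)})
    (sigma : {ffun 'I_(npts I) -> 'I_(npts I)}) : rat :=
  \sum_(i in S) opening i + \sum_(j in cli I) dist (sigma j) j.
Arguments cost : clear implicits.

Definition optimal (I : instance) (S : {set 'I_(npts I)})
    (sigma : {ffun 'I_(npts I) -> 'I_(npts I)}) : Prop :=
  feasible I S sigma /\
  forall S' sigma', feasible I S' sigma' -> cost I S sigma <= cost I S' sigma'.
Arguments optimal : clear implicits.

(* Nonnegative rationals are written as reduced fractions. *)
Definition encode_rat (q : rat) : seq nat := [:: `|numq q|%N; `|denq q|%N].

Definition encode_instance (I : instance) : seq nat :=
  npts I ::
  flatten [seq [:: nat_of_bool (i \in fac I); nat_of_bool (i \in cli I);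
                   nat_of_bool (i \in oddset I)]
               ++ encode_rat (if i \in fac I then opening i else 0)
          | i <- enum 'I_(npts I)] ++
  flatten [seq encode_rat (dist i j)
          | i <- enum 'I_(npts I), j <- enum 'I_(npts I)].

Definition encode_solution (n : nat) (S : {set 'I_n})
    (sigma : {ffun 'I_n -> 'I_n}) : seq nat :=
  [seq nat_of_bool (i \in S) | i <- enum 'I_n] ++
  [seq nat_of_ord (sigma j) | j <- enum 'I_n].

(* [A] is a polynomial-time [alpha]-approximation algorithm for the instances
   satisfying [P].  As programs are deterministic ([exec_det]), the two parts
   speak of the same run.  The optimum is attained since a given instance has
   finitely many solutions. *)
Definition approximation_algorithm (P : instance -> Prop) (alpha : rat)
    (A : program) : Prop :=
  polynomial_time A (fun inp => exists2 I, P I & inp = encode_instance I) /\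
  forall I, P I -> (exists S sigma, feasible I S sigma) ->
    exists t (S : {set 'I_(npts I)}) sigma,
      [/\ runs A (encode_instance I) t (encode_solution S sigma),
          feasible I S sigma
        & exists S' sigma', optimal I S' sigma' /\
                            cost I S sigma <= alpha * cost I S' sigma'].

(* Main.v *)
(** When every open facility serves an even number of clients, the clients can be
    paired so that partners share their facility.  The optimum therefore dominates
    the cost of a cheapest perfect matching of the clients as well as the optimum of
    ordinary facility location.  Conversely, given a set of facilities and a perfect
    matching, send both partners of each pair to the facility nearest to one of
    them: all the loads are even, and the triangle inequality bounds the cost by a
    constant times the sum of the two costs.

    Facilities are chosen by the Mettu-Plaxton greedy algorithm.  The matching comes
    from the Goemans-Williamson primal-dual scheme: balls grow around the components
    with an odd number of clients and merge when they meet.  The merging edges are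
    then examined in reverse order, an edge being kept if and only if it separates
    odd sets of yet unmatched clients, and kept edges are spliced into a matching.
    Distances are scaled to integers large enough for the rounding of radii and
    growths to cost only a constant factor.

    Running time is controlled once and for all by a language whose loops run [npts]
    times and whose assignments lengthen numbers by at most the input size. *)

Require Import Defs.
From mathcomp Require Import all_boot all_order all_algebra zify.

Set Implicit Arguments.
Unset Strict Implicit.
Unset Printing Implicit Defensive.

(** * Polynomial bounds and bit lengths *)

(** The constant is 20 = 2 * 6 + 4 * 2. Opening costs and nearest connections together are at most 6
    times the optimum; connections are counted twice because a redirected client also pays the
    connection of its partner. The computed pairing costs at most 4 times any other pairing, and
    pairing clients that share a facility costs, summed over the clients, at most twice their
    connections. Classically 6 and 4 would be 3 and 2; integer rounding accounts for the difference.
    The matching is analysed without forests or paths. While merges are undone in reverse, only the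
    current matching and the degrees of the kept edges are remembered: the triangle inequality lets
    one pair stand for a path, and the usual bound on average degrees becomes a potential inequality
    preserved by each undone merge. Both combinatorial arguments are stated for abstract labels,
    radii and edges; the program is shown afterwards to produce such data. *)

Inductive pexp := PX | PC of nat | PAdd of pexp & pexp | PMul of pexp & pexp
  | PComp of pexp & pexp.

Fixpoint peval (p : pexp) (x : nat) : nat :=
  match p with
  | PX => x
  | PC c => c
  | PAdd p q => peval p x + peval q x
  | PMul p q => peval p x * peval q x
  | PComp p q => peval p (peval q x)
  end.

Lemma peval_mono p x y : x <= y -> peval p x <= peval p y.
Proof.
elim: p x y => //= [p IHp q IHq|p IHp q IHq|p IHp q IHq] x y xy.
- by rewrite leq_add ?IHp ?IHq.
- by rewrite leq_mul ?IHp ?IHq.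
- exact/IHp/IHq.
Qed.

Lemma leq_expn a b c d : 0 < b -> a <= b -> c <= d -> a ^ c <= b ^ d.
Proof.
move=> b0 ab cd; apply: leq_trans (leq_pexp2l b0 cd).
by case: c {cd} => [|c] //; rewrite leq_exp2r.
Qed.

Lemma pevalE :
  ((forall x, peval PX x = x) * (forall c x, peval (PC c) x = c) *
   (forall p q x, peval (PAdd p q) x = (peval p x + peval q x)%N) *
   (forall p q x, peval (PMul p q) x = (peval p x * peval q x)%N) *
   (forall p q x, peval (PComp p q) x = peval p (peval q x)))%type.
Proof. by []. Qed.

(** Bounds of the form [(x + c) ^ c] are closed under sum, product and composition alike, so one
    induction covers all constructors. *)
Lemma peval_leq_exp p : exists c, forall x, peval p x <= (x + c) ^ c.
Proof.
elim: p => /= [|c|p [c Hc] q [d Hd]|p [c Hc] q [d Hd]|p [c Hc] q [d Hd]].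
- by exists 1 => x; lia.
- exists c.+1 => x; rewrite expnS.
  have : 0 < (x + c.+1) ^ c by rewrite expn_gt0; lia.
  nia.
- exists (c + d).+2 => x; set e := _.+2.
  have h1 : (x + c) ^ c <= (x + e) ^ (c + d) by apply: leq_expn; lia.
  have h2 : (x + d) ^ d <= (x + e) ^ (c + d) by apply: leq_expn; lia.
  have A2 : 2 <= x + e by lia.
  apply: (@leq_trans (2 * (x + e) ^ (c + d))); last first.
    by rewrite (_ : e = (c + d).+1.+1) // !expnS leq_mul // leq_pmull //; lia.
  by have := Hc x; have := Hd x; lia.
- exists (c + d) => x; apply: leq_trans (leq_mul (Hc x) (Hd x)) _.
  rewrite expnD; case: c {Hc} => [|c]; case: d {Hd} => [|d] //;
    by rewrite leq_mul // leq_expn //; lia.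
- exists (c + d + d.+1 * c).+2 => x; set e := _.+2.
  apply: leq_trans (Hc _) _.
  have A2 : 2 <= x + e by lia.
  have h : peval q x + c <= (x + e) ^ d.+1.
    have h1 : (x + d) ^ d <= (x + e) ^ d by apply: leq_expn; lia.
    have := Hd x; have : 0 < (x + e) ^ d by rewrite expn_gt0; lia.
    rewrite expnS; have : c + 2 <= x + e by lia.
    set A := x + e in h1 A2 *; set B := A ^ d in h1 *; nia.
  have -> // : (peval q x + c) ^ c <= (x + e) ^ e.
  apply: leq_trans (leq_expn _ h (leqnn c)) _; first by rewrite expn_gt0; lia.
  by rewrite -expnM leq_pexp2l //; lia.
Qed.

(** For [x > 0] one has [x + c <= c.+1 * x]; the additive term [a] takes care of [x = 0]. *)
Lemma peval_leq_poly p : exists a k, forall x, peval p x <= a * x ^ k + a.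
Proof.
have [c Hc] := peval_leq_exp p.
exists (c.+1 ^ c), c => x; apply: leq_trans (Hc x) _.
case: x => [|x]; first by rewrite add0n -[X in X <= _]add0n leq_add // leq_expn.
by apply: leq_trans (leq_addr _ _); rewrite -expnMn leq_expn //; nia.
Qed.

(** * Binary lengths of values and costs of expressions *)

Lemma bitlen_leq n b : 0 < b -> (bitlen n <= b) = (n < 2 ^ b).
Proof.
move=> b0; rewrite /bitlen; case: n => [|n]; first by rewrite trunc_log0 b0 expn_gt0.
apply/idP/idP => h.
  exact: leq_trans (trunc_log_ltn n.+1 (ltnSn 1)) (leq_pexp2l (ltn0Sn 1) h).
rewrite -(ltn_exp2l _ _ (ltnSn 1)); apply: leq_ltn_trans h.
exact: trunc_logP.
Qed.

Lemma ltn_bitlen n : n < 2 ^ bitlen n.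
Proof. by rewrite -bitlen_leq. Qed.

Lemma bitlen_mono m n : m <= n -> bitlen m <= bitlen n.
Proof. by move=> h; rewrite bitlen_leq //; apply: leq_ltn_trans (ltn_bitlen _). Qed.

Lemma bitlen_id n : bitlen n <= n.+1.
Proof. by rewrite bitlen_leq //; apply: ltn_trans (ltn_expl _ _). Qed.

Lemma bitlenD m n b : bitlen m <= b -> bitlen n <= b -> bitlen (m + n) <= b.+1.
Proof.
move=> hm hn; have b0 : 0 < b by apply: leq_trans hm.
by move: hm hn; rewrite !bitlen_leq // expnS; lia.
Qed.

Lemma bitlenM m n : bitlen (m * n) <= bitlen m + bitlen n.
Proof.
rewrite bitlen_leq ?addn_gt0 // expnD.
have := ltn_bitlen m; have := ltn_bitlen n.
case: m => [|m]; first by rewrite mul0n muln_gt0 !expn_gt0.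
by move=> h1 h2; apply: ltn_mul.
Qed.

Definition bounded_memory (b : nat) (m : memory) := forall j, bitlen (m j) <= b.

Fixpoint expr_weight (e : expr) : nat :=
  match e with
  | Const n => bitlen n
  | Read a => (expr_weight a).+1
  | Binop _ e1 e2 => (expr_weight e1 + expr_weight e2).+1
  end.

Lemma bitlen_eval m b e :
  0 < b -> bounded_memory b m -> bitlen (eval m e) <= expr_weight e * b.
Proof.
move=> b0 hm; elim: e => /= [n|a _|o e1 IH1 e2 IH2].
- by rewrite leq_pmulr.
- by rewrite mulSn; apply: leq_trans (hm _) (leq_addr _ _).
- rewrite mulSn mulnDl; case: o => /=.
  + by apply: leq_trans (bitlenD (leq_trans IH1 (leq_addr (expr_weight e2 * b) _))
     (leq_trans IH2 (leq_addl _ _))) _; rewrite -add1n leq_add2r.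
  + apply: leq_trans (bitlen_mono (leq_subr _ _)) _.
    by apply: leq_trans IH1 _; rewrite addnCA leq_addr.
  + apply: leq_trans (bitlenM _ _) _.
    by apply: leq_trans (leq_add IH1 IH2) (leq_addl _ _).
  + apply: leq_trans (bitlen_mono (leq_div _ _)) _.
    by apply: leq_trans IH1 _; rewrite addnCA leq_addr.
Qed.

(** An expression of weight [w] has at most [w] nodes, each with a value of at most [w * b] bits. *)
Lemma expr_cost_leq m b e :
  0 < b -> bounded_memory b m ->
  expr_cost m e <= (expr_weight e * expr_weight e) * b.
Proof.
move=> b0 hm; elim: e => [n|a IH|o e1 IH1 e2 IH2].
- by rewrite /= addn0 -mulnA leq_pmulr // muln_gt0 b0.
- have := bitlen_eval (Read a) b0 hm; rewrite /=.
  set w := expr_weight a in IH *; move: IH; set c := expr_cost m a; set x := bitlen _.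
  nia.
- have := bitlen_eval (Binop o e1 e2) b0 hm; rewrite /=.
  move: IH1 IH2; set w1 := expr_weight e1; set w2 := expr_weight e2.
  set c1 := expr_cost m e1; set c2 := expr_cost m e2; set x := bitlen _.
  nia.
Qed.

(** * A language of bounded loops and its compilation *)

(** A Hoare triple for total correctness with a time budget; the rules below add up budgets and hide
    exact running times. *)
Definition reaches (p : program) (m : memory) (T : nat) (Q : memory -> Prop) :=
  exists t m', [/\ exec p m t m', t <= T & Q m'].

Lemma reaches_weak p m T T' (Q Q' : memory -> Prop) :
  reaches p m T Q -> T <= T' -> (forall m', Q m' -> Q' m') -> reaches p m T' Q'.
Proof.
move=> [t [m' [hp ht hQ]]] hT hQQ'; exists t, m'.
by split; [|apply: leq_trans hT|apply: hQQ'].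
Qed.

Lemma reaches_seq p q m T1 T2 (Q1 Q2 : memory -> Prop) :
  reaches p m T1 Q1 -> (forall m', Q1 m' -> reaches q m' T2 Q2) ->
  reaches (Seq p q) m (T1 + T2) Q2.
Proof.
move=> [t1 [m1 [h1 l1 q1]]] /(_ _ q1) [t2 [m2 [h2 l2 q2]]].
by exists (t1 + t2), m2; split; [exact: exec_Seq h1 h2|exact: leq_add|].
Qed.

Definition cost_weight (e : expr) := expr_weight e * expr_weight e.

Lemma reaches_assign a e m b (Q : memory -> Prop) :
  0 < b -> bounded_memory b m -> Q (update m (eval m a) (eval m e)) ->
  reaches (Assign a e) m (1 + (cost_weight a + cost_weight e) * b) Q.
Proof.
move=> b0 hb hQ; do 2!eexists; split; [exact: exec_Assign| |exact: hQ].
by rewrite mulnDl -addnA leq_add2l leq_add ?expr_cost_leq.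
Qed.

(** [T] bounds a test and a body separately, hence the factor 2; the extra round pays for the final
    failing test. *)
Lemma reaches_while b p n T (Inv : nat -> memory -> Prop) m :
  (forall i m', i < n -> Inv i m' ->
     eval m' b != 0 /\ reaches p m' T (Inv i.+1)) ->
  (forall i m', i <= n -> Inv i m' -> 1 + expr_cost m' b <= T) ->
  (forall m', Inv n m' -> eval m' b = 0) ->
  Inv 0 m -> reaches (While b p) m ((n.+1 * 2) * T) (Inv n).
Proof.
move=> hI hT h0 I0.
suff H j : forall i m', i + j = n -> Inv i m' ->
    reaches (While b p) m' ((j.+1 * 2) * T) (Inv n).
  by apply: H I0.
elim: j => [|j IH] i m' ij Ii.
  have En : i = n by lia.
  subst i; exists (1 + expr_cost m' b), m'; split => //.
    by apply: exec_While_false; apply: h0.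
  by have := hT _ _ (leqnn n) Ii; nia.
have [bi [t1 [m1 [e1 l1 I1]]]] := hI i m' ltac:(lia) Ii.
have [t2 [m2 [e2 l2 I2]]] := IH i.+1 m1 ltac:(lia) I1.
exists (1 + expr_cost m' b + t1 + t2), m2; split => //.
  exact: exec_While_true e1 e2.
have := hT i m' ltac:(lia) Ii; nia.
Qed.

Lemma reaches_if b p q m B T (Q : memory -> Prop) :
  0 < B -> bounded_memory B m ->
  reaches (if eval m b != 0 then p else q) m T Q ->
  reaches (If b p q) m (1 + cost_weight b * B + T) Q.
Proof.
move=> B0 hB [t [m' [he ht hQ]]]; exists (1 + expr_cost m b + t), m'.
split => //; last by rewrite leq_add // leq_add2l expr_cost_leq.
case: eqP he => hb he; first by apply: exec_If_false.
by apply: exec_If_true => //; apply/eqP.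
Qed.

(* [Var] is a loop variable given by its de Bruijn level, [Inp] an input register
   (the index is truncated to the input length), [Arr t] an array and [Sum] a sum over
   0 <= i < npts.  [Op Mul] truncates its right operand to the length of the input
   and [MulInp e1 e2] is [e1 * Inp e2]: hence an operation adds at most the input
   size to the bit length of its operands, which bounds all numbers by counting
   assignments. *)
Inductive dexp :=
| Lit of nat
| Var of nat
| Inp of dexp
| Arr of nat & dexp
| Op of binop & dexp & dexp
| MulInp of dexp & dexp
| Sum of dexp.

Inductive cmd :=
| Set_ of nat & dexp & dexp
| Then of cmd & cmd
| When of dexp & cmd
| For of cmd.

Definition store := nat -> nat -> nat.

Definition upd (st : store) (t i v : nat) : store :=
  fun t' i' => if (t' == t) && (i' == i) then v else st t' i'.

(** Truncating the index makes the value of [Inp] independent of the arrays stored beyond the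
    input. *)
Definition reg (s : seq nat) (j : nat) : nat := nth 0 (size s :: s) (minn j (size s)).

Definition eval_op (s : seq nat) (o : binop) (x y : nat) : nat :=
  match o with
  | Mul => x * minn y (size s)
  | _ => eval_binop o x y
  end.

Fixpoint ev (s : seq nat) (st : store) (env : seq nat) (e : dexp) : nat :=
  match e with
  | Lit n => n
  | Var i => nth 0 env i
  | Inp e => reg s (ev s st env e)
  | Arr t e => st t (ev s st env e)
  | Op o e1 e2 => eval_op s o (ev s st env e1) (ev s st env e2)
  | MulInp e1 e2 => ev s st env e1 * reg s (ev s st env e2)
  | Sum e => \sum_(i < nth 0 s 0) ev s st (rcons env i) e
  end.

Definition iter_for (n : nat) (f : nat -> store -> store) (st : store) : store :=
  foldl (fun st i => f i st) st (iota 0 n).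

Fixpoint run (s : seq nat) (env : seq nat) (c : cmd) (st : store) : store :=
  match c with
  | Set_ t e1 e2 => upd st t (ev s st env e1) (ev s st env e2)
  | Then c1 c2 => run s env c2 (run s env c1 st)
  | When e c => if ev s st env e != 0 then run s env c st else st
  | For c => iter_for (nth 0 s 0) (fun i => run s (rcons env i) c) st
  end.

Fixpoint wfe (k : nat) (e : dexp) : bool :=
  match e with
  | Lit _ => true
  | Var i => i < k
  | Inp e | Arr _ e => wfe k e
  | Op _ e1 e2 | MulInp e1 e2 => wfe k e1 && wfe k e2
  | Sum e => wfe k.+1 e
  end.

Fixpoint wfc (k : nat) (c : cmd) : bool :=
  match c with
  | Set_ _ e1 e2 => wfe k e1 && wfe k e2
  | Then c1 c2 => wfc k c1 && wfc k c2
  | When e c => wfe k e && wfc k c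
  | For c => wfc k.+1 c
  end.

(* Item [i] of array [t] is stored at [size s + (2 * i + 1) * 2 ^ t]; array 0 holds
   temporaries, array 1 the loop variables and array [t.+2] the program array [t]. *)
Definition loc (t : nat) (i : expr) : expr :=
  Binop Add (Read (Const 0))
    (Binop Mul (Binop Add (Binop Mul (Const 2) i) (Const 1)) (Const (2 ^ t))).

Definition tmp (d : nat) : expr := loc 0 (Const d).
Definition loopvar (k : nat) : expr := loc 1 (Const k).
(** Register 0 holds [size s], so the double truncated subtraction is the minimum of [e] and
    [size s]. *)
Definition cap (e : expr) : expr := Binop Monus e (Binop Monus e (Read (Const 0))).
Definition more (k : nat) : expr := Binop Monus (Read (Const 1)) (Read (loopvar k)).
Definition next (k : nat) : program :=
  Assign (loopvar k) (Binop Add (Read (loopvar k)) (Const 1)).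

Definition op_expr (o : binop) (x y : expr) : expr :=
  match o with
  | Mul => Binop Mul x (cap y)
  | _ => Binop o x y
  end.

(** [k] counts the loop variables in use and [d] the temporaries: the value goes to temporary [d],
    those below [d] are preserved, and [Sum] borrows loop variable [k]. *)
Fixpoint ce (k d : nat) (e : dexp) : program :=
  match e with
  | Lit n => Assign (tmp d) (Const n)
  | Var i => Assign (tmp d) (Read (loopvar i))
  | Inp e => Seq (ce k d e) (Assign (tmp d) (Read (cap (Read (tmp d)))))
  | Arr t e => Seq (ce k d e) (Assign (tmp d) (Read (loc t.+2 (Read (tmp d)))))
  | Op o e1 e2 => Seq (ce k d e1) (Seq (ce k d.+1 e2)
      (Assign (tmp d) (op_expr o (Read (tmp d)) (Read (tmp d.+1)))))
  | MulInp e1 e2 => Seq (ce k d e1) (Seq (ce k d.+1 e2)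
      (Assign (tmp d)
         (Binop Mul (Read (tmp d)) (Read (cap (Read (tmp d.+1)))))))
  | Sum e => Seq (Assign (tmp d) (Const 0)) (Seq (Assign (loopvar k) (Const 0))
      (While (more k) (Seq (ce k.+1 d.+1 e)
        (Seq (Assign (tmp d) (Binop Add (Read (tmp d)) (Read (tmp d.+1))))
             (next k)))))
  end.

Fixpoint cc (k : nat) (c : cmd) : program :=
  match c with
  | Set_ t e1 e2 => Seq (ce k 0 e1) (Seq (ce k 1 e2)
      (Assign (loc t.+2 (Read (tmp 0))) (Read (tmp 1))))
  | Then c1 c2 => Seq (cc k c1) (cc k c2)
  | When e c => Seq (ce k 0 e) (If (Read (tmp 0)) (cc k c) Skip)
  | For c => Seq (Assign (loopvar k) (Const 0))
      (While (more k) (Seq (cc k.+1 c) (next k)))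
  end.

(** * Representation of inputs, loop variables and arrays in memory *)

Definition addr (s : seq nat) (t i : nat) : nat := size s + (2 * i + 1) * 2 ^ t.

Lemma addr_gt s t i : size s < addr s t i.
Proof. by rewrite /addr -addn1 leq_add2l muln_gt0 expn_gt0 addn1. Qed.

(** The exponent of 2 in [(2 * i + 1) * 2 ^ t] recovers [t], and the odd part recovers [i]:
    unbounded arrays coexist without overlap. *)
Lemma addr_inj s t i t' i' : addr s t i = addr s t' i' -> t = t' /\ i = i'.
Proof.
move=> /addnI h.
have l2 j u : logn 2 ((2 * j + 1) * 2 ^ u) = u.
  rewrite lognM ?expn_gt0 ?addn1 // pfactorK // (_ : logn _ _ = 0) //.
  by apply: logn_coprime; rewrite coprime2n /= mul2n odd_double.
have tt : t = t' by rewrite -(l2 i t) h l2.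
split=> //; move: h; rewrite tt => /eqP.
by rewrite eqn_pmul2r ?expn_gt0 // => /eqP; lia.
Qed.

Lemma addr_eq s t i t' i' : (addr s t i == addr s t' i') = (t == t') && (i == i').
Proof.
apply/eqP/andP => [/addr_inj [-> ->] //|[/eqP -> /eqP ->]//].
Qed.

(** Array 0 is left unconstrained, since temporaries carry no meaning between commands. *)
Definition rep (s env : seq nat) (st : store) (m : memory) : Prop :=
  [/\ forall j, j <= size s -> m j = nth 0 (size s :: s) j,
      forall i, i < size env -> m (addr s 1 i) = nth 0 env i
    & forall t i, m (addr s t.+2 i) = st t i].

Lemma eval_read m a : eval m (Read a) = m (eval m a).
Proof. by []. Qed.

Lemma eval_binopE m o e1 e2 :
  eval m (Binop o e1 e2) = eval_binop o (eval m e1) (eval m e2).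
Proof. by []. Qed.

Lemma rep0 s env st m : rep s env st m -> m 0 = size s.
Proof. by case=> h _ _; rewrite h. Qed.

Lemma eval_loc s env st m t e :
  rep s env st m -> eval m (loc t e) = addr s t (eval m e).
Proof. by move=> /rep0 h /=; rewrite h. Qed.

Lemma eval_tmp s env st m d : rep s env st m -> eval m (tmp d) = addr s 0 d.
Proof. by move=> /eval_loc h; rewrite h. Qed.

Lemma eval_loopvar s env st m d : rep s env st m -> eval m (loopvar d) = addr s 1 d.
Proof. by move=> /eval_loc h; rewrite h. Qed.

Lemma eval_cap s env st m e :
  rep s env st m -> eval m (cap e) = minn (eval m e) (size s).
Proof. by move=> /rep0 h /=; rewrite h; lia. Qed.

Lemma rep_reg s env st m j : rep s env st m -> m (minn j (size s)) = reg s j.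
Proof. by case=> h _ _; rewrite h // geq_minr. Qed.

Lemma rep_update s env st m a v :
  rep s env st m -> size s < a ->
  (forall i, i < size env -> a != addr s 1 i) ->
  (forall t i, a != addr s t.+2 i) -> rep s env st (update m a v).
Proof.
move=> [h1 h2 h3] ha ne1 ne2; split=> [j hj|i hi|t i]; rewrite /update.
- by case: eqP => [?|_]; [lia|exact: h1].
- by rewrite eq_sym (negbTE (ne1 _ hi)) h2.
- by rewrite eq_sym (negbTE (ne2 _ _)) h3.
Qed.

Lemma rep_tmp s env st m d v :
  rep s env st m -> rep s env st (update m (addr s 0 d) v).
Proof.
by move=> h; apply: rep_update => //; rewrite ?addr_gt // => *; rewrite addr_eq.
Qed.

Lemma rep_loopvar s env st m v :
  rep s env st m -> rep s (rcons env v) st (update m (addr s 1 (size env)) v).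
Proof.
move=> [h1 h2 h3]; split=> [j hj|i|t i]; rewrite /update.
- by case: eqP => [?|_]; [have := addr_gt s 1 (size env); lia|exact: h1].
- by rewrite size_rcons ltnS addr_eq /= nth_rcons; case: ltngtP => // + _; apply: h2.
- by rewrite addr_eq h3.
Qed.

Lemma rep_loopvar_next s env st m v w :
  rep s (rcons env v) st m ->
  rep s (rcons env w) st (update m (addr s 1 (size env)) w).
Proof.
move=> [h1 h2 h3]; split=> [j hj|i|t i]; rewrite /update.
- by case: eqP => [?|_]; [have := addr_gt s 1 (size env); lia|exact: h1].
- rewrite size_rcons ltnS addr_eq /= nth_rcons; case: ltngtP => // hi _.
  by rewrite h2 ?size_rcons ?nth_rcons ?hi // ltnS ltnW.
- by rewrite addr_eq h3.
Qed.

Lemma rep_rcons s env st m v : rep s (rcons env v) st m -> rep s env st m.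
Proof.
move=> [h1 h2 h3]; split=> // i hi.
by rewrite h2 ?size_rcons ?nth_rcons ?hi // ltnS ltnW.
Qed.

Lemma rep_loopvarE s env st m v :
  rep s (rcons env v) st m -> m (addr s 1 (size env)) = v.
Proof. by case=> _ h _; rewrite h ?size_rcons // nth_rcons ltnn eqxx. Qed.

Lemma rep_set s env st m t i v :
  rep s env st m -> rep s env (upd st t i v) (update m (addr s t.+2 i) v).
Proof.
move=> [h1 h2 h3]; split=> [j hj|j hj|t' i']; rewrite /update.
- by case: eqP => [?|_]; [have := addr_gt s t.+2 i; lia|exact: h1].
- by rewrite addr_eq h2.
- by rewrite addr_eq h3 /upd !eqSS.
Qed.

Lemma bounded_weak b b' m : b <= b' -> bounded_memory b m -> bounded_memory b' m.
Proof. by move=> h hm j; apply: leq_trans (hm j) h. Qed.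

Lemma bounded_update b b' m a v :
  bounded_memory b m -> b <= b' -> bitlen v <= b' -> bounded_memory b' (update m a v).
Proof.
by move=> hm h hv j; rewrite /update; case: eqP => // _; apply: leq_trans (hm j) h.
Qed.

Arguments bounded_update {b b' m a v}.

Lemma size_leq_input s : size s <= input_size s.
Proof.
rewrite /input_size; elim: s => [|x s IH] //=.
by rewrite big_cons -add1n leq_add.
Qed.

Lemma bitlen_input s x : x \in s -> bitlen x <= input_size s.
Proof.
rewrite /input_size => xs; rewrite (big_rem x) //=; exact: leq_addr.
Qed.

Lemma bitlen_reg s j : bitlen (reg s j) <= (input_size s).+1.
Proof.
rewrite /reg; case: (minn j (size s)) (geq_minr j (size s)) => [|i] /= hi.
  by apply: leq_trans (bitlen_id _) _; rewrite ltnS size_leq_input.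
by apply: leqW; apply: bitlen_input; rewrite mem_nth.
Qed.

Lemma bitlen_size s x : x <= size s -> bitlen x <= (input_size s).+1.
Proof.
move=> h; apply: leq_trans (bitlen_id _) _; rewrite ltnS.
exact: leq_trans h (size_leq_input s).
Qed.

(* Loops run [nth 0 s 0] times, which must be polynomial in the input size. *)
Definition good_input (s : seq nat) := 0 < size s /\ nth 0 s 0 <= size s.

(** * Correctness and running time of compiled expressions *)

Definition ce_post s env st (m : memory) d e b (m' : memory) :=
  [/\ rep s env st m', m' (addr s 0 d) = ev s st env e,
      forall j, j < d -> m' (addr s 0 j) = m (addr s 0 j) & bounded_memory b m'].

(** The growth [peval g (input_size s)] of the bit bound does not depend on [b]. Hence loops add up
    growths instead of compounding them, and lengths stay polynomial. *)
Definition ce_spec k d e := exists g h : pexp,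
  forall s env st m b, size env = k -> good_input s -> rep s env st m ->
    0 < b -> bounded_memory b m ->
    reaches (ce k d e) m (peval h (input_size s + b))
      (ce_post s env st m d e (b + peval g (input_size s))).

Lemma ce_unary k d e e' (x : expr) :
  ce k d e' = Seq (ce k d e) (Assign (tmp d) x) ->
  ce_spec k d e ->
  (forall s env st m, size env = k -> rep s env st m ->
    m (addr s 0 d) = ev s st env e -> eval m x = ev s st env e') ->
  (exists g0, forall s env st m b, rep s env st m -> bounded_memory b m ->
    bitlen (eval m x) <= b + peval g0 (input_size s)) ->
  ce_spec k d e'.
Proof.
move=> E [g [h H]] hx [g0 hg0]; exists (PAdd g g0).
exists (PAdd h (PAdd (PC 1) (PMul (PC (cost_weight (tmp d) + cost_weight x))
  (PAdd PX g)))) => s env st m b hk hs hr b0 hb; rewrite E.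
set L := input_size s.
apply: reaches_weak (reaches_seq (H _ _ _ _ _ hk hs hr b0 hb) _) _ _; last first.
- by move=> m' Q; exact: Q.
- by rewrite /=; apply: leqnn.
move=> m1 [r1 v1 o1 b1] /=.
have b1' : bounded_memory (L + b + peval g (L + b)) m1.
  by apply: bounded_weak b1; have := @peval_mono g L (L + b) (leq_addr _ _); rewrite /L; lia.
apply: reaches_assign => //; first by lia.
split.
- by rewrite (eval_tmp _ r1); apply: rep_tmp.
- by rewrite (eval_tmp _ r1) /update eqxx (hx _ _ _ _ hk r1).
- by move=> j hj; rewrite (eval_tmp _ r1) /update addr_eq /= ltn_eqF // o1.
- apply: (bounded_update b1); first by rewrite leq_add2l leq_addr.
  by have := hg0 _ _ _ _ _ r1 b1; rewrite addnA.
Qed.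

Lemma ce_binary k d e1 e2 e' (x : expr) :
  ce k d e' = Seq (ce k d e1) (Seq (ce k d.+1 e2) (Assign (tmp d) x)) ->
  ce_spec k d e1 -> ce_spec k d.+1 e2 ->
  (forall s env st m, size env = k -> rep s env st m ->
    m (addr s 0 d) = ev s st env e1 -> m (addr s 0 d.+1) = ev s st env e2 ->
    eval m x = ev s st env e') ->
  (exists g0, forall s env st m b, rep s env st m -> bounded_memory b m ->
    bitlen (eval m x) <= b + peval g0 (input_size s)) ->
  ce_spec k d e'.
Proof.
move=> E [g1 [h1 H1]] [g2 [h2 H2]] hx [g0 hg0]; exists (PAdd (PAdd g1 g2) g0).
exists (PAdd h1 (PAdd (PComp h2 (PAdd PX g1)) (PAdd (PC 1)
  (PMul (PC (cost_weight (tmp d) + cost_weight x))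
  (PAdd PX (PAdd g1 g2)))))) => s env st m b hk hs hr b0 hb; rewrite E.
set L := input_size s.
apply: reaches_weak (reaches_seq (H1 _ _ _ _ _ hk hs hr b0 hb) _) _ _; last first.
- by move=> m' Q; exact: Q.
- by rewrite /=; apply: leqnn.
move=> m1 [r1 v1 o1 b1] /=.
have m1g := @peval_mono g1 L (L + b) (leq_addr _ _).
have m2g := @peval_mono g2 L (L + b) (leq_addr _ _).

have T1 : peval h2 (L + (b + peval g1 L)) <= peval h2 (L + b + peval g1 (L + b)).
  by apply: peval_mono; lia.
apply: reaches_weak (reaches_seq (H2 _ _ _ _ _ hk hs r1 (ltn_addr _ b0) b1) _) _ _; last first.
- by move=> m' Q; exact: Q.
- by apply: leq_add; [exact: T1|exact: leqnn].
move=> m2 [r2 v2 o2 b2] /=.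
have b2' : bounded_memory (L + b + (peval g1 (L + b) + peval g2 (L + b))) m2.
  by apply: bounded_weak b2; move: m1g m2g; rewrite /L; lia.
apply: reaches_assign => //; first by lia.
split.
- by rewrite (eval_tmp _ r2); apply: rep_tmp.
- by rewrite (eval_tmp _ r2) /update eqxx (hx _ _ _ _ hk r2 _ v2) // o2.
- move=> j hj; rewrite (eval_tmp _ r2) /update addr_eq /= ltn_eqF // o2 ?o1 //.
  exact: ltnW.
- apply: (bounded_update b2); first by rewrite /L /=; lia.
  by have := hg0 _ _ _ _ _ r2 b2; rewrite /L /=; lia.
Qed.

Lemma eval_more s env st m v :
  good_input s -> rep s (rcons env v) st m -> eval m (more (size env)) = nth 0 s 0 - v.
Proof.
move=> [s0 _] r; have [h _ _] := r.
rewrite [LHS]/(m 1 - m (eval m (loopvar (size env)))).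
by rewrite (eval_loopvar _ r) (rep_loopvarE r) h.
Qed.

Lemma leq_cost a c d : 0 < d -> c <= d -> 1 + a * c <= (1 + a) * d.
Proof. by move=> d0 cd; rewrite mulnDl mul1n leq_add // leq_mul2l cd orbT. Qed.

Lemma ce_correct e : forall k d, wfe k e -> ce_spec k d e.
Proof.
elim: e => [n|i|e IH|t e IH|o e1 IH1 e2 IH2|e1 IH1 e2 IH2|e IH] k d wf.
- exists (PC (bitlen n)), (PAdd (PC 1)
    (PMul (PC (cost_weight (tmp d) + cost_weight (Const n))) PX)).
  move=> s env st m b hk hs hr b0 hb /=.
  apply: (reaches_weak (T := 1 + (cost_weight (tmp d) + cost_weight (Const n)) * b)
    (Q := ce_post s env st m d (Lit n) (b + bitlen n))) => //;
    last by rewrite leq_add2l leq_mul2l leq_addl orbT.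
  apply: reaches_assign => //; rewrite (eval_tmp _ hr); split => /=.
  + exact: rep_tmp.
  + by rewrite /update eqxx.
  + by move=> j hj; rewrite /update addr_eq /= ltn_eqF.
  + by apply: (bounded_update hb); lia.
- exists (PC 0), (PAdd (PC 1)
    (PMul (PC (cost_weight (tmp d) + cost_weight (Read (loopvar i)))) PX)).
  move=> s env st m b hk hs hr b0 hb.
  apply: (reaches_weak
    (T := 1 + (cost_weight (tmp d) + cost_weight (Read (loopvar i))) * b)
    (Q := ce_post s env st m d (Var i) (b + 0))) => //;
    last by rewrite leq_add2l leq_mul2l leq_addl orbT.
  have [_ h2 _] := hr.
  apply: reaches_assign => //; rewrite (eval_tmp _ hr).
  rewrite eval_read (eval_loopvar _ hr); split.
  + exact: rep_tmp.
  + by rewrite /update eqxx h2 ?hk.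
  + by move=> j hj; rewrite /update addr_eq /= ltn_eqF.
  + by apply: (bounded_update hb); [lia|rewrite addn0].
- apply: (ce_unary (e := e) (x := Read (cap (Read (tmp d))))) => //.
  + exact: IH.
  + move=> s env st m hk hr hd.
    rewrite eval_read (eval_cap _ hr) eval_read (eval_tmp _ hr) hd.
    exact: (rep_reg _ hr).
  + by exists (PC 0) => s env st m b _ hb; rewrite eval_read addn0; exact: hb.
- apply: (ce_unary (e := e) (x := Read (loc t.+2 (Read (tmp d))))) => //.
  + exact: IH.
  + move=> s env st m hk hr hd; have [_ _ h3] := hr.
    rewrite eval_read (eval_loc _ _ hr) eval_read (eval_tmp _ hr) hd.
    exact: h3.
  + by exists (PC 0) => s env st m b _ hb; rewrite eval_read addn0; exact: hb.
- move: wf => /andP [wf1 wf2].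
  apply: (ce_binary (e1 := e1) (e2 := e2)) => //; [exact: IH1|exact: IH2| |].
  + move=> s env st m hk hr hd hd1.
    have E j : eval m (Read (tmp j)) = m (addr s 0 j).
      by rewrite eval_read (eval_tmp _ hr).
    have := eval_cap (Read (tmp d.+1)) hr; have := E d; have := E d.+1.
    rewrite hd hd1 => E1 E2 E3.
    by case: o; rewrite [op_expr _ _ _]/= eval_binopE E2 ?E1 // E3 E1.
  + exists (PAdd PX (PC 1)) => s env st m b hr hb.
    have E j : eval m (Read (tmp j)) = m (addr s 0 j).
      by rewrite eval_read (eval_tmp _ hr).
    have E3 := eval_cap (Read (tmp d.+1)) hr.
    case: o; rewrite [op_expr _ _ _]/= eval_binopE ?E3 !E.
    * apply: leq_trans (bitlenD (hb _) (hb _)) _; rewrite /=; lia.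
    * by apply: leq_trans (bitlen_mono (leq_subr _ _)) (leq_trans (hb _) (leq_addr _ _)).
    * apply: leq_trans (bitlenM _ _) _; apply: leq_add; first exact: hb.
      by rewrite /= addn1 bitlen_size // geq_minr.
    * by apply: leq_trans (bitlen_mono (leq_div _ _)) (leq_trans (hb _) (leq_addr _ _)).
- move: wf => /andP [wf1 wf2].
  apply: (ce_binary (e1 := e1) (e2 := e2)) => //; [exact: IH1|exact: IH2| |].
  + move=> s env st m hk hr hd hd1.
    have E j : eval m (Read (tmp j)) = m (addr s 0 j).
      by rewrite eval_read (eval_tmp _ hr).
    by rewrite eval_binopE E eval_read (eval_cap _ hr) E hd hd1 (rep_reg _ hr).
  + exists (PAdd PX (PC 1)) => s env st m b hr hb.
    rewrite eval_binopE [eval m (Read (cap _))]eval_read (eval_cap _ hr) (rep_reg _ hr).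
    apply: leq_trans (bitlenM _ _) _; apply: leq_add; first exact: hb.
    by apply: leq_trans (bitlen_reg _ _) _; rewrite [peval _ _]/=; lia.
- have [g [h H]] := IH k.+1 d.+1 wf.
  (* Each of at most [input_size s] rounds adds the growth of the term and one bit for the
     accumulation; [PX + 2] leaves room for the loop counter. *)
  pose gm := PAdd (PAdd PX (PC 2)) (PMul PX (PAdd g (PC 1))).
  pose W := PAdd PX gm.
  pose a1 := Binop Add (Read (tmp d)) (Read (tmp d.+1)).
  pose a2 := Binop Add (Read (loopvar k)) (Const 1).
  pose c0 := 1 + (cost_weight (tmp d) + cost_weight (Const 0)).
  pose c1 := 1 + (cost_weight (tmp d) + cost_weight a1).
  pose c2 := 1 + (cost_weight (loopvar k) + cost_weight a2).
  pose c3 := 1 + (cost_weight (loopvar k) + cost_weight (Const 0)).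
  pose c4 := 1 + cost_weight (more k).
  (* One bound for both the body and the test, as [reaches_while] requires; [c4] pays for the
     test. *)
  pose T := PAdd (PComp h (PAdd PX W))
    (PAdd (PMul (PC c1) W) (PAdd (PMul (PC c2) W) (PMul (PC c4) W))).
  exists gm, (PAdd (PMul (PC c0) W) (PAdd (PMul (PC c3) W)
    (PMul (PMul (PAdd PX (PC 1)) (PC 2)) T))).
  move=> s env st m b hk hs hr b0 hb; set L := input_size s; set X := L + b.
  have [s0 nL'] := hs.
  set n := nth 0 s 0 in nL'.
  have nL : n <= L by apply: leq_trans nL' (size_leq_input s).
  pose G := peval g L + 1.
  pose bd i := b + (L + 2) + i * G.
  have gX : peval g L <= peval g X by apply: peval_mono; apply: leq_addr.
  have bdn i : i <= n -> bd i <= b + peval gm L.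
    move=> hi; rewrite /bd [peval gm L]/= -/G -addnA leq_add2l leq_add2l.
    by rewrite leq_mul2r (leq_trans hi nL) orbT.
  have gmX : peval gm L <= peval gm X by apply: peval_mono; apply: leq_addr.
  have bdW i : i <= n -> bd i <= peval W X.
    by move=> /bdn; rewrite [peval W X]/=; move: gmX; rewrite /X [peval gm _]/= [peval gm _]/=; lia.
  have W1 : 1 <= peval W X by rewrite /= /X; lia.
  pose Inv i (m' : memory) := [/\ rep s (rcons env i) st m',
    m' (addr s 0 d) = \sum_(j < i) ev s st (rcons env j) e,
    forall j, j < d -> m' (addr s 0 j) = m (addr s 0 j)
    & bounded_memory (bd i) m'].
  apply: (reaches_weak (T := c0 * peval W X + (c3 * peval W X +
     (n.+1 * 2) * peval T X)) (Q := Inv n)); last first.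
  + move=> m' [r1 v1 o1 b1]; split => //; first exact: rep_rcons r1.
    exact: bounded_weak (bdn _ (leqnn n)) b1.
  + rewrite -[peval (PAdd _ _) _]/(c0 * peval W X + (c3 * peval W X +
     ((X + 1) * 2) * peval T X)) !leq_add2l leq_mul2r; apply/orP; right.
    by rewrite leq_mul2r /= addn1 ltnS (leq_trans nL) // leq_addr.
  rewrite [ce _ _ _]/=.
  apply: (reaches_seq (Q1 := fun m' => [/\ rep s env st m', m' (addr s 0 d) = 0,
    forall j, j < d -> m' (addr s 0 j) = m (addr s 0 j) & bounded_memory (bd 0) m'])).
  + apply: (reaches_weak (T := 1 + (cost_weight (tmp d) + cost_weight (Const 0)) * b));
      [apply: reaches_assign => // | | by move=> ? Q; exact: Q].
    * rewrite (eval_tmp _ hr); split.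
      - exact: rep_tmp.
      - by rewrite /update eqxx.
      - by move=> j hj; rewrite /update addr_eq /= ltn_eqF.
      - apply: (bounded_update hb); rewrite /bd /=; first by lia.
        by apply: leq_trans (bitlen_id _) _; lia.
    * rewrite /c0; apply: leq_cost => //; rewrite /W /= /X; lia.
  move=> m1 [r1 v1 o1 b1].
  apply: (reaches_seq (Q1 := Inv 0)).
  + apply: (reaches_weak (T := 1 + (cost_weight (loopvar k) + cost_weight (Const 0)) * bd 0));
      [apply: reaches_assign => // | | by move=> ? Q; exact: Q].
    * by rewrite /bd; lia.
    * rewrite (eval_loopvar _ r1) -hk; split.
      - exact: rep_loopvar.
      - by rewrite /update addr_eq /= big_ord0.
      - by move=> j hj; rewrite /update addr_eq /= o1.
      - apply: (bounded_update b1); rewrite /bd /=; first by lia.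
        by apply: leq_trans (bitlen_id _) _; lia.
    * by rewrite /c3; apply: leq_cost; rewrite ?bdW.
  move=> m2 I2.
  apply: reaches_while I2.
  + move=> i m3 hi [r3 v3 o3 b3]; split.
      by rewrite -hk (eval_more hs r3) -/n; lia.
    have hk1 : size (rcons env i) = k.+1 by rewrite size_rcons hk.
    have hbi : bd i <= peval W X by apply: bdW; lia.
    have TH : peval h (L + bd i) <= peval h (X + peval W X).
      by apply: peval_mono; apply: leq_add => //; apply: leq_addr.
    apply: (reaches_weak (T := peval h (L + bd i) +
      ((1 + (cost_weight (tmp d) + cost_weight a1) * (bd i + peval g L))
      + (1 + (cost_weight (loopvar k) + cost_weight a2) * bd i.+1)))
      (Q := Inv i.+1)) => //; last first.
      have bi1 : bd i + peval g L <= peval W X.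
        by apply: leq_trans (bdW _ hi); rewrite /bd mulSn /G; lia.
      have bi2 := bdW _ hi.
      change (peval T X) with (peval h (X + peval W X) + (c1 * peval W X +
         (c2 * peval W X + c4 * peval W X))).
      apply: leq_add => //; rewrite [X in _ <= X]addnA; apply: leq_trans (leq_addr _ _).
      by rewrite /c1 /c2; apply: leq_add; apply: leq_cost.
    have bi0 : 0 < bd i by rewrite /bd; lia.
    apply: reaches_seq (H _ _ _ _ _ hk1 hs r3 bi0 b3) _.
    move=> m4 [r4 v4 o4 b4].
    apply: (reaches_seq (Q1 := fun m' => [/\ rep s (rcons env i) st m',
       m' (addr s 0 d) = \sum_(j < i.+1) ev s st (rcons env j) e,
       forall j, j < d -> m' (addr s 0 j) = m (addr s 0 j)
       & bounded_memory (bd i.+1) m'])).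
      apply: reaches_assign => //; first by lia.
      have E j : eval m4 (Read (tmp j)) = m4 (addr s 0 j).
        by rewrite eval_read (eval_tmp _ r4).
      have Ea1 : eval m4 a1 = \sum_(j < i.+1) ev s st (rcons env j) e.
        by rewrite eval_binopE !E /= v4 o4 // v3 big_ord_recr.
      rewrite (eval_tmp _ r4); split.
      - exact: rep_tmp.
      - by rewrite /update eqxx Ea1.
      - by move=> j hj; rewrite /update addr_eq /= ltn_eqF // o4 ?o3 // ltnW.
      - apply: (bounded_update b4); rewrite /bd mulSn /G /L; first by lia.
        rewrite eval_binopE !eval_read.
        by apply: leq_trans (bitlenD (b4 _) (b4 _)) _; rewrite /bd /G /L; lia.
    move=> m5 [r5 v5 o5 b5].
    apply: reaches_assign => //; first by rewrite /bd; lia.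
    have -> : eval m5 a2 = i.+1.
      rewrite eval_binopE eval_read (eval_loopvar _ r5) -hk (rep_loopvarE r5).
      exact: addn1.
    rewrite (eval_loopvar _ r5); split.
    * by rewrite -hk; apply: rep_loopvar_next r5.
    * by rewrite /update addr_eq.
    * by move=> j hj; rewrite /update addr_eq /= o5.
    * apply: (bounded_update b5) => //.
      by apply: leq_trans (bitlen_size (leq_trans hi nL')) _; rewrite /bd; lia.
  + move=> i m3 hi [r3 v3 o3 b3].
    have bi0 : 0 < bd i by rewrite /bd; lia.
    apply: leq_trans (leq_add (leqnn 1) (expr_cost_leq _ bi0 b3)) _.
    change (peval T X) with (peval h (X + peval W X) + (c1 * peval W X +
         (c2 * peval W X + c4 * peval W X))).
    apply: (@leq_trans (c4 * peval W X));
      first exact: (leq_cost (cost_weight (more k)) W1 (bdW _ hi)).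
    by apply: leq_trans (leq_addl _ _); apply: leq_trans (leq_addl _ _); exact: leq_addl.
  + by move=> m3 [r3 _ _ _]; rewrite -hk (eval_more hs r3) subnn.
Qed.

(** * Correctness and running time of compiled commands *)

Lemma iter_forS n f st : iter_for n.+1 f st = f n (iter_for n f st).
Proof. by rewrite /iter_for -addn1 iotaD foldl_cat. Qed.

Definition cc_post s env st b (m' : memory) := rep s env st m' /\ bounded_memory b m'.

Definition cc_spec k c := exists g h : pexp,
  forall s env st m b, size env = k -> good_input s -> rep s env st m ->
    0 < b -> bounded_memory b m ->
    reaches (cc k c) m (peval h (input_size s + b))
      (cc_post s env (run s env c st) (b + peval g (input_size s))).

Lemma cc_set t e1 e2 k : wfe k e1 -> wfe k e2 -> cc_spec k (Set_ t e1 e2).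
Proof.
move=> /ce_correct -/(_ 0) [g1 [h1 H1]] /ce_correct -/(_ 1) [g2 [h2 H2]].
pose W := cost_weight (loc t.+2 (Read (tmp 0))) + cost_weight (Read (tmp 1)).
exists (PAdd g1 g2), (PAdd h1 (PAdd (PComp h2 (PAdd PX g1))
  (PMul (PC (1 + W)) (PAdd PX (PAdd g1 g2))))).
move=> s env st m b hk hs hr b0 hb.
have m1g := @peval_mono g1 _ _ (leq_addr b (input_size s)).
have m2g := @peval_mono g2 _ _ (leq_addr b (input_size s)).
rewrite !pevalE; apply: reaches_seq (H1 _ _ _ _ _ hk hs hr b0 hb) _ => m1 [r1 v1 o1 b1].
have T1 : peval h2 (input_size s + (b + peval g1 (input_size s))) <=
    peval h2 (input_size s + b + peval g1 (input_size s + b)).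
  by apply: peval_mono; lia.
set B := b + peval g1 (input_size s) + peval g2 (input_size s).
apply: (reaches_weak (T := peval h2 (input_size s + (b + peval g1 (input_size s))) +
  (1 + W * B)) (Q := cc_post s env (run s env (Set_ t e1 e2) st) B)).
- apply: reaches_seq (H2 _ _ _ _ _ hk hs r1 (ltn_addr _ b0) b1) _.
  move=> m2 [r2 v2 o2 b2].
  have E0 : eval m2 (Read (tmp 0)) = ev s st env e1.
    by rewrite eval_read (eval_tmp _ r2) o2.
  have E1 : eval m2 (Read (tmp 1)) = ev s st env e2.
    by rewrite eval_read (eval_tmp _ r2).
  apply: (reaches_assign (b := B)) => //; first by rewrite /B; lia.
  rewrite (eval_loc _ _ r2) E0; split.
    by rewrite E1; apply: rep_set.
  by apply: (bounded_update b2) => //; rewrite eval_read.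
- apply: leq_add => //; apply: leq_cost; rewrite /B; lia.
- by move=> m' [r' b']; split => //; apply: bounded_weak b'; rewrite /B; lia.
Qed.

Lemma cc_correct c : forall k, wfc k c -> cc_spec k c.
Proof.
elim: c => [t e1 e2|c1 IH1 c2 IH2|e c IH|c IH] k /=.
- by move=> /andP [? ?]; apply: cc_set.
- move=> /andP [/IH1 [g1 [h1 H1]] /IH2 [g2 [h2 H2]]].
  exists (PAdd g1 g2), (PAdd h1 (PComp h2 (PAdd PX g1))).
  move=> s env st m b hk hs hr b0 hb.
  have m1g := @peval_mono g1 _ _ (leq_addr b (input_size s)).
  rewrite !pevalE; apply: reaches_seq (H1 _ _ _ _ _ hk hs hr b0 hb) _ => m1 [r1 b1].
  apply: reaches_weak (H2 _ _ _ _ _ hk hs r1 (ltn_addr _ b0) b1) _ _.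
  + by apply: peval_mono; lia.
  + by move=> m2 [r2 b2]; split => //; apply: bounded_weak b2; lia.
- move=> /andP [/ce_correct -/(_ 0) [g1 [h1 H1]] /IH [g2 [h2 H2]]].
  pose W := cost_weight (Read (tmp 0)).
  exists (PAdd g1 g2), (PAdd h1 (PAdd (PMul (PC (1 + W)) (PAdd PX g1))
    (PAdd (PC 1) (PComp h2 (PAdd PX g1))))).
  move=> s env st m b hk hs hr b0 hb.
  have m1g := @peval_mono g1 _ _ (leq_addr b (input_size s)).
  rewrite !pevalE; apply: reaches_seq (H1 _ _ _ _ _ hk hs hr b0 hb) _ => m1 [r1 v1 o1 b1].
  set B := b + peval g1 (input_size s) in b1.
  have B0 : 0 < B by rewrite /B; lia.
  have E0 : eval m1 (Read (tmp 0)) = ev s st env e.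
    by rewrite eval_read (eval_tmp _ r1).
  have Bl : B <= input_size s + b + peval g1 (input_size s + b) by rewrite /B; lia.
  apply: (reaches_weak (T := 1 + W * B + (1 + peval h2 (input_size s + B)))
    (Q := cc_post s env (run s env (When e c) st)
            (B + peval g2 (input_size s)))).
  + apply: reaches_if => //; rewrite E0 /=; case: ifP => _; last first.
      exists 1, m1; split => //; first exact: exec_Skip.
      by split=> //; apply: bounded_weak b1; apply: leq_addr.
    by apply: reaches_weak (H2 _ _ _ _ _ hk hs r1 B0 b1) _ _; rewrite ?leq_addl.
  + apply: leq_add; first by apply: leq_cost => //; lia.
    by apply: leq_add => //; apply: peval_mono; rewrite /B; lia.
  + by move=> m2 [r2 b2]; split => //; apply: bounded_weak b2; rewrite /B; lia.
- move=> /IH [g [h H]].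
  pose gm := PAdd (PAdd PX (PC 2)) (PMul PX g).
  pose W := PAdd PX gm.
  pose a2 := Binop Add (Read (loopvar k)) (Const 1).
  pose c2 := 1 + (cost_weight (loopvar k) + cost_weight a2).
  pose c3 := 1 + (cost_weight (loopvar k) + cost_weight (Const 0)).
  pose c4 := 1 + cost_weight (more k).
  pose T := PAdd (PComp h (PAdd PX W)) (PAdd (PMul (PC c2) W) (PMul (PC c4) W)).
  exists gm, (PAdd (PMul (PC c3) W) (PMul (PMul (PAdd PX (PC 1)) (PC 2)) T)).
  move=> s env st m b hk hs hr b0 hb; set X := input_size s + b.
  have [s0 nL'] := hs.
  set n := nth 0 s 0 in nL'.
  have nL : n <= input_size s by apply: leq_trans nL' (size_leq_input s).
  pose bd i := b + (input_size s + 2) + i * peval g (input_size s).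
  have bdn i : i <= n -> bd i <= b + peval gm (input_size s).
    move=> hi; rewrite /bd [peval gm _]/= -addnA leq_add2l leq_add2l.
    by rewrite leq_mul2r (leq_trans hi nL) orbT.
  have gmX : peval gm (input_size s) <= peval gm X.
    by apply: peval_mono; apply: leq_addr.
  have bdW i : i <= n -> bd i <= peval W X.
    by move=> /bdn; move: gmX; rewrite /W /X !pevalE; lia.
  have W1 : 1 <= peval W X by rewrite /W !pevalE /X; lia.
  pose Inv i (m' : memory) := rep s (rcons env i)
     (iter_for i (fun i => run s (rcons env i) c) st) m' /\ bounded_memory (bd i) m'.
  apply: (reaches_weak (T := c3 * peval W X + (n.+1 * 2) * peval T X) (Q := Inv n));
      last first.
  + move=> m' [r1 b1]; split; first exact: rep_rcons r1.
    exact: bounded_weak (bdn _ (leqnn n)) b1.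
  + change (c3 * peval W X + (n.+1 * 2) * peval T X <= c3 * peval W X +
     ((X + 1) * 2) * peval T X).
    rewrite leq_add2l leq_mul2r; apply/orP; right.
    by rewrite leq_mul2r addn1 ltnS (leq_trans nL) // leq_addr.
  apply: (reaches_seq (Q1 := Inv 0)).
  + apply: (reaches_weak (T := 1 + (cost_weight (loopvar k) + cost_weight (Const 0)) * b));
      [apply: reaches_assign => // | | by move=> ? Q; exact: Q].
    * rewrite (eval_loopvar _ hr) -hk; split; first exact: rep_loopvar.
      apply: (bounded_update hb); rewrite /bd /=; first by lia.
      by apply: leq_trans (bitlen_id _) _; lia.
    * by rewrite /c3; apply: leq_cost => //; rewrite /W !pevalE /X; lia.
  move=> m2 I2.
  apply: reaches_while I2.
  + move=> i m3 hi [r3 b3]; split.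
      by rewrite -hk (eval_more hs r3) -/n; lia.
    have hk1 : size (rcons env i) = k.+1 by rewrite size_rcons hk.
    have hbi : bd i <= peval W X by apply: bdW; lia.
    have TH : peval h (input_size s + bd i) <= peval h (X + peval W X).
      by apply: peval_mono; apply: leq_add => //; apply: leq_addr.
    have bi0 : 0 < bd i by rewrite /bd; lia.
    apply: (reaches_weak (T := peval h (input_size s + bd i) +
      (1 + (cost_weight (loopvar k) + cost_weight a2) * bd i.+1))
      (Q := Inv i.+1)) => //; last first.
      change (peval T X) with (peval h (X + peval W X) + (c2 * peval W X +
         c4 * peval W X)).
      apply: leq_add => //; apply: leq_trans (leq_addr _ _).
      by rewrite /c2; apply: leq_cost => //; apply: bdW.
    apply: reaches_seq (H _ _ _ _ _ hk1 hs r3 bi0 b3) _.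
    move=> m4 [r4 b4].
    have b4' : bounded_memory (bd i.+1) m4.
      by apply: bounded_weak b4; rewrite /bd mulSn; lia.
    apply: reaches_assign => //; first by rewrite /bd; lia.
    have -> : eval m4 a2 = i.+1.
      rewrite eval_binopE eval_read (eval_loopvar _ r4) -hk (rep_loopvarE r4).
      exact: addn1.
    rewrite (eval_loopvar _ r4) -hk; split.
      by rewrite iter_forS; apply: rep_loopvar_next r4.
    apply: (bounded_update b4') => //.
    by apply: leq_trans (bitlen_size (leq_trans hi nL')) _; rewrite /bd; lia.
  + move=> i m3 hi [r3 b3].
    have bi0 : 0 < bd i by rewrite /bd; lia.
    apply: leq_trans (leq_add (leqnn 1) (expr_cost_leq _ bi0 b3)) _.
    change (peval T X) with (peval h (X + peval W X) + (c2 * peval W X +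
         c4 * peval W X)).
    apply: (@leq_trans (c4 * peval W X));
      first exact: (leq_cost (cost_weight (more k)) W1 (bdW _ hi)).
    by apply: leq_trans (leq_addl _ _); exact: leq_addl.
  + by move=> m3 [r3 _]; rewrite -hk (eval_more hs r3) subnn.
Qed.

(** * Writing the output *)

Definition emit_row (x : expr) (a : nat) : program :=
  Assign x (Read (loc a.+2 (Read (tmp 1)))).

Definition emit_test : expr := Binop Monus (Read (tmp 0)) (Read (tmp 1)).

Definition emit_body (a1 a2 : nat) : program :=
  Seq (emit_row (Binop Add (Const 1) (Read (tmp 1))) a1)
  (Seq (emit_row (Binop Add (Const 1) (Binop Add (Read (tmp 0)) (Read (tmp 1)))) a2)
       (Assign (tmp 1) (Binop Add (Read (tmp 1)) (Const 1)))).

(* Register 0, the base of all addresses, is overwritten last. *)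
Definition emit (a1 a2 : nat) : program :=
  Seq (Assign (tmp 0) (Read (Const 1)))
  (Seq (Assign (tmp 1) (Const 0))
  (Seq (While emit_test (emit_body a1 a2))
       (Assign (Const 0) (Binop Add (Read (tmp 0)) (Read (tmp 0)))))).

Definition compile (c : cmd) (a1 a2 : nat) : program := Seq (cc 0 c) (emit a1 a2).

Definition emit_inv s st n a1 a2 b i (m : memory) :=
  [/\ m 0 = size s, m (addr s 0 0) = n /\ m (addr s 0 1) = i,
      forall t j, m (addr s t.+2 j) = st t j,
      forall j, j < i -> m j.+1 = st a1 j /\ m (n + j).+1 = st a2 j
    & bounded_memory b m].

Lemma eval_loc0 s m t e : m 0 = size s -> eval m (loc t e) = addr s t (eval m e).
Proof. by move=> h /=; rewrite h. Qed.

Lemma emit_eval_tmp s m d : m 0 = size s -> eval m (Read (tmp d)) = m (addr s 0 d).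
Proof. by move=> h; rewrite eval_read /= h. Qed.

(** Since twice the number of points is at most [size s], the output fits in the input registers,
    below every array, so the arrays still to be copied remain intact. The number of points, held in
    register 1, is saved in a temporary before that register is overwritten. *)
Lemma emit_correct a1 a2 : exists h : pexp, forall s st m b,
  good_input s -> nth 0 s 0 + nth 0 s 0 <= size s -> rep s [::] st m -> 0 < b ->
  bounded_memory b m ->
  reaches (emit a1 a2) m (peval h (input_size s + b)) (fun m' =>
    read_output m' = mkseq (st a1) (nth 0 s 0) ++ mkseq (st a2) (nth 0 s 0)).
Proof.
pose x1 := Binop Add (Const 1) (Read (tmp 1)).
pose x2 := Binop Add (Const 1) (Binop Add (Read (tmp 0)) (Read (tmp 1))).
pose y a := Read (loc a.+2 (Read (tmp 1))).
pose z := Binop Add (Read (tmp 1)) (Const 1).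
pose d1 := cost_weight x1 + cost_weight (y a1).
pose d2 := cost_weight x2 + cost_weight (y a2).
pose d3 := cost_weight (tmp 1) + cost_weight z.
pose d4 := cost_weight (tmp 0) + cost_weight (Read (Const 1)).
pose d5 := cost_weight (tmp 1) + cost_weight (Const 0).
pose d6 := cost_weight (Const 0) + cost_weight (Binop Add (Read (tmp 0)) (Read (tmp 0))).
pose d7 := cost_weight emit_test.
pose B := PAdd PX (PC 2).
pose cB d := PAdd (PC 1) (PMul (PC d) B).
pose T := PAdd (PAdd (cB d1) (PAdd (cB d2) (cB d3))) (cB d7).
exists (PAdd (cB d4) (PAdd (cB d5) (PAdd (PMul (PMul (PAdd PX (PC 1)) (PC 2)) T) (cB d6)))).
move=> s st m b hs h2n hr b0 hb; set X := input_size s + b.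
have [s0 nL'] := hs; set n := nth 0 s 0 in nL' h2n *.
have nL : n <= input_size s by apply: leq_trans nL' (size_leq_input s).
have hb' : bounded_memory (peval B X) m by apply: bounded_weak hb; rewrite /B !pevalE /X; lia.
have B0 : 0 < peval B X by rewrite /B !pevalE; lia.
have bn i : i <= n -> bitlen i <= peval B X.
  by move=> hi; apply: leq_trans (bitlen_id _) _; rewrite /B !pevalE /X; lia.
have [r1 _ r3] := hr.
apply: (reaches_seq (Q1 := fun m' => [/\ rep s [::] st m', m' (addr s 0 0) = n &
    bounded_memory (peval B X) m'])).
  apply: reaches_assign => //; rewrite (eval_tmp _ hr) eval_read r1 //; split.
  - exact: rep_tmp.
  - by rewrite /update eqxx.
  - by apply: (bounded_update hb') => //; apply: bn.
move=> m1 [q1 v1 b1].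
apply: (reaches_seq (Q1 := emit_inv s st n a1 a2 (peval B X) 0)).
  apply: reaches_assign => //; rewrite (eval_tmp _ q1).
  have [_ _ q3] := q1.
  split.
  - by rewrite /update ltn_eqF ?(rep0 q1) //; apply: leq_trans (addr_gt _ _ _).
  - by rewrite /update eqxx addr_eq v1.
  - by move=> t j; rewrite /update addr_eq q3.
  - by [].
  - by apply: (bounded_update b1) => //; apply: bn.
move=> m2 I2.
have nXT : n.+1 * 2 * peval T X <= peval (PMul (PMul (PAdd PX (PC 1)) (PC 2)) T) X.
  change (n.+1 * 2 * peval T X <= (X + 1) * 2 * peval T X).
  rewrite leq_mul2r; apply/orP; right; rewrite leq_mul2r addn1 ltnS.
  by rewrite (leq_trans nL) ?orbT // leq_addr.
apply: reaches_seq (reaches_weak (reaches_while _ _ _ I2) nXT (fun m Q => Q)) _.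
- move=> i m3 hi [e0 [et0 et1] e3 e4 b3].
  have E d := emit_eval_tmp d e0.
  have no_addr t j k : k < size s -> (addr s t j == k.+1) = false.
    by move=> hk; apply/eqP => h; have := addr_gt s t j; lia.
  have no0 k : (0 == k.+1) = false by [].
  split; first by rewrite eval_binopE !E et0 et1 /=; lia.
  apply: (reaches_weak (T := peval (PAdd (cB d1) (PAdd (cB d2) (cB d3))) X)
    (Q := emit_inv s st n a1 a2 (peval B X) i.+1)) => //; last by rewrite leq_addr.
  have Ey a m' : m' 0 = size s -> m' (addr s 0 1) = i ->
      (forall t j, m' (addr s t.+2 j) = st t j) -> eval m' (y a) = st a i.
    move=> h0 h1 h3.
    by rewrite eval_read (eval_loc0 _ _ h0) (emit_eval_tmp _ h0) h1 h3.
  have by' a m' : bounded_memory (peval B X) m' -> bitlen (eval m' (y a)) <= peval B X.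
    by move=> h; rewrite eval_read.
  apply: (reaches_seq (Q1 := fun m' => [/\ m' 0 = size s,
     m' (addr s 0 0) = n /\ m' (addr s 0 1) = i,
     forall t j, m' (addr s t.+2 j) = st t j,
     (forall j, j < i.+1 -> m' j.+1 = st a1 j) /\
     (forall j, j < i -> m' (n + j).+1 = st a2 j)
     & bounded_memory (peval B X) m'])).
    apply: reaches_assign => //.
    have -> : eval m3 x1 = i.+1 by rewrite eval_binopE E et1.
    rewrite Ey //; split; rewrite /update //.
    + by rewrite !no_addr; try lia.
    + by move=> t j; rewrite no_addr ?e3 //; lia.
    + split=> j hj; first by rewrite eqSS; case: eqP => [->//|?]; apply: (e4 _ _).1; lia.
      by case: eqP => [?|_]; [lia|apply: (e4 _ hj).2].
    + by apply: (bounded_update b3) => //; rewrite -(Ey a1 m3) ?by'.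
  move=> m4 [f0 [ft0 ft1] f3 [f4 f5] b4].
  have E4 d := emit_eval_tmp d f0.
  apply: (reaches_seq (Q1 := fun m' => [/\ m' 0 = size s,
     m' (addr s 0 0) = n /\ m' (addr s 0 1) = i,
     forall t j, m' (addr s t.+2 j) = st t j,
     (forall j, j < i.+1 -> m' j.+1 = st a1 j) /\
     (forall j, j < i.+1 -> m' (n + j).+1 = st a2 j)
     & bounded_memory (peval B X) m'])).
    apply: reaches_assign => //.
    have -> : eval m4 x2 = (n + i).+1 by rewrite eval_binopE eval_binopE !E4 ft0 ft1.
    rewrite Ey //; split; rewrite /update //.
    + by rewrite !no_addr; try lia.
    + by move=> t j; rewrite no_addr ?f3 //; lia.
    + split=> j hj; first by case: eqP => [?|_]; [lia|apply: f4].
      by rewrite eqSS eqn_add2l; case: eqP => [->//|?]; apply: f5; lia.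
    + by apply: (bounded_update b4) => //; rewrite -(Ey a2 m4) ?by'.
  move=> m5 [g0 [gt0 gt1] g3 [g4 g5] b5].
  have E5 d := emit_eval_tmp d g0.
  apply: reaches_assign => //.
  have -> : eval m5 z = i.+1 by rewrite eval_binopE E5 gt1 /= addn1.
  have -> : eval m5 (tmp 1) = addr s 0 1 by rewrite /= g0.
  split; rewrite /update.
  + by rewrite ltn_eqF //; apply: leq_trans (addr_gt _ _ _).
  + by rewrite eqxx addr_eq gt0.
  + by move=> t j; rewrite addr_eq g3.
  + move=> j hj; rewrite ![_ == addr _ _ _]eq_sym !no_addr; try lia.
    by split; [apply: g4|apply: g5].
  + by apply: (bounded_update b5) => //; apply: bn.
- move=> i m3 hi [e0 [et0 et1] e3 e4 b3].
  apply: (@leq_trans (peval (cB d7) X)); last by rewrite /T pevalE leq_addl.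
  by rewrite !pevalE leq_add2l; apply: expr_cost_leq.
- by move=> m3 [e0 [et0 et1] e3 e4 b3]; rewrite eval_binopE !(emit_eval_tmp _ e0) et0 et1 /= subnn.
move=> m3 [e0 [et0 et1] e3 e4 b3].
apply: reaches_assign => //.
rewrite eval_binopE !(emit_eval_tmp _ e0) et0 [eval_binop _ _ _]/= [eval m3 _]/=.
rewrite /read_output (_ : update _ _ _ 0 = n + n) //.
apply: (@eq_from_nth _ 0); first by rewrite size_cat !size_mkseq.
rewrite size_mkseq => i hi; rewrite nth_mkseq // nth_cat size_mkseq /update /=.
case: ltnP => hin; first by rewrite nth_mkseq //; exact: (e4 _ hin).1.
have hj : i - n < n by lia.
by rewrite nth_mkseq // -(e4 _ hj).2; congr (m3 _.+1); lia.
Qed.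

Definition empty_store : store := fun _ _ => 0.

Theorem compile_correct c a1 a2 : wfc 0 c ->
  exists a k, forall s, good_input s -> nth 0 s 0 + nth 0 s 0 <= size s ->
  exists2 t, t <= a * input_size s ^ k + a &
    runs (compile c a1 a2) s t
      (mkseq (run s [::] c empty_store a1) (nth 0 s 0) ++
       mkseq (run s [::] c empty_store a2) (nth 0 s 0)).
Proof.
move=> /cc_correct [g [h H]]; have [h' H'] := emit_correct a1 a2.
pose P := PAdd PX (PAdd PX (PC 1)).
have [a [k Hp]] := peval_leq_poly (PAdd (PComp h P) (PComp h' (PAdd P g))).
exists a, k => s hs h2.
have b0 : bounded_memory (input_size s).+1 (init_memory s).
  case=> [|j]; first by rewrite /init_memory /=; apply: bitlen_size.
  rewrite /init_memory /=; case: (ltnP j (size s)) => hj.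
    by apply: leqW; apply: bitlen_input; apply: mem_nth.
  by rewrite nth_default // bitlen_leq // expn_gt0.
have r0 : rep s [::] empty_store (init_memory s).
  split=> // t i; rewrite /init_memory nth_default //=.
  exact: addr_gt.
have := reaches_seq (H s [::] empty_store _ _ (erefl _) hs r0 (ltn0Sn _) b0)
  (fun m1 Q1 => H' _ _ _ _ hs h2 Q1.1 (ltn_addr _ (ltn0Sn _)) Q1.2).
case=> [t [m [he ht hm]]].
exists t; last by exists m.
apply: leq_trans (leq_trans ht _) (Hp (input_size s)).
by rewrite /P !pevalE; apply: leq_add; apply: peval_mono; lia.
Qed.

(** * The Mettu-Plaxton facility location algorithm *)

Lemma sum_leq_single (T : finType) (P : pred T) (f : T -> nat) c :
  (forall z z', P z -> P z' -> 0 < f z -> 0 < f z' -> z = z') ->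
  (forall z, P z -> f z <= c) -> \sum_(z | P z) f z <= c.
Proof.
move=> h1 hc; case: (pickP [pred z | P z && (0 < f z)]) => [z /= /andP [Pz fz]|h0].
  rewrite (bigD1 z) //= big1 ?addn0 ?hc // => z' /andP [Pz' /eqP ne].
  by case: (posnP (f z')) => // f0; case: ne; apply: h1.
rewrite big1 // => z Pz; have := h0 z; rewrite /= Pz /=.
by case: (f z).
Qed.

Section MettuPlaxton.
Variables (V : finType) (D : V -> V -> nat) (cli : pred V) (F r : V -> nat).
Hypothesis D_sym : forall x y, D x y = D y x.
Hypothesis D_triangle : forall x y z, D x z <= D x y + D y z.

Definition ball_sum i t := \sum_(j | cli j && (D i j <= D i t)) D i j.
Definition ball_card i t := \sum_(j | cli j && (D i j <= D i t)) 1.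

(** The Mettu-Plaxton radius of [i] is the [x] for which the positive parts of [x - D i j] add up to
    [F i]. Applied to the ball formed by the clients that contribute at [x], the hypothesis reads
    [x * ball_card <= F i + ball_sum], which is the claim. *)
Lemma radius_leq i x :
  (forall t, cli t -> x <= (F i + ball_sum i t) %/ ball_card i t) ->
  \sum_(j | cli j) (x - D i j) <= F i.
Proof.
move=> h; rewrite (bigID (fun j => D i j < x)) /= [X in _ + X]big1 ?addn0; last first.
  by move=> j /andP [_]; rewrite -leqNgt => ?; lia.
case: (pickP [pred j | cli j && (D i j < x)]) => [t0 ht0|h0]; last first.
  by rewrite big_pred0.
(* [t] is the farthest client closer than [x], so its ball is exactly the set of contributing
   clients. *)
case: (@arg_maxnP _ t0 [pred j | cli j && (D i j < x)] (D i) ht0) => t /= /andP [ct tx] tmax.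
have E j : cli j && (D i j < x) = cli j && (D i j <= D i t).
  apply/andP/andP => [[cj jx]|[cj jt]]; split => //; last exact: leq_ltn_trans tx.
  by apply: tmax; rewrite /= cj.
rewrite (eq_bigl _ _ E).
have K0 : 0 < ball_card i t.
  by rewrite /ball_card (bigD1 t) /= ?ct ?leqnn.
have := h t ct; rewrite leq_divRL // /ball_card /ball_sum => h1.
have -> : \sum_(j | cli j && (D i j <= D i t)) (x - D i j) =
    x * \sum_(j | cli j && (D i j <= D i t)) 1 -
    \sum_(j | cli j && (D i j <= D i t)) D i j.
  rewrite sumnB; last by move=> j /andP [_ hj]; rewrite ltnW // (leq_ltn_trans hj).
  by rewrite big_distrr /=; congr (_ - _); apply: eq_bigr => j _; rewrite muln1.
lia.
Qed.

(** The converse up to rounding: the integer quotient misses the exact one by less than 1, which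
    costs at most one unit per client. *)
Lemma radius_geq i t x :
  cli t -> x = (F i + ball_sum i t) %/ ball_card i t ->
  F i <= \sum_(j | cli j) (x - D i j) + \sum_(j | cli j) 1.
Proof.
move=> ct ex; set P := fun j => cli j && (D i j <= D i t).
have K0 : 0 < ball_card i t by rewrite /ball_card (bigD1 t) /= ?ct ?leqnn.
have h := ltn_ceil (F i + ball_sum i t) K0; rewrite -ex in h.
have : F i <= \sum_(j | P j) (x - D i j) + \sum_(j | P j) 1.
  suff : \sum_(j | P j) x <= \sum_(j | P j) (x - D i j) + ball_sum i t.
    move: h; rewrite mulSn.
    have -> : x * ball_card i t = \sum_(j | P j) x.
      by rewrite /ball_card big_distrr /=; apply: eq_bigr => j _; rewrite muln1.
    have -> : ball_card i t = \sum_(j | P j) 1 by [].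
    lia.
  by rewrite /ball_sum -big_split /=; apply: leq_sum => j _; lia.
move=> h2; apply: leq_trans h2 _; apply: leq_add.
  rewrite [X in _ <= X](bigID (fun j => D i j <= D i t)) /=; exact: leq_addr.
rewrite [X in _ <= X](bigID (fun j => D i j <= D i t)) /=; exact: leq_addr.
Qed.

Variables (fac opn : pred V) (near : V -> V).
Hypothesis r_lower : forall i, fac i -> \sum_(j | cli j) (r i - D i j) <= F i.
Hypothesis r_upper : forall i, fac i -> F i <= 2 * \sum_(j | cli j) (r i - D i j).
Hypothesis opn_fac : forall z, opn z -> fac z.
Hypothesis opn_cover : forall i, fac i -> exists z, [/\ opn z, r z <= r i & D i z <= 2 * r i].
Hypothesis opn_separated : forall z z', opn z -> opn z' -> z != z' -> 2 * r z < D z z'.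
Hypothesis near_opn : forall j z, cli j -> opn z -> D (near j) j <= D z j.

(** Any solution pays at least the sum over the clients of [M j], the larger of the distance to and
    the radius of its facility. In the computed solution each client contributes to at most one open
    facility, because these are separated; this contribution and the nearest distance are both
    charged to [M j]. *)
Theorem mettu_plaxton (X : pred V) (sigma : V -> V) :
  (forall i, X i -> fac i) -> (forall j, cli j -> X (sigma j)) ->
  \sum_(z | opn z) F z + \sum_(j | cli j) D (near j) j <=
  6 * (\sum_(i | X i) F i + \sum_(j | cli j) D (sigma j) j).
Proof.
move=> Xfac Xs.
(* Truncated subtraction makes this the maximum of [D (sigma j) j] and [r (sigma j)]. *)
pose M j := D (sigma j) j + (r (sigma j) - D (sigma j) j).
have sumM : \sum_(j | cli j) M j <= \sum_(i | X i) F i + \sum_(j | cli j) D (sigma j) j.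
  rewrite /M big_split /= addnC leq_add2r.
  apply: (@leq_trans (\sum_(i | X i) \sum_(j | cli j) (r i - D i j))); last first.
    by apply: leq_sum => i Xi; apply: r_lower; apply: Xfac.
  rewrite exchange_big /=; apply: leq_sum => j cj.
  by rewrite [X in _ <= X](bigD1 (sigma j)) ?Xs //= leq_addr.
(* One half of [6 * M j] pays for the distance, through the open facility [z0] that covers
   [sigma j]; the other half pays for the contribution, whose factor 2 comes from [r_upper]. *)
have per j : cli j -> 2 * (\sum_(z | opn z) (r z - D z j)) + D (near j) j <= 6 * M j.
  move=> cj; have [z0 [oz0 rz0 dz0]] := opn_cover (Xfac _ (Xs _ cj)).
  have h0 : D z0 j <= 3 * M j.
    have := D_triangle z0 (sigma j) j; rewrite (D_sym z0 (sigma j)) /M; lia.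
  have hn := near_opn cj oz0.
  suff : \sum_(z | opn z) 2 * (r z - D z j) <= 3 * M j.
    by rewrite -big_distrr /=; lia.
  apply: sum_leq_single => [z z' oz oz' h h'|z oz].
    apply/eqP/negPn/negP => ne.
    have := opn_separated oz oz' ne.
    rewrite eq_sym in ne; have := opn_separated oz' oz ne.
    have := D_triangle z j z'; rewrite (D_sym j z') (D_sym z' z); lia.
  case: (eqVneq z z0) => [->|ne]; first by rewrite /M; lia.
  have := opn_separated oz oz0 ne; have := D_triangle z j z0; rewrite (D_sym j z0); lia.
apply: leq_trans (leq_mul (leqnn 6) sumM).
rewrite big_distrr /=.
have tot : \sum_(j | cli j) (2 * (\sum_(z | opn z) (r z - D z j)) + D (near j) j) <=
    \sum_(j | cli j) 6 * M j by apply: leq_sum.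
apply: leq_trans tot; rewrite big_split /= leq_add2r.
rewrite -big_distrr exchange_big /= big_distrr /=.
by apply: leq_sum => z oz; apply: r_upper; apply: opn_fac.
Qed.

End MettuPlaxton.

(** * Approximate matching by growing moats *)

Lemma even_involution (V : finType) (p : V -> V) (A : {set V}) :
  (forall v, v \in A -> [/\ p v \in A, p (p v) = v & p v != v]) -> ~~ odd #|A|.
Proof.
have [n] := ubnP #|A|; elim: n A => // n IH A; rewrite ltnS => An hA.
have [->|[v vA]] := set_0Vmem A; first by rewrite cards0.
have [pvA ppv nv] := hA v vA.
have c1 := cardsD1 v A; have c2 := cardsD1 (p v) (A :\ v).
rewrite vA in c1; rewrite !inE nv pvA /= in c2.
have -> : #|A| = (#|A :\ v :\ p v|).+2 by rewrite c1 c2.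
rewrite /= negbK; apply: IH; first by lia.
move=> w; rewrite !inE => /and3P [w1 w2 wA]; have [pwA ppw nw] := hA w wA.
rewrite pwA ppw nw andbT; split => //; apply/andP; split; apply/eqP => h.
  by move: w2; rewrite -ppw h ppv eqxx.
by move: w1; rewrite -h ppw eqxx.
Qed.

Lemma even_pairing (V : finType) (A : {set V}) : ~~ odd #|A| ->
  exists p : V -> V, forall v, v \in A -> [/\ p v \in A, p (p v) = v & p v != v].
Proof.
have [n] := ubnP #|A|; elim: n A => // n IH A; rewrite ltnS => An hA.
have [->|[v vA]] := set_0Vmem A; first by exists id => v; rewrite inE.
have c1 := cardsD1 v A; rewrite vA in c1.
have [h|[w]] := set_0Vmem (A :\ v); first by move: hA; rewrite c1 h cards0.
rewrite !inE => /andP [wv wA].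
have c2 := cardsD1 w (A :\ v); rewrite !inE wv wA /= in c2.
have hA' : ~~ odd #|A :\ v :\ w| by move: hA; rewrite c1 c2 /= negbK.
have lA' : #|A :\ v :\ w| < n by lia.
have [p hp] := IH _ lA' hA'.
exists (fun z => if z == v then w else if z == w then v else p z) => z zA.
case: (eqVneq z v) => [->|zv].
  by rewrite eqxx (negbTE wv); split.
case: (eqVneq z w) => [->|zw]; first by rewrite eqxx; split => //; rewrite eq_sym.
have := hp z; rewrite !inE zv zw zA => /(_ isT) [/and3P [q1 q2 q3] q4 q5].
by rewrite (negbTE q1) (negbTE q2).
Qed.

Lemma odd_sum (I : finType) (P : pred I) (b : I -> bool) :
  odd (\sum_(i | P i) b i) = \big[addb/false]_(i | P i) b i.
Proof.
by rewrite (big_morph odd oddD (erefl _)); apply: eq_bigr => i _; rewrite oddb.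
Qed.

Lemma addb_single (I : finType) (P Q : pred I) x : P x ->
  \big[addb/false]_(i | P i) ((i == x) && Q i) = Q x.
Proof.
move=> Px; rewrite (bigD1 x) //= eqxx big1 /= ?addbF // => i /andP [_ /negbTE ->].
by [].
Qed.

Lemma sum_single (I : finType) (P : pred I) (f : I -> nat) x : P x ->
  \sum_(i | P i) (i == x) * f i = f x.
Proof.
move=> Px; rewrite (bigD1 x) //= eqxx mul1n big1 ?addn0 // => i /andP [_ /negbTE ->].
by [].
Qed.

(** * Adding an edge to a matching *)

Section Splice.
Variables (V : finType) (D : V -> V -> nat).
Hypothesis D_sym : forall x y, D x y = D y x.
Hypothesis D_triangle : forall x y z, D x z <= D x y + D y z.

Definition put (m : V -> option V) (w : V) (o : option V) : V -> option V :=
  fun z => if z == w then o else m z.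

(* Adds the edge [u v] to the matching [m]: the path formed by this edge and the
   edges of [m] at [u] and [v] is replaced by an edge between its ends. *)
Definition splice (m : V -> option V) (u v : V) : V -> option V :=
  let a := odflt u (m u) in
  let b := odflt v (m v) in
  if a == v then put (put m u None) v None
  else put (put (put (put m u None) v None) a (Some b)) b (Some a).

Definition mates (m : V -> option V) := forall v w, m v = Some w -> m w = Some v /\ v != w.

Definition mate_cost (m : V -> option V) := \sum_v oapp (D v) 0 (m v).

Lemma put_cost m w o :
  mate_cost (put m w o) + oapp (D w) 0 (m w) = mate_cost m + oapp (D w) 0 o.
Proof.
rewrite /mate_cost (bigD1 w) //= [X in _ = X + _](bigD1 w) //= {1}/put eqxx.
rewrite (eq_bigr (fun v => oapp (D v) 0 (m v))); first by lia.
by move=> i /negbTE h; rewrite /put h.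
Qed.

(** Only the status of [u] and of [v] flips; being matched thus records the parity of the number of
    edges added at a vertex. *)
Lemma splice_None m u v w : mates m -> u != v ->
  (splice m u v w == None) = ((m w == None) (+) (w == u)) (+) (w == v).
Proof.
move=> hm uv; have vu : (v == u) = false by rewrite eq_sym (negbTE uv).
have hu a : m u = Some a -> m a = Some u /\ u != a by apply: hm.
have hv a : m v = Some a -> m a = Some v /\ v != a by apply: hm.
rewrite /splice /put.
case eu : (m u) hu => [a|] hu; case ev: (m v) hv => [b|] hv /=.
- have [ma ua] := hu _ erefl; have [mb vb] := hv _ erefl.
  case: (eqVneq a v) => [eav|av].
    by case: (eqVneq w v) => [->|wv]; [rewrite ev vu|case: (eqVneq w u) => [->|wu];
      rewrite ?eu ?addbF].
  case: (eqVneq w b) => [->|wb].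
    have bu : b != u.
      by apply/eqP => h; move: eu; rewrite -h mb => -[] h2; move: av; rewrite h2 eqxx.
    by rewrite mb (negbTE bu) (eq_sym b v) (negbTE vb).
  case: (eqVneq w a) => [->|wa].
    by rewrite ma (eq_sym a u) (negbTE ua) (negbTE av).
  case: (eqVneq w v) => [->|wv]; first by rewrite ev vu.
  by case: (eqVneq w u) => [->|wu]; rewrite ?eu ?addbF.
- have [ma ua] := hu _ erefl.
  case: (eqVneq a v) => [eav|av]; first by rewrite -eav ma in ev.
  case: (eqVneq w v) => [->|wv]; first by rewrite ev vu.
  case: (eqVneq w a) => [->|wa].
    by rewrite ma (eq_sym a u) (negbTE ua).
  by case: (eqVneq w u) => [->|wu]; rewrite ?eu ?addbF.
- have [mb vb] := hv _ erefl; rewrite (negbTE uv).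
  case: (eqVneq w b) => [->|wb].
    have bu : b != u by apply/eqP => h; rewrite -h mb in eu.
    by rewrite mb (negbTE bu) (eq_sym b v) (negbTE vb).
  case: (eqVneq w u) => [->|wu]; first by rewrite eu (negbTE uv).
  by case: (eqVneq w v) => [->|wv]; rewrite ?ev ?addbF.
- rewrite (negbTE uv).
  case: (eqVneq w v) => [->|wv]; first by rewrite ev vu.
  by case: (eqVneq w u) => [->|wu]; rewrite ?eu ?addbF.
Qed.

Lemma splice_mates m u v : mates m -> u != v -> mates (splice m u v).
Proof.
move=> hm uv; have vu : v != u by rewrite eq_sym.
have inj x y z : m x = Some z -> m y = Some z -> x = y.
  by move=> /hm [h1 _] /hm [h2 _]; move: h1; rewrite h2 => -[].
set a := odflt u (m u); set b := odflt v (m v).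
have ua : u = a \/ m u = Some a.
  by rewrite /a; case: (m u) => [x|]; [right|left].
have ua' : m u = None -> a = u by rewrite /a => ->.
have vb : v = b \/ m v = Some b.
  by rewrite /b; case: (m v) => [x|]; [right|left].
have vb' : m v = None -> b = v by rewrite /b => ->.
move=> x y; rewrite /splice -/a -/b; case: (eqVneq a v) => [av|av].
  have mu : m u = Some v.
    by case: ua => [h|->]; [rewrite -h in av; rewrite av eqxx in uv|rewrite av].
  have [mv _] := hm _ _ mu.
  rewrite /put; case: (eqVneq x v) => // xv; case: (eqVneq x u) => // xu mx.
  have [my xy] := hm _ _ mx; split => //.
  case: eqP => [yv|_]; first by move: my; rewrite yv mv => -[] h; rewrite h eqxx in xu.
  by case: eqP => [yu|_] //; move: my; rewrite yu mu => -[] h; rewrite h eqxx in xv.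
have bu : b != u.
  apply/eqP => h; case: vb => [vb|mv]; first by rewrite vb h eqxx in uv.
  rewrite h in mv; have [mu _] := hm _ _ mv.
  by move: av; rewrite /a mu eqxx.
have ab : a != b.
  apply/eqP => h; case: ua => [h1|h1]; first by rewrite -h -h1 eqxx in bu.
  case: vb => [h2|h2]; first by rewrite h -h2 eqxx in av.
  by rewrite h in h1; rewrite (inj _ _ _ h1 h2) eqxx in uv.
rewrite /put; case: (eqVneq x b) => [->|xb].
  by case=> <-; rewrite eqxx (negbTE ab) eq_sym; split.
case: (eqVneq x a) => [->|xa]; first by case=> <-; rewrite eqxx.
case: (eqVneq x v) => // xv; case: (eqVneq x u) => // xu mx.
have [my xy] := hm _ _ mx; split => //.
have yb : y != b.
  apply/eqP => h; rewrite h in my mx; case: vb => [h2|h2].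
    by move: my; rewrite -h2 => mv; move: xb; rewrite /b mv eqxx.
  by move: xv; rewrite (inj _ _ _ mx h2) eqxx.
have ya : y != a.
  apply/eqP => h; rewrite h in my mx; case: ua => [h2|h2].
    by move: my; rewrite -h2 => mu; move: xa; rewrite /a mu eqxx.
  by move: xu; rewrite (inj _ _ _ mx h2) eqxx.
have yv : y != v.
  by apply/eqP => h; rewrite h in my; move: xb; rewrite /b my eqxx.
have yu : y != u.
  by apply/eqP => h; rewrite h in my; move: xa; rewrite /a my eqxx.
by rewrite (negbTE yb) (negbTE ya) (negbTE yv) (negbTE yu).
Qed.

(** [mate_cost] counts each pair from both ends, hence the factor 2. The new pair [a b] is bounded
    by the path through [u] and [v], whose outer parts are the removed pairs. *)
Lemma splice_cost m u v : mates m -> u != v ->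
  mate_cost (splice m u v) <= mate_cost m + 2 * D u v.
Proof.
move=> hm uv; have vu : v != u by rewrite eq_sym.
rewrite /splice.
have hu a : m u = Some a -> m a = Some u /\ u != a by apply: hm.
have hv a : m v = Some a -> m a = Some v /\ v != a by apply: hm.
set a := odflt u (m u); set b := odflt v (m v).
have h1 := put_cost m u None; have h2 := put_cost (put m u None) v None.
case: (eqVneq a v) => [av|av]; first by move: h1 h2 => /=; lia.
have h3 := put_cost (put (put m u None) v None) a (Some b).
have h4 := put_cost (put (put (put m u None) v None) a (Some b)) b (Some a).
have t1 := D_triangle a u b; have t2 := D_triangle u v b.
have s1 := D_sym a b; have s2 := D_sym a u; have s3 := D_sym b v.
have bu : b != u.
  rewrite /b; case ev: (m v) => [z|] //=; have [mz _] := hv _ ev.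
  by apply/eqP => h; move: av; rewrite /a -h mz eqxx.
have ab : a != b.
  rewrite /a /b; case eu: (m u) => [z|] /=; case ev: (m v) => [z'|] //=.
  - apply/eqP => h; have [mz _] := hu _ eu; have [mz' _] := hv _ ev.
    by move: mz'; rewrite -h mz => -[] h'; rewrite h' eqxx in uv.
  - by apply/eqP => h; move: av; rewrite /a eu /= h eqxx.
  - by apply/eqP => h; move: bu; rewrite /b ev /= h eqxx.
have putN m' w o z : z != w -> put m' w o z = m' z by move=> /negbTE zw; rewrite /put zw.
rewrite (putN m) // in h2.
rewrite (putN (put m u None)) // in h3.
have ba : b != a by rewrite eq_sym.
rewrite (putN (put (put m u None) v None)) // in h4.
set m2 := put (put m u None) v None in h2 h3 h4 *.
set m3 := put m2 a (Some b) in h3 h4 *.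
rewrite /= in h1 h2 h3 h4.
have q1 : mate_cost m2 + oapp (D u) 0 (m u) + oapp (D v) 0 (m v) = mate_cost m by lia.
have q2 : mate_cost m3 + oapp (D a) 0 (put m u None a) = mate_cost m2 + D a b by lia.
have e1 : oapp (D a) 0 (put m u None a) = oapp (D u) 0 (m u).
  rewrite /put /a; case eu: (m u) => [z|] /=; last by rewrite eqxx.
  by have [mz uz] := hu _ eu; rewrite (eq_sym z u) (negbTE uz) mz /= D_sym.
have e2 : oapp (D b) 0 (m2 b) = oapp (D v) 0 (m v).
  rewrite /m2 /put /b; case ev: (m v) => [z|] /=; last by rewrite eqxx.
  have [mz vz] := hv _ ev; rewrite (eq_sym z v) (negbTE vz) ifN.
    by rewrite mz /= D_sym.
  by move: bu; rewrite /b ev.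
have e3 : D a b <= oapp (D u) 0 (m u) + D u v + oapp (D v) 0 (m v).
  move: t1 t2 s2 s3; rewrite /a /b; case: (m u) => [z|] /=; case: (m v) => [z'|] /=; try lia.
by lia.
Qed.
End Splice.

(** * Primal-dual growth of moats around odd components *)

Section Moats.
Variables (V : finType) (D : V -> V -> nat) (cli : pred V).
(** [comp k] labels the components before step [k] and [d k v] is the total width of the moats
    around [v]. In step [k] all odd components grow by [eps k], then the two ends of [edge k] have
    their components merged. *)
Variables (comp d : nat -> V -> nat) (eps : nat -> nat) (edge : nat -> option (V * V)).
Hypothesis D_sym : forall x y, D x y = D y x.
Hypothesis D_triangle : forall x y z, D x z <= D x y + D y z.
Hypothesis D_gt1 : forall x y, x != y -> 1 < D x y.

Definition size_class k v := \sum_(w | cli w) (comp k w == comp k v).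
Definition act k v := cli v && odd (size_class k v).

Hypothesis comp0_inj : injective (comp 0).
Hypothesis d0 : forall v, d 0 v = 0.
(** The last clause says that the growth overruns no gap, the fourth that one more unit would
    overrun the gap of [x] and [y]. Two odd components share their gap, hence the factor
    [1 + act]. *)
Hypothesis edge_some : forall k x y, edge k = Some (x, y) ->
  [/\ act k x, cli y, comp k x != comp k y,
      D x y - (d k x + d k y) < (eps k).+1 * (1 + act k y)
    & forall a b, act k a -> cli b -> comp k a != comp k b ->
        eps k * (1 + act k b) <= D a b - (d k a + d k b)].
Hypothesis comp_some : forall k x y, edge k = Some (x, y) ->
  forall v, comp k.+1 v = if comp k v == comp k y then comp k x else comp k v.
Hypothesis d_some : forall k x y, edge k = Some (x, y) ->
  forall v, d k.+1 v = d k v + eps k * act k v.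
Hypothesis edge_none : forall k, edge k = None ->
  [/\ forall v, comp k.+1 v = comp k v, forall v, d k.+1 v = d k v
    & forall a b, act k a -> cli b -> comp k a = comp k b].
Hypothesis cli_even : ~~ odd #|cli|.

(** A merge keeps the label of [x], so each component of clients contains exactly one client that
    still bears its initial label: counting roots counts components. *)
Definition root k v := cli v && (comp k v == comp 0 v).
Definition growth k := if edge k is Some _ then eps k else 0.
Local Notation e := growth.
Fixpoint moat_time k := if k is k'.+1 then moat_time k' + e k' else 0.
Local Notation t := moat_time.

(* The last time at which the component of [v] was odd. *)
Fixpoint last_active k v : nat :=
  if k is k'.+1 then
    if edge k' is Some (x, y) then
      if act k' v || (comp k' v == comp k' x) || (comp k' v == comp k' y) then t k
      else last_active k' v
    else last_active k' v
  else 0.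
Local Notation T := last_active.

Definition active_roots k := \sum_(v | root k v) act k v.

(* Total of the dual variables of the odd components. *)
Fixpoint dual k := if k is k'.+1 then dual k' + e k' * active_roots k' else 0.
Local Notation Y := dual.

Lemma act_comp k v w : cli v -> cli w -> comp k v = comp k w -> act k v = act k w.
Proof. by move=> cv cw h; rewrite /act cv cw /size_class h. Qed.

(** An odd component would then contain all the clients, whose number is even. *)
Lemma edge_none_act k v : edge k = None -> act k v = false.
Proof.
move=> /edge_none [_ _ h]; apply/negP => av; have /andP [cv] := av.
rewrite /size_class (eq_bigr (fun=> 1)); last first.
  by move=> w cw; rewrite (h v w av cw) eqxx.
by rewrite sum1_card (negbTE cli_even).
Qed.

Lemma d_step k v : d k.+1 v = d k v + e k * act k v.
Proof.
rewrite /growth; case E: (edge k) => [[x y]|]; first by rewrite (d_some E).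
by have [_ -> _] := edge_none E; rewrite addn0.
Qed.

Lemma root_of k v : cli v -> exists w, [/\ cli w, comp 0 w = comp k v & comp k w = comp k v].
Proof.
elim: k v => [|k IH] v cv; first by exists v.
case E: (edge k) => [[x y]|]; last first.
  have [h _ _] := edge_none E; have [w [cw h1 h2]] := IH v cv.
  by exists w; rewrite !h.
have [/andP [cx _] cy ne _ _] := edge_some E.
have h := comp_some E; rewrite h; case: eqP => hv.
  have [w [cw h1 h2]] := IH x cx; exists w; split=> //.
  by rewrite h h2 (negbTE ne).
have [w [cw h1 h2]] := IH v cv; exists w; split=> //.
by rewrite h h2; case: eqP.
Qed.

Lemma last_active_leq k v : T k v <= t k.
Proof.
elim: k v => //= k IH v; case: (edge k) => [[x y]|].
  by case: ifP => // _; apply: leq_trans (IH v) _; rewrite /= leq_addr.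
by apply: leq_trans (IH v) _; rewrite /= leq_addr.
Qed.

Lemma act_step k x y v : edge k = Some (x, y) ->
  cli v -> comp k v != comp k x -> comp k v != comp k y -> act k.+1 v = act k v.
Proof.
move=> E cv vx vy; rewrite /act /size_class; congr (_ && odd _).
apply: eq_bigr => w cw; rewrite !(comp_some E) (negbTE vy).
case: (eqVneq (comp k w) (comp k y)) => [->|//].
by rewrite eq_sym (negbTE vx) eq_sym (negbTE vy).
Qed.

Lemma last_active_act k v : act k v -> T k v = t k.
Proof.
elim: k v => //= k IH v av; case E: (edge k) => [[x y]|]; last first.
  have [h _ _] := edge_none E.
  have : act k v by move: av; rewrite /act /size_class h; under eq_bigr do rewrite h.
  by rewrite (edge_none_act _ E).
have cv : cli v by case/andP: av.
case: ifP => //; move=> /negbT; rewrite !negb_or => /andP [/andP [n1 n2] n3].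
by move: av; rewrite (act_step E) // (negbTE n1).
Qed.

Lemma last_active_comp k v w : cli v -> cli w -> comp k v = comp k w -> T k v = T k w.
Proof.
elim: k v w => //= k IH v w cv cw; case E: (edge k) => [[x y]|]; last first.
  by have [h _ _] := edge_none E; rewrite !h => ?; apply: IH.
rewrite !(comp_some E).
have [/andP [cx _] cy ne _ _] := edge_some E.
case: (eqVneq (comp k v) (comp k y)) => hv; case: (eqVneq (comp k w) (comp k y)) => hw h.
- by rewrite !orbT.
- by rewrite h eqxx !orbT.
- by rewrite h eqxx !orbT.
- by rewrite (act_comp cv cw h) h; case: ifP => // _; apply: IH.
Qed.

(** Dual feasibility: components separated after a merge were separated before it, and the growth
    overruns no gap that has an odd side. *)
Lemma d_feasible k a b : cli a -> cli b -> comp k a != comp k b ->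
  d k a + d k b <= D a b.
Proof.
elim: k a b => [|k IH] a b ca cb; first by rewrite !d0.
case E: (edge k) => [[x y]|]; last first.
  by have [h1 h2 _] := edge_none E; rewrite !h1 !h2; apply: IH.
have [ax cy nexy _ hf] := edge_some E.
rewrite !(comp_some E) !(d_some E).
move=> ne; have ne' : comp k a != comp k b.
  by apply: contraNneq ne => ->.
have := IH a b ca cb ne'; have := hf a b ^~ cb; have := hf b a ^~ ca.
rewrite ne' eq_sym ne' (D_sym b a).
by case: (act k a) => /=; case: (act k b) => /=; lia.
Qed.

(** Rounding leaves at most one unit of the gap uncovered, and only when both sides are odd. As the
    distance is at least 2, at least one unit is covered, so doubling suffices. *)
Lemma edge_tight k x y : edge k = Some (x, y) -> D x y <= 2 * (d k.+1 x + d k.+1 y).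
Proof.
move=> E; have [ax cy ne h _] := edge_some E.
have cx : cli x by case/andP: ax.
have xy : x != y by apply: contraNneq ne => ->.
have := D_gt1 xy; have := d_feasible cx cy ne; rewrite !(d_some E) ax.
by move: h; case: (act k y) => /=; lia.
Qed.

(** * Weak duality: the moats bound every perfect matching from below *)

Section Dual.
Variable p : V -> V.
Hypothesis pP : forall v, cli v -> [/\ cli (p v), p (p v) = v & p v != v].

(* Total of the dual variables of the components that separate [a] from [p a]. *)
Fixpoint load k a := if k is k'.+1 then
  if comp k' a == comp k' (p a) then load k' a else d k a + d k (p a) else 0.

Lemma load_sep k a : comp k a != comp k (p a) -> load k a = d k a + d k (p a).
Proof.
case: k => [|k] /=; first by rewrite !d0.
case: (eqVneq (comp k a) (comp k (p a))) => //= h.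
case E: (edge k) => [[x y]|]; last by have [h1 _ _] := edge_none E; rewrite !h1 h eqxx.
by rewrite !(comp_some E) h eqxx.
Qed.

Lemma load_leq k a : cli a -> load k a <= D a (p a).
Proof.
move=> ca; have [cp _ _] := pP ca; elim: k => //= k IH; case: eqP => // /eqP ne.
have := d_feasible ca cp ne; have := IH.
rewrite load_sep //.
case E: (edge k) => [[x y]|]; last first.
  by have [h1 h2 _] := edge_none E; rewrite !h2.
have [ax cy nexy _ hf] := edge_some E.
rewrite !(d_some E).
have := hf a (p a) ^~ cp; have := hf (p a) a ^~ ca.
rewrite ne eq_sym ne (D_sym _ a).
by case: (act k a) => /=; case: (act k (p a)) => /=; lia.
Qed.

(** Otherwise [p] would be an involution without fixed points of an odd component. *)
Lemma crossing k v : act k v ->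
  exists a, [/\ cli a, comp k a = comp k v & comp k a != comp k (p a)].
Proof.
move=> /andP [cv]; rewrite /size_class => ho.
case: (pickP [pred a | [&& cli a, comp k a == comp k v & comp k a != comp k (p a)]]).
  by move=> a /= /and3P [ca /eqP h n]; exists a.
move=> h0; exfalso; move: ho.
rewrite (_ : \sum_(w | _) _ = #|[set w | cli w && (comp k w == comp k v)]|); last first.
  rewrite -sum1dep_card.
  by rewrite [RHS]big_mkcondr /=; apply: eq_bigr => w _; case: eqP.
apply/negP; apply: (@even_involution _ p) => w; rewrite !inE => /andP [cw /eqP hw].
have [cp pp pn] := pP cw; split=> //; rewrite cp /=.
by have := h0 w; rewrite /= cw hw eqxx /= => /negbFE /eqP <-.
Qed.

Lemma active_roots_leq k :
  active_roots k <= \sum_(a | cli a && (comp k a != comp k (p a))) act k a.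
Proof.
rewrite /active_roots; pose Q a := cli a && (comp k a != comp k (p a)).
rewrite [X in _ <= X](_ : _ = \sum_(a | Q a) act k a) //.
apply: (@leq_trans (\sum_(v | root k v) \sum_(a | Q a) act k a * (comp k a == comp k v))).
  apply: leq_sum => v /andP [cv rv]; case av: (act k v) => //.
  have [a [ca hav hac]] := crossing av.
  rewrite (bigD1 a) /=; last by rewrite /Q ca.
  by rewrite hav eqxx (act_comp ca cv hav) av.
rewrite exchange_big /=; apply: leq_sum => a _.
rewrite -big_distrr /= -[X in _ <= X]muln1 leq_mul2l; apply/orP; right.
apply: sum_leq_single => [z z' /andP [_ /eqP rz] /andP [_ /eqP rz']|z _]; last by case: eqP.
rewrite !lt0b => /eqP h1 /eqP h2; apply: comp0_inj.
by rewrite -rz -rz' -h1 h2.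
Qed.

(** Each odd component is crossed by some pair; the sum over clients sees each pair from both ends,
    hence the factor 2. *)
Lemma dual_load k : 2 * Y k <= \sum_(a | cli a) load k a.
Proof.
elim: k => //= k IH; rewrite mulnDr.
have -> : \sum_(a | cli a) load k.+1 a = \sum_(a | cli a) load k a +
    \sum_(a | cli a && (comp k a != comp k (p a))) e k * (act k a + act k (p a)).
  rewrite big_mkcondr -big_split /=; apply: eq_bigr => a ca.
  case: (eqVneq (comp k a) (comp k (p a))) => //= [_|ne]; first by rewrite addn0.
  by rewrite load_sep // !d_step; lia.
rewrite -big_distrr /= big_split /=.
(* [p] exchanges the two ends of the separated pairs. *)
have -> : \sum_(a | cli a && (comp k a != comp k (p a))) act k (p a) =
   \sum_(a | cli a && (comp k a != comp k (p a))) act k a.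
  rewrite [RHS](reindex_onto p p) /=.
    apply: eq_bigl => a; apply/andP/andP => [[ca ne]|[/andP [cp ne] /eqP pa]].
      have [cp pp _] := pP ca; split; last by rewrite pp.
      by rewrite cp pp eq_sym.
    by have [ca _ _] := pP cp; move: ca ne; rewrite pa eq_sym => -> ->.
  by move=> a /andP [ca _]; have [] := pP ca.
have := active_roots_leq k; set A := active_roots k.
set B := \sum_(a | _) _ => AB.
apply: leq_add IH _; rewrite mulnCA leq_mul2l; apply/orP; right; lia.
Qed.

Lemma dual_leq k : 2 * Y k <= \sum_(a | cli a) D a (p a).
Proof. by apply: leq_trans (dual_load k) _; apply: leq_sum => a; apply: load_leq. Qed.
End Dual.

Lemma root_succ k x y v : edge k = Some (x, y) ->
  root k.+1 v = root k v && (comp k v != comp k y).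
Proof.
move=> E; have [/andP [cx _] cy ne _ _] := edge_some E.
rewrite /root (comp_some E) -andbA; congr (_ && _).
case: (eqVneq (comp k v) (comp k y)) => h; last by rewrite andbT.
rewrite andbF; apply/eqP => h2.
have [w [cw h3 h4]] := root_of k cx.
have : v = w by apply: comp0_inj; rewrite -h2 h3.
by move=> vw; move: ne; rewrite -h4 -vw h eqxx.
Qed.

Let inR k v : (v \in root k) = root k v. Proof. by []. Qed.

(** Each merge removes one root, and a client always has a root in its component, so [#|cli|] steps
    exhaust the odd components. *)
Lemma no_act k : #|cli| <= k -> forall v, act k v = false.
Proof.
move=> hk v.
have [h|h] : (forall v, act k v = false) \/ #|root k| + k <= #|cli|.
- elim: k {hk} => [|k [IH|IH]].
  + by right; rewrite addn0; apply/subset_leq_card/subsetP => w /andP [].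
  + left=> w; case E: (edge k) => [[x y]|].
      by have [] := edge_some E; rewrite IH.
    by have [h _ _] := edge_none E; rewrite -(IH w) /act /size_class h; under eq_bigr do rewrite h.
  + case E: (edge k) => [[x y]|]; last first.
      have [h _ _] := edge_none E; left=> w.
      by rewrite -(edge_none_act w E) /act /size_class h; under eq_bigr do rewrite h.
    right; rewrite addnS -addSn; apply: leq_trans IH; rewrite leq_add2r.
    have [_ cy ne _ _] := edge_some E; have [w [cw h1 h2]] := root_of k cy.
    apply: proper_card; apply/properP; split.
      by apply/subsetP => z; rewrite !inR (root_succ _ E) => /andP [].
    exists w; first by rewrite inR /root cw h1 h2 eqxx.
    by rewrite inR (root_succ _ E) h2 eqxx andbF.
- exact: h.
apply/negP => /andP [cv _]; have [w [cw h1 h2]] := root_of k cv.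
have : 0 < #|root k| by apply/card_gt0P; exists w; rewrite inR /root cw h1 h2 eqxx.
lia.
Qed.

(** * The backward pass and its potential *)

Variable N : nat.
Hypothesis N_large : #|cli| <= N.

Definition unmatched (m : V -> option V) k y :=
  \sum_(w | cli w) ((comp k w == comp k y) && (m w == None)).

(** Testing the side of [y] is enough: the merged component has an even number of unmatched clients,
    so the two sides have the same parity. *)
Definition back_step k (m : V -> option V) :=
  if edge k is Some (x, y) then
    if odd (unmatched m k y) then splice m x y else m
  else m.

Fixpoint back i : V -> option V :=
  if i is i'.+1 then back_step (N - i'.+1) (back i') else fun => None.

Definition roots_time k := \sum_(v | root k v) T k v.

(* [J] is the cost of the edges kept so far and [R v] the number of them at [v].  The
   potential compares, component by component, the degree of the kept edges at the
   components with the number of odd components, integrated over time; passing a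
   merge backwards uses that a kept edge enters an odd component or a component
   already met by a kept edge. *)
Definition back_inv k (m : V -> option V) :=
  [/\ mates m, forall v, m v != None -> cli v,
      forall v, cli v -> ~~ odd (unmatched m k v) &
   exists (R : V -> nat) J, [/\ forall v, cli v -> (m v == None) = ~~ odd (R v),
     mate_cost D m <= 2 * J &
     J + 4 * Y k + 2 * \sum_(v | cli v) R v * T k v <=
     4 * Y N + 4 * roots_time k + 2 * \sum_(v | cli v) R v * d k v]].

Lemma back_inv0 : back_inv N (fun => None).
Proof.
split=> //.
- move=> v cv; have := no_act N_large v; rewrite /act cv /= => /negbT.
  by rewrite /size_class /unmatched; under eq_bigr do rewrite -[X in nat_of_bool X]andbT.
- exists (fun => 0), 0; split => //; first by rewrite /mate_cost big1.
  have z (f : V -> nat) : \sum_(v | cli v) 0 * f v = 0 by apply: big1.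
  by rewrite !z; lia.
Qed.

Lemma unmatched_splice m k x y v : cli x -> cli y -> x != y -> mates m ->
  odd (unmatched (splice m x y) k v) =
  odd (unmatched m k v) (+) (comp k x == comp k v) (+) (comp k y == comp k v).
Proof.
move=> cx cy xy hm; rewrite /unmatched !odd_sum.
rewrite -(addb_single (P := cli) (fun w => comp k w == comp k v) cx).
rewrite -(addb_single (P := cli) (fun w => comp k w == comp k v) cy).
rewrite -!big_split /=; apply: eq_bigr => w cw; rewrite (splice_None _ hm xy).
by case: (comp k w == _); rewrite ?andbF ?andbT ?addbF //.
Qed.

Lemma unmatched_comp m k v w : comp k v = comp k w -> unmatched m k v = unmatched m k w.
Proof. by move=> h; rewrite /unmatched h. Qed.

(** The whole merged component is stamped with the current time. Odd components, that of [x]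
    included, advance by the growth; that of [y] moreover catches up on the time it was idle. Terms
    stand on both sides to avoid truncated subtraction. *)
Lemma last_active_step k x y v : edge k = Some (x, y) -> cli v ->
  T k.+1 v + (comp k v == comp k y) * (T k y + e k * act k y) =
  T k v + e k * act k v + (comp k v == comp k y) * t k.+1.
Proof.
move=> E cv; have [ax cy ne _ _] := edge_some E; rewrite /= E.
have cx : cli x by case/andP: ax.
case: (eqVneq (comp k v) (comp k y)) => [h|h].
  by rewrite !orbT !mul1n (last_active_comp cv cy h) (act_comp cv cy h) addnC.
rewrite !mul0n !addn0 orbF; case av: (act k v) => /=.
  by rewrite muln1 (last_active_act av).
rewrite muln0 addn0; case: eqP => // h1.
by move: av; rewrite (act_comp cv cx h1) ax.
Qed.

(** The only root lost is that of the component of [y], and [T k y + e k * act k y] is its share. *)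
Lemma roots_time_step k x y : edge k = Some (x, y) ->
  roots_time k.+1 + (T k y + e k * act k y) = roots_time k + e k * active_roots k.
Proof.
move=> E; have [ax cy ne _ _] := edge_some E.
have [w [cw h1 h2]] := root_of k cy.
have rw : root k w by rewrite /root cw h1 h2 eqxx.
rewrite /roots_time /active_roots big_distrr -big_split /=.
rewrite [RHS](bigD1 w) //= addnC (last_active_comp cw cy h2) (act_comp cw cy h2).
congr (_ + _).
have E1 v : root k.+1 v = root k v && (v != w).
  rewrite (root_succ _ E) /=; case rv: (root k v) => //=.
  congr (~~ _); apply/eqP/eqP => [h|->//].
  by apply: comp0_inj; case/andP: rv => _ /eqP <-; rewrite h h1.
rewrite (eq_bigl _ _ E1); apply: eq_bigr => v /andP [rv vw].
have cv : cli v by case/andP: rv.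
have := last_active_step E cv.
have -> : (comp k v == comp k y) = false.
  have := E1 v; rewrite (root_succ _ E) rv vw /=.
  by move/negbTE.
by rewrite !mul0n !addn0.
Qed.

(** If the edge is kept, tightness bounds [D x y] by twice the moats at its ends. Together with the
    new degree terms this requires room for [2 * t k.+1 + 2 * Ty], while [key] offers
    [4 * Ty + 2 * (R2 * dt)]. *)
Lemma back_inv_step k m : back_inv k.+1 m -> back_inv k (back_step k m).
Proof.
rewrite /back_step; case E: (edge k) => [[x y]|]; last first.
  have [h1 h2 _] := edge_none E.
  move=> [q1 q0 q2 [R [J [q3 q4 q5]]]]; split => //.
    move=> v cv; have := q2 v cv; rewrite /unmatched h1; by under eq_bigr do rewrite h1.
  exists R, J; split => //; move: q5; rewrite /= E.
  have -> : \sum_(v | cli v) R v * d k.+1 v = \sum_(v | cli v) R v * d k v.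
    by apply: eq_bigr => v _; rewrite h2.
  have -> : e k = 0 by rewrite /growth E.
  rewrite mul0n addn0.
  have -> // : roots_time k.+1 = roots_time k.
  rewrite /roots_time /= E; apply: eq_bigl => v; by rewrite /root h1.
have [ax cy ne _ _] := edge_some E.
have cx : cli x by case/andP: ax.
have xy : x != y by apply: contraNneq ne => ->.
move=> [q1 q0 q2 [R [J [q3 q4 q5]]]].
(* [R2] counts the ends of kept edges in the component of [y], [Ty] is its last active time after
   the growth of step [k], and [dt] is the time it has been idle since. *)
set R2 := \sum_(v | cli v) R v * (comp k v == comp k y).
set Ty := T k y + e k * act k y.
set dt := t k.+1 - Ty.
have Tyt : Ty <= t k.+1.
  rewrite /Ty /=; have := last_active_leq k y.
  by case: (act k y) => /=; rewrite ?muln1 ?muln0; lia.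
have key : J + 4 * Y k + 2 * \sum_(v | cli v) R v * T k v + 2 * (R2 * dt) + 4 * Ty <=
     4 * Y N + 4 * roots_time k + 2 * \sum_(v | cli v) R v * d k v.
  have S1 : \sum_(v | cli v) R v * T k.+1 v = \sum_(v | cli v) R v * T k v +
     e k * (\sum_(v | cli v) R v * act k v) + R2 * dt.
    rewrite /R2 big_distrr big_distrl -!big_split /=; apply: eq_bigr => v cv.
    transitivity (R v * T k.+1 v) => //.
    have -> : T k.+1 v = T k v + e k * act k v + (comp k v == comp k y) * dt.
      have := last_active_step E cv; rewrite -/Ty /dt.
      by case: (comp k v == _); rewrite ?mul1n ?mul0n; clear -Tyt; lia.
    by rewrite !mulnDr (mulnCA (R v)) [R v * (_ * dt)]mulnA.
  have S2 : \sum_(v | cli v) R v * d k.+1 v = \sum_(v | cli v) R v * d k v +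
     e k * (\sum_(v | cli v) R v * act k v).
    rewrite big_distrr -!big_split /=; apply: eq_bigr => v cv.
    by rewrite d_step mulnDr (mulnCA (R v)).
  have S3 := roots_time_step E; rewrite -/Ty in S3.
  move: q5; rewrite S1 S2 /=; lia.
have other v : comp k v != comp k x -> comp k v != comp k y ->
    unmatched m k.+1 v = unmatched m k v.
  move=> n1 n2; apply: eq_bigr => w _; rewrite !(comp_some E) (negbTE n2).
  case: (eqVneq (comp k w) (comp k y)) => [->|//].
  by rewrite (eq_sym (comp k x)) (negbTE n1) (eq_sym (comp k y)) (negbTE n2).
have merged : ~~ odd (unmatched m k x + unmatched m k y).
  have := q2 y cy; rewrite /unmatched -big_split /=.
  rewrite (eq_bigr (fun w => ((comp k w == comp k x) && (m w == None)) +
                      ((comp k w == comp k y) && (m w == None)))) // => w _.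
  rewrite !(comp_some E) eqxx.
  case: (eqVneq (comp k w) (comp k y)) => [->|h].
    by rewrite !eqxx (eq_sym (comp k y)) (negbTE ne).
  by rewrite addn0.
case: ifP => ho; last first.
  split => //; last by exists R, J; split => //; lia.
  move=> v cv; case: (eqVneq (comp k v) (comp k y)) => [h|h].
    by rewrite (unmatched_comp _ h) ho.
  case: (eqVneq (comp k v) (comp k x)) => [h'|h'].
    by rewrite (unmatched_comp _ h'); move: merged; rewrite oddD ho addbF.
  by rewrite -other ?q2.
split.
- exact: splice_mates.
- move=> v; rewrite (splice_None _ q1 xy).
  case: (eqVneq v x) => [->//|_]; case: (eqVneq v y) => [->//|_].
  by rewrite !addbF; apply: q0.
- move=> v cv; rewrite unmatched_splice //.
  case: (eqVneq (comp k y) (comp k v)) => [h|h].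
    by rewrite -(unmatched_comp _ h) ho -h (negbTE ne).
  case: (eqVneq (comp k x) (comp k v)) => [h'|h'].
    rewrite -(unmatched_comp _ h'); move: merged; rewrite oddD ho addbT negbK => ->.
    by [].
  by rewrite !addbF -other ?q2 // eq_sym.
exists (fun v => R v + (v == x) + (v == y)), (J + D x y); split.
- move=> v cv; rewrite (splice_None _ q1 xy) q3 // !oddD !oddb.
  by case: (odd _); case: (v == x); case: (v == y).
- by apply: leq_trans (splice_cost D_sym D_triangle q1 xy) _; rewrite mulnDr leq_add2r.
have sumR (f : V -> nat) : \sum_(v | cli v) (R v + (v == x) + (v == y)) * f v =
    \sum_(v | cli v) R v * f v + f x + f y.
  rewrite -(sum_single f cx) -(sum_single f cy) -!big_split /=.
  by apply: eq_bigr => v _; rewrite !mulnDl.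
rewrite !sumR.
have tight := edge_tight E; rewrite !d_step ax muln1 in tight.
have Tx := last_active_act ax.
have tS : t k.+1 = t k + e k by [].
(* Either [y] is active and [dt = 0], or a kept edge already ends in its component and [R2 > 0]. *)
suff : dt <= R2 * dt by rewrite /Ty /dt in key *; lia.
case ay : (act k y).
  by rewrite /dt /Ty ay muln1 (last_active_act ay) tS subnn.
apply: leq_pmull; rewrite lt0n; apply/eqP => R20.
move: ay; rewrite /act cy /= /size_class => hs.
(* With [R2 = 0] every client of the component is unmatched, so the odd number of its unmatched
   clients would equal its even size. *)
have : odd (unmatched m k y) = odd (size_class k y).
  congr odd; apply: eq_bigr => w cw; case: eqP => //= h.
  have /eqP := R20; rewrite /R2 sum_nat_eq0 => /forallP /(_ w); rewrite cw h eqxx muln1 /=.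
  by move=> /eqP R0; rewrite q3 // R0.
by rewrite ho /size_class hs.
Qed.

(** At step 0 components are singletons, so an even number of unmatched clients means none, and the
    potential terms vanish, leaving [J <= 4 * Y N]. Weak duality and [mate_cost <= 2 * J] then give
    the factor 4. *)
Theorem moat_matching (p : V -> V) :
  (forall v, cli v -> [/\ cli (p v), p (p v) = v & p v != v]) ->
  [/\ mates (back N), forall v, (back N v != None) = cli v &
      mate_cost D (back N) <= 4 * \sum_(a | cli a) D a (p a)].
Proof.
move=> pP.
have H i : i <= N -> back_inv (N - i) (back i).
  elim: i => [|i IH] hi; first by rewrite subn0; apply: back_inv0.
  rewrite /=; apply: back_inv_step; rewrite -subSn // subSS; apply: IH; exact: ltnW.
have := H N (leqnn N); rewrite subnn => -[h1 h0 h2 [R [J [h3 h4 h5]]]]; split=> //.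
  move=> v; apply/idP/idP; first exact: h0.
  move=> cv; apply/eqP => mv; have := h2 v cv.
  rewrite /unmatched (bigD1 v) //= eqxx mv eqxx big1 //= => w /andP [_ wv].
  by case: eqP => // /comp0_inj h; rewrite h eqxx in wv.
have := dual_leq pP N; move: h5 => /=.
rewrite /roots_time [X in _ <= _ + _ * X + _]big1 //.
rewrite [X in _ <= _ + _ * X]big1; last by move=> v _; rewrite d0 muln0.
lia.
Qed.
End Moats.

(** * The program *)

(* Program expressions are marked by the suffix X. *)
Definition addX := Op Add.
Definition subX := Op Monus.
Definition mulX := Op Mul.
Definition divX := Op Div.
(** Truncated subtraction from 1 yields the truth values 0 and 1. *)
Definition leX a b := subX (Lit 1) (subX a b).
Definition ltX a b := leX (addX a (Lit 1)) b.
Definition eqX a b := subX (Lit 1) (addX (subX a b) (subX b a)).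
Definition notX a := subX (Lit 1) a.
Definition parityX a := subX a (addX (divX a (Lit 2)) (divX a (Lit 2))).
Definition nX := Inp (Lit 1).

Section Eval.
Variables (s : seq nat) (st : store) (env : seq nat).
Local Notation ev := (ev s st env).

Lemma ev_add a b : ev (addX a b) = ev a + ev b. Proof. by []. Qed.
Lemma ev_sub a b : ev (subX a b) = ev a - ev b. Proof. by []. Qed.
Lemma ev_div a b : ev (divX a b) = ev a %/ ev b. Proof. by []. Qed.
Lemma ev_le a b : ev (leX a b) = (ev a <= ev b).
Proof. by rewrite !ev_sub /=; case: leqP; lia. Qed.
Lemma ev_lt a b : ev (ltX a b) = (ev a < ev b).
Proof. by rewrite ev_le ev_add addn1. Qed.
Lemma ev_eq a b : ev (eqX a b) = (ev a == ev b).
Proof. by rewrite ev_sub ev_add !ev_sub /=; case: eqP; lia. Qed.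
Lemma ev_not a : ev (notX a) = (ev a == 0).
Proof. by rewrite ev_sub /=; case: eqP; lia. Qed.
Lemma ev_odd a : ev (parityX a) = odd (ev a).
Proof.
rewrite ev_sub ev_add !ev_div [ev (Lit 2)]/= divn2.
by have := odd_double_half (ev a); rewrite -addnn; lia.
Qed.
(** The truncation in [Op Mul] is harmless here because the right operands in the program are point
    indices, the number of points or truth values. *)
Lemma ev_mul a b : ev b <= size s -> ev (mulX a b) = ev a * ev b.
Proof. by move=> h; rewrite /= (minn_idPl h). Qed.
Lemma ev_mul_bool a b (c : bool) : 0 < size s -> ev b = c -> ev (mulX a b) = ev a * c.
Proof. by move=> h e; rewrite ev_mul e //; case: c {e}. Qed.
Lemma ev_and a b (c1 c2 : bool) : 0 < size s -> ev a = c1 -> ev b = c2 ->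
  ev (mulX a b) = (c1 && c2).
Proof. by move=> h e1 e2; rewrite (ev_mul_bool _ h e2) e1; case: c1 {e1}; case: c2 {e2}. Qed.
Lemma ev_n : 0 < size s -> ev nX = nth 0 s 0.
Proof. by move=> h; rewrite /= /reg (minn_idPl h). Qed.
End Eval.

Lemma ev_var s st env i : ev s st env (Var i) = nth 0 env i.
Proof. by []. Qed.

Lemma ev_sum s st env e :
  ev s st env (Sum e) = \sum_(i < nth 0 s 0) ev s st (rcons env i) e.
Proof. by []. Qed.

Fixpoint reads (e : dexp) : seq nat :=
  match e with
  | Lit _ | Var _ => [::]
  | Inp e => reads e
  | Arr t e => t :: reads e
  | Op _ e1 e2 | MulInp e1 e2 => reads e1 ++ reads e2
  | Sum e => reads e
  end.

Fixpoint writes (c : cmd) : seq nat :=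
  match c with
  | Set_ t _ _ => [:: t]
  | Then c1 c2 => writes c1 ++ writes c2
  | When _ c | For c => writes c
  end.

Lemma ev_ext s st st' env e : (forall t i, t \in reads e -> st t i = st' t i) ->
  ev s st env e = ev s st' env e.
Proof.
elim: e env => //= [e IH|t e IH|o e1 IH1 e2 IH2|e1 IH1 e2 IH2|e IH] env h.
- by rewrite IH.
- rewrite IH ?h ?inE ?eqxx // => u i hu; rewrite h // inE hu orbT //.
- by rewrite IH1 ?IH2 // => u i hu; rewrite h // mem_cat hu ?orbT.
- by rewrite IH1 ?IH2 // => u i hu; rewrite h // mem_cat hu ?orbT.
- by apply: eq_bigr => i _; apply: IH.
Qed.

Lemma for_ind s env c st (Inv : nat -> store -> Prop) :
  Inv 0 st ->
  (forall i st', i < nth 0 s 0 -> Inv i st' -> Inv i.+1 (run s (rcons env i) c st')) ->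
  Inv (nth 0 s 0) (run s env (For c) st).
Proof.
move=> h0 hS /=; elim: {-2}(nth 0 s 0) (leqnn (nth 0 s 0)) => // k IH hk.
by rewrite iter_forS; apply: hS => //; apply: IH; apply: ltnW.
Qed.

Lemma run_frame s env c st t i : t \notin writes c -> run s env c st t i = st t i.
Proof.
elim: c env st => [u e1 e2|c1 IH1 c2 IH2|e c IH|c IH] env st /=.
- by rewrite inE /upd => /negbTE ->.
- by rewrite mem_cat negb_or => /andP [h1 h2]; rewrite IH2 // IH1.
- by move=> h; case: ifP => // _; rewrite IH.
- move=> h; elim: (nth 0 s 0) => // k IHk.
  by rewrite iter_forS IH.
Qed.

(** [k] is the number of enclosing loops, hence the level of the index variable of this one. *)
Definition tab k t e := For (Set_ t (Var k) e).

(** If [e] read the array being filled, later entries would see updated ones; this is why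
    [merge_prog] updates its arrays through [aTMP]. *)
Lemma run_tab s env st k t e t' i : size env = k -> t \notin reads e ->
  run s env (tab k t e) st t' i =
  if (t' == t) && (i < nth 0 s 0) then ev s st (rcons env i) e else st t' i.
Proof.
move=> hk ht.
pose Inv m (st' : store) := forall t' i,
  st' t' i = if (t' == t) && (i < m) then ev s st (rcons env i) e else st t' i.
suff : Inv (nth 0 s 0) (run s env (tab k t e) st) by apply.
apply: for_ind => [|j st' hj IH] {t' i} t' i; first by rewrite andbF.
rewrite /= /upd -hk nth_rcons ltnn eqxx.
case: (eqVneq t' t) => [->|tt] /=; last by rewrite IH (negbTE tt).
rewrite ltnS leq_eqVlt; case: (eqVneq i j) => [->|ij] /=; last by rewrite IH eqxx.
apply: ev_ext => u l hu; rewrite IH; case: eqP => // ut.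
by rewrite -ut hu in ht.
Qed.

Definition bestX k a v i :=
  mulX (Arr a i)
    (eqX (Sum (mulX (Arr a (Var k)) (ltX (Arr v (Var k)) (Arr v i)))) (Lit 0)).

(** A search written as a count: the number of indices with no best index at or before them is the
    first best index, or the number of points if there is none. *)
Definition argminX k a v :=
  Sum (eqX (Sum (mulX (leX (Var k.+1) (Var k)) (bestX k.+2 a v (Var k.+1)))) (Lit 0)).

Lemma sum_bool_eq0 n (P : nat -> bool) :
  (\sum_(i < n) P i == 0) = [forall i : 'I_n, ~~ P i].
Proof. by rewrite sum_nat_eq0; apply: eq_forallb => i; rewrite eqb0. Qed.

Lemma sum_ltn n l : \sum_(i < n) (i < l) = minn n l.
Proof. by elim: n => [|n IH]; rewrite ?big_ord0 ?min0n // big_ord_recr /= IH; lia. Qed.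

Lemma first_index n (P : nat -> bool) :
  let v := \sum_(i < n) (\sum_(j < n) ((j <= i) && P j) == 0) in
  (v = n /\ forall j, j < n -> ~~ P j) \/ (v < n /\ P v).
Proof.
move=> v.
case: (pickP [pred i : 'I_n | P i]) => [i0 Pi0|h0]; last first.
  left; split; last by move=> j hj; have := h0 (Ordinal hj) => /= ->.
  rewrite /v (eq_bigr (fun=> 1)) ?sum1_card ?card_ord // => i _.
  rewrite big1 // => j _; have := h0 j => /= ->; by rewrite andbF.
case: (@arg_minnP _ i0 [pred i : 'I_n | P i] (fun i => i) Pi0) => m /= Pm mmin.
suff -> : v = m by right.
rewrite /v (eq_bigr (fun i : 'I_n => (i < m : nat))).
  by rewrite sum_ltn (minn_idPr (ltnW (ltn_ord m))).
move=> i _; congr nat_of_bool.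
rewrite (@sum_bool_eq0 n (fun j => (j <= i) && P j)).
apply/forallP/idP => [h|im j]; first by have := h m; rewrite Pm andbT -ltnNge.
by apply/negP => /andP [ji Pj]; have := mmin j Pj; lia.
Qed.

Lemma argmin_correct s (st : store) env k a v (ok : nat -> bool) n :
  0 < size s -> nth 0 s 0 = n -> size env = k -> (forall i, i < n -> st a i = ok i) ->
  let x := ev s st env (argminX k a v) in
  (x = n /\ forall j, j < n -> ~~ ok j) \/
  [/\ x < n, ok x & forall j, j < n -> ok j -> st v x <= st v j].
Proof.
move=> s0 <- hk hok x; set n' := nth 0 s 0 in hok *.
pose best i := ok i && [forall j : 'I_n', ~~ (ok j && (st v j < st v i))].
have Eb env' i : size env' = k.+2 -> i < n' -> nth 0 env' k.+1 = i ->
    ev s st env' (bestX k.+2 a v (Var k.+1)) = best i.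
  move=> hs hi hn; apply: ev_and => //; first by rewrite /= hn hok.
  rewrite ev_eq; congr (nat_of_bool _).
  rewrite -(@sum_bool_eq0 n' (fun j => ok j && (st v j < st v i))).
  congr (_ == _); rewrite ev_sum; apply: eq_bigr => j _; apply: ev_and => //.
    by rewrite /= nth_rcons hs ltnn eqxx hok.
  by rewrite ev_lt /= !nth_rcons hs ltnn eqxx ltnSn hn.
have -> : x = \sum_(i < n') (\sum_(j < n') ((j <= i) && best j) == 0).
  rewrite /x ev_sum; apply: eq_bigr => i _; rewrite ev_eq; congr (nat_of_bool (_ == _)).
  rewrite ev_sum; apply: eq_bigr => j _; apply: ev_and => //.
    by rewrite ev_le /= !nth_rcons !size_rcons hk ltnn eqxx ltnSn ltnn eqxx.
  by apply: Eb => //; rewrite ?size_rcons ?hk // nth_rcons size_rcons hk ltnn eqxx.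
case: (first_index n' best) => [[-> h]|[h1 /andP [h2 /forallP h3]]].
  left; split => // j hj; apply/negP => oj.
  case: (@arg_minnP _ (Ordinal hj) [pred i : 'I_n' | ok i] (fun i => st v i) oj) => m /= om mmin.
  have := h m (ltn_ord m); rewrite /best om /= => /negP; apply.
  apply/forallP => l; apply/negP => /andP [ol]; rewrite ltnNge => /negP; apply.
  exact: mmin.
right; split => // j hj oj.
by have := h3 (Ordinal hj); rewrite /= oj /= -leqNgt.
Qed.

Arguments ev : simpl never.
Arguments run : simpl never.
Arguments tab : simpl never.

Lemma run_then s env c1 c2 st :
  run s env (Then c1 c2) st = run s env c2 (run s env c1 st).
Proof. by []. Qed.
Lemma run_set s env t e1 e2 st :
  run s env (Set_ t e1 e2) st = upd st t (ev s st env e1) (ev s st env e2).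
Proof. by []. Qed.
Lemma run_when s env e c st :
  run s env (When e c) st = if ev s st env e != 0 then run s env c st else st.
Proof. by []. Qed.
Lemma ev_arr s st env t e : ev s st env (Arr t e) = st t (ev s st env e).
Proof. by []. Qed.
Lemma ev_lit s st env c : ev s st env (Lit c) = c.
Proof. by []. Qed.
Lemma updE st t i v t' i' :
  upd st t i v t' i' = if (t' == t) && (i' == i) then v else st t' i'.
Proof. by []. Qed.

(** * Arrays, input layout and the program text *)

Local Notation aQ := 0 (only parsing).
Local Notation aOK := 1 (only parsing).
Local Notation aVAL := 2 (only parsing).
Local Notation aR := 3 (only parsing).
Local Notation aOPN := 4 (only parsing).
Local Notation aNEAR := 5 (only parsing).
Local Notation aCOMP := 6 (only parsing).
Local Notation aD := 7 (only parsing).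
Local Notation aACT := 8 (only parsing).
Local Notation aBV := 9 (only parsing).
Local Notation aBVAL := 10 (only parsing).
Local Notation aBOK := 11 (only parsing).
Local Notation aLAB := 12 (only parsing).
Local Notation aEA := 13 (only parsing).
Local Notation aEB := 14 (only parsing).
Local Notation aVALID := 15 (only parsing).
Local Notation aTMP := 16 (only parsing).
Local Notation aMATE := 17 (only parsing).
Local Notation aSIG := 18 (only parsing).
Local Notation aSOL := 19 (only parsing).
Local Notation aX := 20 (only parsing).
Local Notation aY := 21 (only parsing).

(** Register 1 holds the number of points. Point [i] owns five registers from [2 + 5 * i] on: the
    facility, client and parity bits, then numerator and denominator of its opening cost. The
    distances come next, two registers each, row by row. *)
Definition facX i := Inp (addX (Lit 2) (mulX (Lit 5) i)).
Definition cliX i := Inp (addX (Lit 3) (mulX (Lit 5) i)).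
Definition openNumX i := addX (Lit 5) (mulX (Lit 5) i).
Definition openDenX i := addX (Lit 6) (mulX (Lit 5) i).
Definition pairX i j := addX (mulX nX i) j.
Definition distNumX i j :=
  addX (addX (Lit 2) (mulX (Lit 5) nX)) (addX (pairX i j) (pairX i j)).
Definition distDenX i j := addX (distNumX i j) (Lit 1).
Definition qX := Arr aQ (Lit 0).
(** The denominator divides the scale factor, so the division is exact, and the multiplication is by
    an input number, as [MulInp] demands. *)
Definition distX i j := MulInp (divX qX (Inp (distDenX i j))) (distNumX i j).
Definition openX i := MulInp (divX qX (Inp (openDenX i))) (openNumX i).

Definition scale_prog :=
  Then (Set_ aQ (Lit 0) (addX nX nX))
  (Then (For (Set_ aQ (Lit 0) (MulInp qX (openDenX (Var 0)))))
        (For (For (Set_ aQ (Lit 0) (MulInp qX (distDenX (Var 0) (Var 1))))))).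

Definition nearerX := mulX (cliX (Var 2)) (leX (distX (Var 0) (Var 2)) (distX (Var 0) (Var 1))).

Definition radius_prog := For
  (Then (tab 1 aOK (cliX (Var 1)))
  (Then (tab 1 aVAL (divX (addX (openX (Var 0)) (Sum (mulX (distX (Var 0) (Var 2)) nearerX)))
                          (Sum nearerX)))
  (Then (Set_ aX (Lit 0) (argminX 1 aOK aVAL))
        (Set_ aR (Var 0) (Arr aVAL (Arr aX (Lit 0))))))).

Definition coveredX := Sum (mulX (Arr aOPN (Var 2))
  (leX (distX (Var 1) (Var 2)) (addX (Arr aR (Var 1)) (Arr aR (Var 1))))).

(** Each round opens an uncovered facility of least radius. When none is left, [argminX] returns the
    number of points and the mark falls outside the range of the points. *)
Definition open_prog := For
  (Then (tab 1 aOK (mulX (facX (Var 1)) (eqX coveredX (Lit 0))))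
  (Then (Set_ aX (Lit 0) (argminX 1 aOK aR))
        (Set_ aOPN (Arr aX (Lit 0)) (Lit 1)))).

Definition near_prog := For
  (Then (tab 1 aVAL (distX (Var 1) (Var 0)))
        (Set_ aNEAR (Var 0) (argminX 1 aOPN aVAL))).

(** Each step keeps a snapshot of the labels, because the backward pass needs the components as they
    were before each merge. *)
Definition label_prog := For (Set_ aLAB (pairX (Var 0) (Var 1)) (Arr aCOMP (Var 1))).

Definition act_prog := tab 1 aACT (mulX (cliX (Var 1))
  (parityX (Sum (mulX (cliX (Var 2)) (eqX (Arr aCOMP (Var 2)) (Arr aCOMP (Var 1))))))).

(** The minimum over pairs is nested: the best partner of each [u] is found here, then [moat_body]
    minimises over the odd [u] that have a partner. *)
Definition candidate_prog := For
  (Then (tab 2 aOK (mulX (cliX (Var 2)) (notX (eqX (Arr aCOMP (Var 2)) (Arr aCOMP (Var 1))))))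
  (Then (tab 2 aVAL (divX
     (subX (distX (Var 1) (Var 2)) (addX (Arr aD (Var 1)) (Arr aD (Var 2))))
     (addX (Lit 1) (Arr aACT (Var 2)))))
  (Then (Set_ aX (Lit 0) (argminX 2 aOK aVAL))
  (Then (Set_ aBV (Var 1) (Arr aX (Lit 0)))
  (Then (Set_ aBVAL (Var 1) (Arr aVAL (Arr aX (Lit 0))))
        (Set_ aBOK (Var 1) (mulX (Arr aACT (Var 1)) (ltX (Arr aX (Lit 0)) nX)))))))).

Definition sameX := eqX (Arr aCOMP (Var 1)) (Arr aCOMP (Arr aEB (Var 0))).

Definition merge_prog :=
  Then (tab 1 aTMP (addX (Arr aD (Var 1))
          (mulX (Arr aBVAL (Arr aX (Lit 0))) (Arr aACT (Var 1)))))
  (Then (tab 1 aD (Arr aTMP (Var 1)))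
  (Then (tab 1 aTMP (addX (mulX (Arr aCOMP (Arr aEA (Var 0))) sameX)
                          (mulX (Arr aCOMP (Var 1)) (notX sameX))))
        (tab 1 aCOMP (Arr aTMP (Var 1))))).

Definition moat_body :=
  Then label_prog
  (Then act_prog
  (Then candidate_prog
  (Then (Set_ aX (Lit 0) (argminX 1 aBOK aBVAL))
  (Then (Set_ aVALID (Var 0) (ltX (Arr aX (Lit 0)) nX))
  (Then (Set_ aEA (Var 0) (Arr aX (Lit 0)))
  (Then (Set_ aEB (Var 0) (Arr aBV (Arr aX (Lit 0))))
        (When (Arr aVALID (Var 0)) merge_prog))))))).

Definition moat_prog := Then (tab 0 aCOMP (Var 0)) (For moat_body).

Definition kX := Arr aX (Lit 0).
Definition uX := Arr aX (Lit 1).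
Definition vX := Arr aX (Lit 2).
Definition aaX := Arr aX (Lit 3).
Definition bbX := Arr aX (Lit 4).
Definition endpointX u :=
  addX (mulX u (eqX (Arr aMATE u) (Lit 0))) (subX (Arr aMATE u) (Lit 1)).

(* [aMATE] holds 0 for an unmatched point and one plus its partner otherwise. *)
Definition splice_prog :=
  Then (Set_ aX (Lit 3) (endpointX uX))
  (Then (Set_ aX (Lit 4) (endpointX vX))
  (Then (Set_ aMATE uX (Lit 0))
  (Then (Set_ aMATE vX (Lit 0))
        (When (notX (eqX aaX vX))
           (Then (Set_ aMATE aaX (addX bbX (Lit 1)))
                 (Set_ aMATE bbX (addX aaX (Lit 1)))))))).

Definition back_prog := For
  (Then (Set_ aX (Lit 0) (subX nX (addX (Var 0) (Lit 1))))
  (Then (Set_ aX (Lit 1) (Arr aEA kX))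
  (Then (Set_ aX (Lit 2) (Arr aEB kX))
        (When (Arr aVALID kX)
          (When (parityX (Sum (mulX (cliX (Var 1))
             (mulX (eqX (Arr aLAB (pairX kX (Var 1))) (Arr aLAB (pairX kX vX)))
                   (eqX (Arr aMATE (Var 1)) (Lit 0))))))
            splice_prog))))).

Definition partnerX := subX (Arr aMATE (Var 0)) (Lit 1).
(** The double subtraction is the minimum of a point and its partner, so both partners read the same
    entry of [aNEAR]. Points that are not clients get 0, which is a legal index, and only facilities
    that serve a client are opened. *)
Definition final_prog :=
  Then (tab 0 aSIG (mulX (Arr aNEAR (subX (Var 0) (subX (Var 0) partnerX))) (cliX (Var 0))))
       (tab 0 aSOL (ltX (Lit 0) (Sum (mulX (cliX (Var 1)) (eqX (Arr aSIG (Var 1)) (Var 0)))))).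

Definition main_prog :=
  Then scale_prog (Then radius_prog (Then open_prog (Then near_prog
  (Then (Then moat_prog back_prog) final_prog)))).

(** * The program computes the data assumed by the analysis *)

Section Run.
Variables (s : seq nat) (n : nat) (facb clib : nat -> bool).
Variables (fnum fden : nat -> nat) (dnum dden : nat -> nat -> nat).
Hypothesis s_n : nth 0 s 0 = n.
Hypothesis s_size : size s = 1 + 5 * n + 2 * (n * n).
Hypothesis reg_fac : forall i, i < n -> reg s (2 + 5 * i) = facb i.
Hypothesis reg_cli : forall i, i < n -> reg s (3 + 5 * i) = clib i.
Hypothesis reg_fnum : forall i, i < n -> reg s (5 + 5 * i) = fnum i.
Hypothesis reg_fden : forall i, i < n -> reg s (6 + 5 * i) = fden i.
Hypothesis reg_dnum : forall i j, i < n -> j < n ->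
  reg s (2 + 5 * n + ((n * i + j) + (n * i + j))) = dnum i j.
Hypothesis reg_dden : forall i j, i < n -> j < n ->
  reg s (2 + 5 * n + ((n * i + j) + (n * i + j)) + 1) = dden i j.

Let s0 : 0 < size s. Proof. by rewrite s_size. Qed.
Let n_size : n <= size s. Proof. by rewrite s_size; lia. Qed.

Lemma ev_fac st env a i : ev s st env a = i -> i < n -> ev s st env (facX a) = facb i.
Proof.
move=> h hi; rewrite -reg_fac // -[LHS]/(reg s (ev s st env (addX (Lit 2) (mulX (Lit 5) a)))).
by rewrite ev_add ev_mul h ?(leq_trans (ltnW hi)).
Qed.

Lemma ev_cli st env a i : ev s st env a = i -> i < n -> ev s st env (cliX a) = clib i.
Proof.
move=> h hi; rewrite -reg_cli // -[LHS]/(reg s (ev s st env (addX (Lit 3) (mulX (Lit 5) a)))).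
by rewrite ev_add ev_mul h ?(leq_trans (ltnW hi)).
Qed.

Lemma ev_pair st env a b i j : ev s st env a = i -> ev s st env b = j -> i < n ->
  ev s st env (pairX a b) = n * i + j.
Proof.
move=> ha hb hi; rewrite ev_add ev_mul; last by rewrite ha (leq_trans (ltnW hi)).
by rewrite ev_n // s_n ha hb.
Qed.

Lemma ev_distNum st env a b i j : ev s st env a = i -> ev s st env b = j -> i < n ->
  ev s st env (distNumX a b) = 2 + 5 * n + ((n * i + j) + (n * i + j)).
Proof.
move=> ha hb hi; have hn : ev s st env nX = n by rewrite ev_n // s_n.
have hm : ev s st env (mulX (Lit 5) nX) = 5 * n by rewrite ev_mul hn.
rewrite -[LHS]/(2 + ev s st env (mulX (Lit 5) nX) +
  (ev s st env (pairX a b) + ev s st env (pairX a b))).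
by rewrite !(ev_pair ha hb hi) hm.
Qed.

Definition scaled q i j := q %/ dden i j * dnum i j.
Definition scaled_open q i := q %/ fden i * fnum i.

Lemma ev_dist st env a b q i j : st aQ 0 = q -> ev s st env a = i -> ev s st env b = j ->
  i < n -> j < n -> ev s st env (distX a b) = scaled q i j.
Proof.
move=> hq ha hb hi hj; rewrite /scaled -reg_dnum // -reg_dden //.
rewrite -[LHS]/(st aQ 0 %/ reg s (ev s st env (distDenX a b)) * reg s (ev s st env (distNumX a b))).
by rewrite ev_add (ev_distNum ha hb hi) hq.
Qed.

Lemma ev_open st env a q i : st aQ 0 = q -> ev s st env a = i -> i < n ->
  ev s st env (openX a) = scaled_open q i.
Proof.
move=> hq ha hi; rewrite /scaled_open -reg_fnum // -reg_fden //.
rewrite -[LHS]/(st aQ 0 %/ reg s (ev s st env (openDenX a)) * reg s (ev s st env (openNumX a))).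
by rewrite !ev_add !ev_mul ha ?hq // (leq_trans (ltnW hi)).
Qed.

(* Nonzero scaled values are at least [2 * n], against rounding errors of at most [n]. *)
Definition scale_factor :=
  (n + n) * (\prod_(i < n) fden i) * \prod_(i < n) \prod_(j < n) dden i j.

Lemma scale_correct st : run s [::] scale_prog st aQ 0 = scale_factor.
Proof.
rewrite /scale_prog !run_then; set st1 := run s [::] (Set_ _ _ _) st.
have h1 : st1 aQ 0 = n + n by rewrite /st1 run_set updE /= ev_add ev_n // s_n.
set st2 := run s [::] (For (Set_ _ _ _)) st1.
have h2 : st2 aQ 0 = (n + n) * \prod_(i < n) fden i.
  rewrite /st2 -[in \prod_(i < n) _]s_n.
  apply: (@for_ind s _ _ _ (fun m st => st aQ 0 = (n + n) * \prod_(i < m) fden i)).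
    by rewrite big_ord0 muln1.
  move=> i st' hi IH; rewrite run_set updE /= big_ord_recr mulnA -IH.
  rewrite s_n in hi; rewrite -reg_fden //.
  rewrite -[LHS]/(st' aQ 0 * reg s (ev s st' [:: i] (openDenX (Var 0)))).
  by rewrite ev_add ev_mul // (leq_trans (ltnW hi)).
rewrite /scale_factor -h2 -[in \prod_(i < n) _]s_n.
apply: (@for_ind s _ _ _ (fun m st =>
  st aQ 0 = st2 aQ 0 * \prod_(i < m) \prod_(j < nth 0 s 0) dden i j)).
  by rewrite big_ord0 muln1.
move=> i st' hi IH; rewrite big_ord_recr mulnA -IH /=.
apply: (@for_ind s _ _ _ (fun m st => st aQ 0 = st' aQ 0 * \prod_(j < m) dden i j)).
  by rewrite big_ord0 muln1.
move=> j st'' hj IH'; rewrite run_set updE /= big_ord_recr mulnA -IH'.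
rewrite s_n in hi hj; rewrite -reg_dden //.
rewrite -[LHS]/(st'' aQ 0 * reg s (ev s st'' [:: i; j] (distDenX (Var 0) (Var 1)))).
by rewrite ev_add (@ev_distNum _ _ _ _ i j).
Qed.

Variable q : nat.
Local Notation DD := (scaled q).
Local Notation FF := (scaled_open q).

Definition nearer i t j := clib j && (DD i j <= DD i t).
Definition radius i t :=
  (FF i + \sum_(j < n) DD i j * nearer i t j) %/ \sum_(j < n) nearer i t j.

Lemma ev_nearer st i t j : st aQ 0 = q -> i < n -> t < n -> j < n ->
  ev s st [:: i; t; j] nearerX = nearer i t j.
Proof.
move=> hq hi ht hj; apply: ev_and => //; first exact: ev_cli.
by rewrite ev_le (ev_dist (i := i) (j := j) hq) // (ev_dist (i := i) (j := t) hq).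
Qed.

Definition radius_ok (st : store) i := exists t, [/\ t < n, clib t, st aR i = radius i t
  & forall t', t' < n -> clib t' -> st aR i <= radius i t'].

Lemma radius_correct st c : st aQ 0 = q -> c < n -> clib c ->
  forall i, i < n -> radius_ok (run s [::] radius_prog st) i.
Proof.
move=> hq hc cc.
suff [] : run s [::] radius_prog st aQ 0 = q /\
  forall i, i < nth 0 s 0 -> radius_ok (run s [::] radius_prog st) i by rewrite s_n.
apply: (@for_ind s _ _ _ (fun m st => st aQ 0 = q /\ forall i, i < m -> radius_ok st i)) => //.
move=> i st' hi [hq' IH]; rewrite s_n in hi.
rewrite !run_then; set st1 := run s _ (tab 1 aOK _) st'.
have ok1 t : t < n -> st1 aOK t = clib t.
  by move=> ht; rewrite /st1 run_tab // s_n ht /= (ev_cli (i := t)).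
have fr1 t' l : t' != aOK -> st1 t' l = st' t' l.
  by move=> ht; rewrite /st1 run_tab // (negbTE ht).
set st2 := run s _ (tab 1 aVAL _) st1.
have q1 : st1 aQ 0 = q by rewrite fr1.
have val2 t : t < n -> st2 aVAL t = radius i t.
  move=> ht; rewrite /st2 run_tab // s_n ht /= ev_div ev_add (ev_open q1 (i := i)) //.
  rewrite !ev_sum s_n; congr (_ %/ _); last first.
    by apply: eq_bigr => j _; rewrite ev_nearer.
  congr (_ + _); apply: eq_bigr => j _.
  rewrite (@ev_mul_bool _ _ _ _ _ (nearer i t j)) ?ev_nearer //.
  by rewrite (ev_dist q1 (i := i) (j := j)).
have fr2 t' l : t' != aVAL -> st2 t' l = st1 t' l.
  by move=> ht; rewrite /st2 run_tab // (negbTE ht).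
rewrite !run_set.
have := @argmin_correct s st2 [:: i] 1 aOK aVAL clib n s0 s_n erefl.
set x := ev s st2 [:: i] (argminX 1 aOK aVAL).
case.
- by move=> t ht; rewrite fr2 // ok1.
- by move=> [_ /(_ c hc)]; rewrite cc.
move=> [xn cx xmin]; split; first by rewrite /upd /= fr2.
have Ex : ev s (upd st2 aX 0 x) [:: i] (Arr aVAL (Arr aX (Lit 0))) = radius i x.
  by rewrite !ev_arr ev_lit !updE /= val2.
move=> l; rewrite ltnS leq_eqVlt => /orP [/eqP ->|li].
  rewrite /radius_ok !updE eqxx /= [ev _ _ _ (Var 0)]/ev /= eqxx.
  exists x; split=> //.
  by rewrite Ex => t' ht' ct'; rewrite -!val2 //; apply: xmin.
have [t [h1 h2 h3 h4]] := IH l li; exists t.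
have E : upd (upd st2 aX (ev s st2 [:: i] (Lit 0)) x) aR
    (ev s (upd st2 aX (ev s st2 [:: i] (Lit 0)) x) [:: i] (Var 0))
    (ev s (upd st2 aX (ev s st2 [:: i] (Lit 0)) x) [:: i] (Arr aVAL (Arr aX (Lit 0))))
    aR l = st' aR l.
  by rewrite !updE /= [ev _ _ _ (Var 0)]/ev /= (ltn_eqF li) fr2 // fr1.
by split; rewrite ?E.
Qed.

Hypothesis DD_sym : forall i j, i < n -> j < n -> DD i j = DD j i.
Hypothesis DD_refl : forall i, i < n -> DD i i = 0.

Definition uncovered (r : nat -> nat) (o : nat -> bool) i :=
  forall z, z < n -> o z -> r i + r i < DD i z.

(* Facilities are opened by increasing radius: an uncovered facility never has a
   smaller radius than an open one. *)
Definition opening_ok (r : nat -> nat) (o : nat -> bool) :=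
  [/\ forall z, z < n -> o z -> facb z,
      forall i, i < n -> facb i ->
        (exists z, [/\ z < n, o z, r z <= r i & DD i z <= r i + r i]) \/
        (uncovered r o i /\ forall z, z < n -> o z -> r z <= r i)
    & forall z z', z < n -> z' < n -> o z -> o z' -> z != z' -> r z + r z < DD z z'].

Definition all_covered (r : nat -> nat) (o : nat -> bool) :=
  forall i, i < n -> facb i -> exists z, [/\ z < n, o z, r z <= r i & DD i z <= r i + r i].

Lemma ev_covered (st : store) k i (o : nat -> bool) : st aQ 0 = q -> i < n ->
  (forall z, z < n -> st aOPN z = o z) ->
  ev s st [:: k; i] coveredX = \sum_(z < n) (o z && (DD i z <= st aR i + st aR i)).
Proof.
move=> hq hi ho; rewrite ev_sum s_n; apply: eq_bigr => z _.
apply: ev_and => //; first by rewrite ev_arr ev_var /= ho.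
rewrite ev_le ev_add (ev_dist (i := i) (j := z) hq) //.
Qed.

(** The last clause measures progress: after [m] rounds at least [m] facilities are open, unless all
    are covered. *)
Definition open_inv (r : nat -> nat) m (st : store) :=
  [/\ st aQ 0 = q, forall i, st aR i = r i
    & exists o : nat -> bool, [/\ forall z, z < n -> st aOPN z = o z, opening_ok r o
        & m <= \sum_(z < n) o z \/ all_covered r o]].

Lemma open_step r k st : k < n -> open_inv r k st -> 
  open_inv r k.+1 (run s [:: k]
   (Then (tab 1 aOK (mulX (facX (Var 1)) (eqX coveredX (Lit 0))))
   (Then (Set_ aX (Lit 0) (argminX 1 aOK aR))
        (Set_ aOPN (Arr aX (Lit 0)) (Lit 1)))) st).
Proof.
move=> hk [hq hr [o [ho [o1 o2 o3] o4]]].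
rewrite !run_then !run_set; set st1 := run s _ (tab 1 aOK _) st.
pose ok i := facb i && (\sum_(z < n) (o z && (DD i z <= r i + r i)) == 0).
have ok1 i : i < n -> st1 aOK i = ok i.
  move=> hi; rewrite /st1 run_tab // s_n hi /=; apply: ev_and => //.
    exact: ev_fac.
  by rewrite ev_eq (ev_covered _ hq hi ho) hr.
have fr1 t' l : t' != aOK -> st1 t' l = st t' l.
  by move=> ht; rewrite /st1 run_tab // (negbTE ht).
have := @argmin_correct s st1 [:: k] 1 aOK aR ok n s0 s_n erefl ok1.
set x := ev s st1 [:: k] (argminX 1 aOK aR) => hx.
have uncov i : (\sum_(z < n) (o z && (DD i z <= r i + r i)) == 0) -> uncovered r o i.
  rewrite (@sum_bool_eq0 n (fun z => o z && (DD i z <= r i + r i))) => /forallP h z hz oz.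
  by have := h (Ordinal hz); rewrite /= oz /= -ltnNge.
have cov i : uncovered r o i -> (\sum_(z < n) (o z && (DD i z <= r i + r i)) == 0).
  rewrite (@sum_bool_eq0 n (fun z => o z && (DD i z <= r i + r i))) => h.
  by apply/forallP => z; apply/negP => /andP [oz]; rewrite leqNgt h.
split; [by rewrite !updE /= fr1|by move=> i; rewrite !updE /= fr1|].
have Ex : ev s (upd st1 aX (ev s st1 [:: k] (Lit 0)) x) [:: k] (Arr aX (Lit 0)) = x.
  by rewrite ev_arr updE.
rewrite Ex; case: hx => [[xn hnone]|[xn okx xmin]].
  (* No facility is uncovered: the mark goes to entry [n], and the set of open facilities is
     unchanged. *)
  exists o; split => //.
    by move=> z hz; rewrite !updE /= xn (ltn_eqF hz) fr1 // ho.
  right=> i hi fi; case: (o2 i hi fi) => // [[/cov hc _]].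
  by have := hnone i hi; rewrite /ok fi hc.
have /andP [fx /uncov ux] := okx.
have ox : o x = false.
  by apply/negP => ox; have := ux x xn ox; rewrite DD_refl.
have rx z : z < n -> o z -> r z <= r x.
  case: (o2 x xn fx) => [[w [hw ow _ hd]]|[_ h]]; last exact: h.
  by have := ux w hw ow; rewrite ltnNge hd.
exists (fun z => (z == x) || o z); split.
- move=> z hz; rewrite !updE /=; case: eqP => //= _; by rewrite fr1 // ho.
- split.
  + by move=> z hz /orP [/eqP -> //|]; apply: o1.
  + move=> i hi fi; case: (o2 i hi fi) => [[z [z1 z2 z3 z4]]|[ui mi]].
      by left; exists z; split => //; rewrite z2 orbT.
    have xi : r x <= r i by rewrite -!hr -!(fr1 aR) //; apply: xmin => //; rewrite /ok fi cov.
    case: (leqP (DD i x) (r i + r i)) => hd.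
      by left; exists x; split => //; rewrite eqxx.
    by right; split => z hz /orP [/eqP -> //|oz]; [apply: ui|apply: mi].
  + move=> z z' hz hz' /orP [/eqP ->|oz] /orP [/eqP ->|oz']; first by rewrite eqxx.
    * by move=> _; apply: ux.
    (* Facilities opened earlier have smaller radii, so separation as seen from [z] follows from [x]
       being uncovered. *)
    * move=> _; rewrite DD_sym //; have := ux z hz oz; have := rx z hz oz; lia.
    * exact: o3.
- case: o4 => [h|h]; last first.
    right=> i hi fi; have [z [z1 z2 z3 z4]] := h i hi fi.
    by exists z; split=> //; rewrite z2 orbT.
  left; rewrite (bigD1 (Ordinal xn)) //= eqxx /= add1n ltnS.
  apply: leq_trans h _; rewrite (bigD1 (Ordinal xn)) //= ox add0n.
  by apply: leq_sum => i _; case: (o i); rewrite ?orbT.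
Qed.

Lemma open_correct st : st aQ 0 = q -> (forall z, z < n -> st aOPN z = 0) ->
  exists o : nat -> bool, [/\ forall z, z < n -> run s [::] open_prog st aOPN z = o z,
    opening_ok (st aR) o & all_covered (st aR) o].
Proof.
move=> hq h0.
have : open_inv (st aR) n (run s [::] open_prog st).
  rewrite -[X in open_inv _ X]s_n; apply: for_ind.
    split => //; exists (fun=> false); split=> //; last by left.
    by split => // i hi fi; right; split.
  by move=> k st' hk; apply: open_step; rewrite -s_n.
case=> _ _ [o [ho hok hc]]; exists o; split => //.
case: hc => // hc i hi fi.
(* With at least [n] open points every point is open, and an open facility covers itself at distance
   0. *)
have oi : o i.
  apply/negPn/negP => noi; move: hc; rewrite leqNgt => /negP; apply.
  rewrite (bigD1 (Ordinal hi)) //= (negbTE noi) add0n.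
  apply: (@leq_ltn_trans (\sum_(j < n | j != Ordinal hi) 1)).
    by apply: leq_sum => j _; case: (o j).
  rewrite sum1_card; have := cardC1 (Ordinal hi); rewrite card_ord /=.
  by move=> ->; lia.
by exists i; rewrite DD_refl.
Qed.

Definition near_ok (o : nat -> bool) (st : store) j :=
  [/\ st aNEAR j < n, o (st aNEAR j)
    & forall z, z < n -> o z -> DD (st aNEAR j) j <= DD z j].

Lemma near_correct st (o : nat -> bool) z0 : st aQ 0 = q ->
  (forall z, z < n -> st aOPN z = o z) -> z0 < n -> o z0 ->
  forall j, j < n -> near_ok o (run s [::] near_prog st) j.
Proof.
move=> hq ho hz0 oz0.
suff [] : [/\ run s [::] near_prog st aQ 0 = q,
    forall z, z < n -> run s [::] near_prog st aOPN z = o z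
  & forall i, i < nth 0 s 0 -> near_ok o (run s [::] near_prog st) i] by rewrite s_n.
apply: (@for_ind s _ _ _ (fun m st => [/\ st aQ 0 = q,
  forall z, z < n -> st aOPN z = o z & forall i, i < m -> near_ok o st i])) => //.
move=> j st' hj [hq' ho' IH]; rewrite s_n in hj.
rewrite !run_then run_set; set st1 := run s _ (tab 1 aVAL _) st'.
have fr1 t' l : t' != aVAL -> st1 t' l = st' t' l.
  by move=> ht; rewrite /st1 run_tab // (negbTE ht).
have val1 z : z < n -> st1 aVAL z = DD z j.
  by move=> hz; rewrite /st1 run_tab // s_n hz /= (ev_dist (i := z) (j := j) hq').
have := @argmin_correct s st1 [:: j] 1 aOPN aVAL o n s0 s_n erefl.
set x := ev s st1 [:: j] (argminX 1 aOPN aVAL).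
case.
- by move=> z hz; rewrite fr1 // ho'.
- by move=> [_ /(_ z0 hz0)]; rewrite oz0.
move=> [xn ox xmin]; split.
- by rewrite updE /= fr1.
- by move=> z hz; rewrite updE /= fr1 // ho'.
move=> l; rewrite ltnS leq_eqVlt /near_ok !updE ev_var /= => /orP [/eqP ->|lj].
  by rewrite eqxx; split => // z hz oz; rewrite -!val1 //; apply: xmin.
by rewrite (ltn_eqF lj) fr1 //; apply: IH.
Qed.


Lemma label_correct st k : k < n ->
  (forall v, v < n -> run s [:: k] label_prog st aLAB (n * k + v) = st aCOMP v) /\
  (forall l, l < n * k -> run s [:: k] label_prog st aLAB l = st aLAB l).
Proof.
move=> hk.
suff [_ h1 h2] : [/\ forall v, run s [:: k] label_prog st aCOMP v = st aCOMP v,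
   forall v, v < nth 0 s 0 -> run s [:: k] label_prog st aLAB (n * k + v) = st aCOMP v
   & forall l, l < n * k -> run s [:: k] label_prog st aLAB l = st aLAB l].
  by rewrite s_n in h1.
apply: (@for_ind s _ _ _ (fun m st' => [/\ forall v, st' aCOMP v = st aCOMP v,
   forall v, v < m -> st' aLAB (n * k + v) = st aCOMP v
   & forall l, l < n * k -> st' aLAB l = st aLAB l])) => //.
move=> v st' hv [h1 h2 h3]; rewrite run_set.
have -> : ev s st' [:: k; v] (pairX (Var 0) (Var 1)) = n * k + v by apply: ev_pair.
split=> [w|w hw|l hl]; rewrite updE /= ?h1 //.
  rewrite eqn_add2l; case: eqP => [->|wv]; first by rewrite ev_arr ev_var /= h1.
  by apply: h2; lia.
by rewrite ltn_eqF ?h3 // ltn_addr.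
Qed.

Definition active (st : store) v :=
  clib v && odd (\sum_(w < n) (clib w && (st aCOMP w == st aCOMP v))).

Lemma act_correct st k v : v < n -> run s [:: k] act_prog st aACT v = active st v.
Proof.
move=> hv; rewrite run_tab // s_n hv /=; apply: ev_and => //; first exact: ev_cli.
rewrite ev_odd ev_sum s_n; congr (nat_of_bool (odd _)).
apply: eq_bigr => w _; apply: ev_and => //; first exact: ev_cli.
by rewrite ev_eq.
Qed.

Definition candidate (st : store) u v := clib v && (st aCOMP v != st aCOMP u).
Definition slack (st : store) u v :=
  (DD u v - (st aD u + st aD v)) %/ (1 + active st v).

Definition best_ok (st0 st : store) u :=
  st aBOK u = (active st0 u && (st aBV u < n)) /\
  ((st aBV u = n /\ forall v, v < n -> ~~ candidate st0 u v) \/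
   [/\ st aBV u < n, candidate st0 u (st aBV u), st aBVAL u = slack st0 u (st aBV u)
     & forall v, v < n -> candidate st0 u v -> st aBVAL u <= slack st0 u v]).

Lemma candidate_correct st k : st aQ 0 = q ->
  (forall v, v < n -> st aACT v = active st v) ->
  forall u, u < n -> best_ok st (run s [:: k] candidate_prog st) u.
Proof.
move=> hq hact.
suff [] : (forall t l, t \notin writes candidate_prog ->
      run s [:: k] candidate_prog st t l = st t l) /\
  forall u, u < nth 0 s 0 -> best_ok st (run s [:: k] candidate_prog st) u by rewrite s_n.
apply: (@for_ind s _ _ _ (fun m st' => (forall t l, t \notin writes candidate_prog ->
      st' t l = st t l) /\ forall u, u < m -> best_ok st st' u)) => //.
move=> u st' hu [fr IH]; rewrite s_n in hu.
split; first by move=> t l ht; rewrite run_frame // fr.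
rewrite !run_then; set st1 := run s _ (tab 2 aOK _) st'.
have fr1 t' l : t' != aOK -> st1 t' l = st' t' l.
  by move=> ht; rewrite /st1 run_tab // (negbTE ht).
have ok1 v : v < n -> st1 aOK v = candidate st u v.
  move=> hv; rewrite /st1 run_tab // s_n hv /=; apply: ev_and => //; first exact: ev_cli.
  by rewrite ev_not ev_eq eqb0 !ev_arr !ev_var /= !fr.
set st2 := run s _ (tab 2 aVAL _) st1.
have fr2 t' l : t' != aVAL -> st2 t' l = st1 t' l.
  by move=> ht; rewrite /st2 run_tab // (negbTE ht).
have val2 v : v < n -> st2 aVAL v = slack st u v.
  move=> hv; rewrite /st2 run_tab // s_n hv /= ev_div ev_sub !ev_add ev_lit !ev_arr !ev_var /=.
  rewrite (ev_dist (q := q) (i := u) (j := v)) //; last by rewrite fr1 // fr.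
  by rewrite !fr1 // !fr // hact.
rewrite !run_set.
have := @argmin_correct s st2 [:: k; u] 2 aOK aVAL (candidate st u) n s0 s_n erefl.
set x := ev s st2 [:: k; u] (argminX 2 aOK aVAL) => hx.
have {}hx := hx (fun v hv => etrans (fr2 aOK v isT) (ok1 v hv)).
set st3 := upd st2 aX _ x.
set st4 := upd st3 aBV _ _.
set st5 := upd st4 aBVAL _ _.
have e4 : st4 = upd st3 aBV u x by rewrite /st4 ev_var ev_arr ev_lit /st3 updE.
have e5 : st5 = upd st4 aBVAL u (st2 aVAL x).
  by rewrite /st5 ev_var !ev_arr ev_lit e4 /st3 !updE.
have e6 : ev s st5 [:: k; u] (mulX (Arr aACT (Var 1)) (ltX (Arr aX (Lit 0)) nX)) =
    (active st u && (x < n)).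
  apply: ev_and => //.
    by rewrite ev_arr ev_var /= e5 e4 /st3 !updE /= fr2 // fr1 // fr // hact.
  by rewrite ev_lt ev_n // s_n ev_arr ev_lit e5 e4 /st3 !updE.
rewrite e6 [ev _ _ _ (Var 1)]ev_var /= e5 e4 /st3.
move=> l; rewrite ltnS leq_eqVlt /best_ok !updE /= => /orP [/eqP ->|lu].
  rewrite eqxx; split => //; case: hx => [[-> h]|[xn xc xmin]]; [by left|right].
  split => //; first exact: val2.
  by move=> v hv cv; rewrite -val2 //; apply: xmin.
by rewrite (ltn_eqF lu) !fr2 // !fr1 //; apply: IH.
Qed.

Definition merged (st st' : store) x y eps :=
  (forall v, v < n -> st' aD v = st aD v + eps * active st v) /\
  (forall v, v < n -> st' aCOMP v =
     if st aCOMP v == st aCOMP y then st aCOMP x else st aCOMP v).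

Lemma merge_correct (st st0 : store) k : 
  (forall v, v < n -> st aACT v = active st0 v) ->
  (forall v, st aCOMP v = st0 aCOMP v) -> (forall v, st aD v = st0 aD v) ->
  merged st0 (run s [:: k] merge_prog st) (st aEA k) (st aEB k) (st aBVAL (st aX 0)).
Proof.
move=> hact hc hd; rewrite /merge_prog !run_then.
set st1 := run s _ (tab 1 aTMP _) st.
have fr1 t' l : t' != aTMP -> st1 t' l = st t' l.
  by move=> ht; rewrite /st1 run_tab // (negbTE ht).
have v1 v : v < n -> st1 aTMP v = st0 aD v + st aBVAL (st aX 0) * active st0 v.
  move=> hv; rewrite /st1 run_tab // s_n hv /= ev_add.
  rewrite (@ev_mul_bool _ _ _ _ _ (active st0 v)) //; last by rewrite ev_arr hact.
  by rewrite ev_arr hd.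
set st2 := run s _ (tab 1 aD _) st1.
have fr2 t' l : t' != aD -> st2 t' l = st1 t' l.
  by move=> ht; rewrite /st2 run_tab // (negbTE ht).
have v2 v : v < n -> st2 aD v = st0 aD v + st aBVAL (st aX 0) * active st0 v.
  by move=> hv; rewrite /st2 run_tab // s_n hv /= ev_arr v1.
set st3 := run s _ (tab 1 aTMP _) st2.
have fr3 t' l : t' != aTMP -> st3 t' l = st2 t' l.
  by move=> ht; rewrite /st3 run_tab // (negbTE ht).
have v3 v : v < n -> st3 aTMP v = if st0 aCOMP v == st0 aCOMP (st aEB k)
    then st0 aCOMP (st aEA k) else st0 aCOMP v.
  move=> hv; rewrite /st3 run_tab // s_n hv /= ev_add.
  have E : ev s st2 [:: k; v] sameX = (st0 aCOMP v == st0 aCOMP (st aEB k)).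
    by rewrite ev_eq !ev_arr !ev_var /= !fr2 // !fr1 // !hc.
  rewrite (ev_mul_bool _ s0 E).
  rewrite (@ev_mul_bool _ _ _ _ _ (st0 aCOMP v != st0 aCOMP (st aEB k))) //; last first.
    by rewrite ev_not E eqb0.
  rewrite !ev_arr !ev_var /= !fr2 // !fr1 // !hc.
  by case: eqP => _ /=; rewrite ?muln1 ?muln0 ?addn0.
split=> v hv; first by rewrite run_frame // fr3 // v2.
by rewrite run_tab // s_n hv /= ev_arr ev_var /= v3.
Qed.

(** The two alternatives mirror the hypothesis [edge_none] and the hypotheses [edge_some],
    [comp_some] and [d_some] of the abstract analysis. *)
Definition moat_step (st st' : store) k :=
  (st' aVALID k = 0 /\
   [/\ forall v, v < n -> st' aCOMP v = st aCOMP v,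
      forall v, v < n -> st' aD v = st aD v
    & forall a b, a < n -> b < n -> active st a -> clib b -> st aCOMP a = st aCOMP b])
  \/ (st' aVALID k = 1 /\ exists x y eps, [/\
     [/\ x < n, y < n, st' aEA k = x, st' aEB k = y & eps = st' aBVAL x],
     [/\ active st x, clib y & st aCOMP x != st aCOMP y],
     DD x y - (st aD x + st aD y) < eps.+1 * (1 + active st y),
     forall a b, a < n -> b < n -> active st a -> clib b -> st aCOMP a != st aCOMP b ->
        eps * (1 + active st b) <= DD a b - (st aD a + st aD b)
     & merged st st' x y eps]).

Lemma moat_body_correct st k : st aQ 0 = q ->
  let st' := run s [:: k] moat_body st in
  [/\ moat_step st st' k,
     forall t l, (t == aVALID) || (t == aEA) || (t == aEB) -> l != k -> st' t l = st t l
   & k < n -> (forall v, v < n -> st' aLAB (n * k + v) = st aCOMP v) /\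
              (forall l, l < n * k -> st' aLAB l = st aLAB l)].
Proof.
move=> hq st'; rewrite /st' /moat_body !run_then {st'}.
set st1 := run s _ label_prog st.
have c1 v : st1 aCOMP v = st aCOMP v by rewrite /st1 run_frame.
set st2 := run s _ act_prog st1.
have c2 v : st2 aCOMP v = st aCOMP v by rewrite /st2 run_frame.
have d2 v : st2 aD v = st aD v by rewrite /st2 /st1 !run_frame.
have a2 v : v < n -> st2 aACT v = active st v.
  move=> hv; rewrite /st2 act_correct // /active c1.
  by under eq_bigr do rewrite c1.
set st3 := run s _ candidate_prog st2.
have fr3 t l : t \notin writes label_prog ++ writes act_prog ++ writes candidate_prog ->
    st3 t l = st t l.
  rewrite mem_cat negb_or => /andP [h1]; rewrite mem_cat negb_or => /andP [h2 h3].
  by rewrite /st3 /st2 /st1 !run_frame.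
have act2 v : active st2 v = active st v.
  by rewrite /active c2; under eq_bigr do rewrite c2.
have cand2 u v : candidate st2 u v = candidate st u v.
  by rewrite /candidate !c2.
have slack2 u v : slack st2 u v = slack st u v.
  by rewrite /slack act2 !d2.
have best u : u < n -> best_ok st st3 u.
  move=> hu; have := @candidate_correct st2 k _ _ u hu.
  rewrite /best_ok act2 slack2 => -[].
  - by rewrite /st2 /st1 !run_frame.
  - by move=> v hv; rewrite a2 // act2.
  move=> h1 h2; split => //; case: h2 => [[h3 h4]|[h3 h4 h5 h6]]; [left|right]; split => //.
  - by move=> v hv; rewrite -cand2 h4.
  - by rewrite -cand2.
  - by move=> v hv cv; rewrite -slack2; apply: h6; rewrite ?cand2.
rewrite !run_set.
pose bok u := active st u && (st3 aBV u < n).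
have := @argmin_correct s st3 [:: k] 1 aBOK aBVAL bok n s0 s_n erefl (fun u hu => (best u hu).1).
set x := ev s st3 [:: k] (argminX 1 aBOK aBVAL) => hx.
set st4 := upd st3 aX _ x.
set st5 := upd st4 aVALID _ _.
set st6 := upd st5 aEA _ _.
set st7 := upd st6 aEB _ _.
have e4 : st4 aX 0 = x by rewrite /st4 updE ev_lit.
have e5 : st5 = upd st4 aVALID k (x < n).
  by rewrite /st5 ev_var ev_lt ev_n // s_n ev_arr ev_lit e4.
have e6 : st6 = upd st5 aEA k x.
  by rewrite /st6 ev_var ev_arr ev_lit /st5 updE e4.
have e7 : st7 = upd st6 aEB k (st3 aBV x).
  by rewrite /st7 ev_var !ev_arr ev_lit /st6 /st5 !updE /= e4 /st4 updE.
have v7 : st7 aVALID k = (x < n) by rewrite e7 e6 e5 !updE /= eqxx.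
have x7 : st7 aEA k = x by rewrite e7 e6 !updE /= eqxx.
have y7 : st7 aEB k = st3 aBV x by rewrite e7 !updE /= eqxx.
have fr7 t l : (t \notin [:: aX; aVALID; aEA; aEB]) -> st7 t l = st3 t l.
  rewrite !inE !negb_or => /and4P [/negbTE h1 /negbTE h2 /negbTE h3 /negbTE h4].
  by rewrite e7 e6 e5 /st4 !updE h1 h2 h3 h4.
rewrite run_when ev_arr ev_var /= v7 eqb0 negbK.
have other t l : (t == aVALID) || (t == aEA) || (t == aEB) -> l != k -> st7 t l = st t l.
  move=> ht hl; rewrite -(fr3 t); last by move: ht => /orP [/orP [] /eqP ->|/eqP ->].
  by rewrite e7 e6 e5 /st4 !updE (negbTE hl) !andbF; move: ht => /orP [/orP [] /eqP ->|/eqP ->].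
have frL t l : t == aLAB -> st7 t l = st1 t l.
  by move=> /eqP ->; rewrite fr7 // /st3 /st2 !run_frame.
case: hx => [[xn hnone]|[xn okx xmin]].
  rewrite xn ltnn in v7 *; split => //.
  - left; split=> //; split=> [v hv|v hv|a b ha hb aa cb].
    + by rewrite fr7 // fr3.
    + by rewrite fr7 // fr3.
    + apply/eqP/negPn/negP => ne; have := hnone a ha; rewrite /bok aa /=.
      case: (best a ha) => _ [[_ h]|[-> _ _ _] //] _.
      by have := h b hb; rewrite /candidate cb eq_sym ne.
  - move=> hk; have [h1 h2] := label_correct st hk.
    by split=> [v hv|l hl]; rewrite frL // /st1 ?h1 ?h2.
rewrite xn in v7 *.
have [actx bx] := andP okx.
have [_ bestx] := best x xn.
case: bestx => [[h _]|[_ cx vx minx]]; first by rewrite h ltnn in bx.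
have := @merge_correct st7 st k.
rewrite x7 y7 => hm.
have {}hm := hm (fun v hv => etrans (etrans (fr7 aACT v isT)
   (run_frame _ _ _ _ (isT : aACT \notin writes candidate_prog))) (a2 v hv))
   (fun v => etrans (fr7 aCOMP v isT) (fr3 aCOMP v isT))
   (fun v => etrans (fr7 aD v isT) (fr3 aD v isT)).
have ex7 : st7 aX 0 = x by rewrite e7 e6 e5 !updE /= e4.
rewrite ex7 (fr7 aBVAL) // in hm.
split.
- right; split; first by rewrite run_frame.
  have /andP [cy ney] := cx.
  exists x, (st3 aBV x), (st3 aBVAL x); split => //.
  + by rewrite !run_frame // fr7.
  + by rewrite eq_sym.
  + by rewrite vx /slack; apply: ltn_ceil.
  + move=> a b ha hb aa cb ne.
    have cab : candidate st a b by rewrite /candidate cb eq_sym.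
    have [_ besta] := best a ha.
    case: besta => [[_ /(_ b hb)]|[h1 _ _ /(_ b hb cab) h2]]; first by rewrite cab.
    have := xmin a ha; rewrite /bok aa h1 => /(_ isT) h3.
    by rewrite -leq_divRL //; apply: leq_trans h3 h2.
- by move=> t l ht hl; rewrite run_frame ?other //; move: ht => /orP [/orP [] /eqP ->|/eqP ->].
- move=> hk; have [h1 h2] := label_correct st hk.
  by split=> [v hv|l hl]; rewrite run_frame // frL // /st1 ?h1 ?h2.
Qed.

(** * The matching read off the memory *)

Section Pairing.
Hypothesis DD_triangle : forall i j k, i < n -> j < n -> k < n -> DD i k <= DD i j + DD j k.
Hypothesis DD_gt1 : forall i j, i < n -> j < n -> i != j -> 1 < DD i j.

Let V : finType := 'I_n.
Let dist_ord (x y : V) := DD x y.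
Let cli_ord : pred V := fun x => clib x.

Definition mate_rep (st : store) (m : V -> option V) :=
  forall v : V, st aMATE v = oapp (fun w : V => w.+1) 0 (m v).

Lemma endpoint_correct st env m a (u : V) : mate_rep st m -> ev s st env a = u ->
  ev s st env (endpointX a) = odflt u (m u).
Proof.
move=> hm ha.
have hM : ev s st env (Arr aMATE a) = oapp (fun w : V => w.+1) 0 (m u).
  by rewrite ev_arr ha hm.
rewrite /endpointX ev_add ev_sub (@ev_mul_bool _ _ _ _ _ (m u == None)) //.
  by rewrite hM ev_lit ha; case: (m u) => [w|] /=; rewrite ?muln0 ?muln1 ?subn1 ?addn0.
by rewrite ev_eq hM; case: (m u).
Qed.

Lemma mate_rep_put st m (w : V) (o : option V) : mate_rep st m ->
  mate_rep (upd st aMATE w (oapp (fun w : V => w.+1) 0 o)) (put m w o).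
Proof. by move=> hm v; rewrite updE /= /put val_eqE; case: eqP. Qed.

Lemma mate_rep_ext st st' m : (forall v, st' aMATE v = st aMATE v) -> mate_rep st m ->
  mate_rep st' m.
Proof. by move=> h hm v; rewrite h. Qed.

Lemma splice_correct st env m (u v : V) : mate_rep st m -> st aX 1 = u -> st aX 2 = v ->
  mate_rep (run s env splice_prog st) (splice m u v).
Proof.
move=> hm hu hv; rewrite /splice_prog.
rewrite run_then run_set ev_lit (endpoint_correct hm (u := u)) //.
set st1 := upd st _ _ _.
have hm1 : mate_rep st1 m by apply: mate_rep_ext hm => w; rewrite /st1 updE.
rewrite run_then run_set ev_lit (endpoint_correct (u := v) hm1); last first.
  by rewrite ev_arr ev_lit /st1 updE.
set st2 := upd st1 _ _ _.
have hm2 : mate_rep st2 m by apply: mate_rep_ext hm1 => w; rewrite /st2 updE.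
rewrite run_then run_set ev_lit [ev _ _ _ uX]ev_arr ev_lit.
have -> : st2 aX 1 = u by rewrite /st2 /st1 !updE.
set st3 := upd st2 aMATE u 0.
have hm3 : mate_rep st3 (put m u None) by apply: (@mate_rep_put _ _ u None hm2).
rewrite run_then run_set ev_lit [ev _ _ _ vX]ev_arr ev_lit.
have -> : st3 aX 2 = v by rewrite /st3 /st2 /st1 !updE.
set st4 := upd st3 aMATE v 0.
have hm4 : mate_rep st4 (put (put m u None) v None) by apply: (@mate_rep_put _ _ v None hm3).
have x4 i : st4 aX i = st2 aX i by rewrite /st4 /st3 !updE.
have x2 : st2 aX 2 = v by rewrite /st2 /st1 !updE.
have x3 : st2 aX 3 = odflt u (m u) by rewrite /st2 /st1 !updE.
have x5 : st2 aX 4 = odflt v (m v) by rewrite /st2 /st1 !updE.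
rewrite run_when ev_not ev_eq !ev_arr !ev_lit !x4 x3 x2 /splice val_eqE.
case: (odflt u (m u) == v) => //=.
set a := odflt u (m u) in x3 *; set b := odflt v (m v) in x5 *.
rewrite run_then; set st5 := run s env _ st4.
have e5 : st5 = upd st4 aMATE a b.+1.
  by rewrite /st5 run_set ev_add !ev_arr !ev_lit !x4 x3 x5 addn1.
have hm5 : mate_rep st5 (put (put (put m u None) v None) a (Some b)).
  by rewrite e5; apply: (@mate_rep_put _ _ a (Some b) hm4).
rewrite run_set ev_add !ev_arr !ev_lit.
have -> : st5 aX 4 = b by rewrite e5 updE /= x4.
have -> : st5 aX 3 = a by rewrite e5 updE /= x4.
rewrite addn1; exact: (@mate_rep_put _ _ b (Some a) hm5).
Qed.

Definition start st := run s [::] (tab 0 aCOMP (Var 0)) st.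
(** The abstract sequences are read off these stores: labels and moats of step [k] in [stage st k],
    its edge and growth in [stage st k.+1]. *)
Definition stage st k := iter_for k (fun i => run s [:: i] moat_body) (start st).

Definition edge_of (st : store) k : option (V * V) :=
  if st aVALID k == 0 then None else
  if insub (st aEA k) is Some x then
    if insub (st aEB k) is Some y then Some (x, y) else None
  else None.

Lemma stage0 st : stage st 0 = run s [::] (tab 0 aCOMP (Var 0)) st.
Proof. by []. Qed.

Lemma stageS st k : stage st k.+1 = run s [:: k] moat_body (stage st k).
Proof. by rewrite /stage iter_forS. Qed.

Lemma stage_q st k : st aQ 0 = q -> stage st k aQ 0 = q.
Proof.
move=> hq; elim: k => [|k IH]; first by rewrite stage0 run_tab.
by rewrite stageS run_frame.
Qed.

(** Step [m] writes only entry [m] of these arrays, so the backward pass finds every recorded edge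
    in the last store. *)
Lemma stage_keep st t k m : st aQ 0 = q -> (t == aVALID) || (t == aEA) || (t == aEB) ->
  k < m -> stage st m t k = stage st k.+1 t k.
Proof.
move=> hq ht; elim: m => // m IH; rewrite ltnS leq_eqVlt => /orP [/eqP -> //|km].
have [_ h _] := moat_body_correct m (stage_q m hq).
by rewrite -IH // stageS h // ltn_eqF.
Qed.

Lemma stage_label st k m v : st aQ 0 = q -> k < m -> m <= n -> v < n ->
  stage st m aLAB (n * k + v) = stage st k aCOMP v.
Proof.
move=> hq; elim: m => // m IH; rewrite ltnS leq_eqVlt => km mn hv.
have [_ _ /(_ mn) [h1 h2]] := moat_body_correct m (stage_q m hq).
rewrite stageS; case/orP: km => [/eqP ->|km]; first exact: h1.
rewrite h2 ?IH // ?(ltnW mn) //.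
by apply: (@leq_trans (n * k + n)); [rewrite ltn_add2l|rewrite -mulnSr leq_mul2l km orbT].
Qed.

Let comp st k (v : V) := stage st k aCOMP v.
Let dd st k (v : V) := stage st k aD v.
Let edge st k := edge_of (stage st k.+1) k.
Let eps st k := stage st k.+1 aBVAL (stage st k.+1 aEA k).

Lemma active_act st k (v : V) : active (stage st k) v = act cli_ord (comp st) k v.
Proof.
rewrite /active /act /size_class; congr (_ && odd _).
by rewrite [RHS]big_mkcond; apply: eq_bigr => w _; rewrite /cli_ord; case: (clib w).
Qed.

Lemma edge_cases st k : st aQ 0 = q ->
  ((edge st k = None /\ stage st k.+1 aVALID k = 0) /\
    [/\ forall v, comp st k.+1 v = comp st k v, forall v, dd st k.+1 v = dd st k v
      & forall a b, act cli_ord (comp st) k a -> cli_ord b -> comp st k a = comp st k b])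
  \/ (exists x y : V, (edge st k = Some (x, y) /\
   [/\ stage st k.+1 aVALID k = 1, stage st k.+1 aEA k = x & stage st k.+1 aEB k = y]) /\
   [/\ [/\ act cli_ord (comp st) k x, cli_ord y, comp st k x != comp st k y,
      dist_ord x y - (dd st k x + dd st k y) < (eps st k).+1 * (1 + act cli_ord (comp st) k y)
    & forall a b, act cli_ord (comp st) k a -> cli_ord b -> comp st k a != comp st k b ->
        eps st k * (1 + act cli_ord (comp st) k b) <= dist_ord a b - (dd st k a + dd st k b)],
     forall v, comp st k.+1 v = (if comp st k v == comp st k y then comp st k x else comp st k v)
    & forall v, dd st k.+1 v = dd st k v + eps st k * act cli_ord (comp st) k v]).
Proof.
move=> hq; have [h _ _] := moat_body_correct k (stage_q k hq).
rewrite -stageS in h; case: h => [[hv [h1 h2 h3]]|[hv [x [y [e [[xn yn hx hy he]]]]]]].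
  left; rewrite /edge /edge_of hv; split => //; split=> [v|v|a b aa cb].
  - exact: h1.
  - exact: h2.
  - by apply: h3 => //; rewrite active_act.
move=> [ax cy ne] ht hf [hd hc]; right.
exists (Ordinal xn), (Ordinal yn).
have -> : eps st k = e by rewrite /eps hx.
rewrite /edge /edge_of hv /= hx hy !insubT /=; split => //.
split; [split|..] => //.
- by rewrite -active_act.
- by rewrite -active_act.
- by move=> a b aa cb ne'; rewrite -active_act; apply: hf; rewrite ?active_act.
- by move=> v; rewrite /comp hc.
- by move=> v; rewrite -active_act /dd hd.
Qed.

Lemma back_correct st : st aQ 0 = q -> (forall v, v < n -> st aMATE v = 0) ->
  mate_rep (run s [::] back_prog (stage st n)) (back cli_ord (comp st) (edge st) n n).
Proof.
move=> hq h0.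
pose Inv i (st' : store) := (forall t l, t \notin [:: aX; aMATE] -> st' t l = stage st n t l) /\
  mate_rep st' (back cli_ord (comp st) (edge st) n i).
suff [] : Inv n (run s [::] back_prog (stage st n)) by [].
rewrite -[X in Inv X]s_n; apply: for_ind.
  have hM k l : stage st k aMATE l = st aMATE l.
    by elim: k => [|k IH]; [rewrite stage0 run_tab|rewrite stageS run_frame].
  by split=> // v /=; rewrite hM h0.
move=> i st' hi [fr IH]; rewrite s_n in hi.
set k := n - i.+1; have kn : k < n by rewrite /k; lia.
rewrite /rcons !run_then !run_set !ev_lit.
have -> : ev s st' [:: i] (subX nX (addX (Var 0) (Lit 1))) = k.
  by rewrite ev_sub ev_add ev_n // s_n ev_var ev_lit addn1.
set st1 := upd st' aX 0 k.
have -> : ev s st1 [:: i] (Arr aEA kX) = stage st n aEA k.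
  by rewrite !ev_arr ev_lit /st1 !updE /= fr.
set st2 := upd st1 aX 1 _.
have -> : ev s st2 [:: i] (Arr aEB kX) = stage st n aEB k.
  by rewrite !ev_arr ev_lit /st2 /st1 !updE /= fr.
set st3 := upd st2 aX 2 _.
have fr3 t l : t \notin [:: aX; aMATE] -> st3 t l = stage st n t l.
  move=> ht; rewrite -fr // /st3 /st2 /st1 !updE.
  by move: ht; rewrite inE negb_or => /andP [/negbTE ->].
have m3 : mate_rep st3 (back cli_ord (comp st) (edge st) n i).
  by apply: mate_rep_ext IH => v; rewrite /st3 /st2 /st1 !updE.
have k3 : st3 aX 0 = k by rewrite /st3 /st2 /st1 !updE.
have u3 : st3 aX 1 = stage st n aEA k by rewrite /st3 /st2 /st1 !updE.
have v3 : st3 aX 2 = stage st n aEB k by rewrite /st3 /st2 /st1 !updE.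
have wr t : t \notin [:: aX; aMATE] -> t \notin writes splice_prog.
  by rewrite /= !inE !negb_or => /andP [-> ->].
split; first by move=> t l ht; rewrite run_frame ?fr3 //; exact: wr.
rewrite [back _ _ _ _ _]/= -/k /back_step.
have keep t : (t == aVALID) || (t == aEA) || (t == aEB) -> stage st n t k = stage st k.+1 t k.
  by move=> ht; apply: stage_keep.
rewrite run_when !ev_arr ev_lit k3 fr3 // keep //.
case: (edge_cases k hq) => [[[-> ->] _]|[x [y [[-> [-> ex ey]] [[ax cy _ _ _] _ _]]]]] //=.
have u4 : st3 aX 1 = x by rewrite u3 keep.
have v4 : st3 aX 2 = y by rewrite v3 keep.
have lab (w : V) : stage st n aLAB (n * k + w) = comp st k w by apply: stage_label.
rewrite run_when ev_odd ev_sum s_n eqb0 negbK.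
have -> : \sum_(w < n) ev s st3 (rcons [:: i] w)
     (mulX (cliX (Var 1)) (mulX (eqX (Arr aLAB (pairX kX (Var 1))) (Arr aLAB (pairX kX vX)))
                   (eqX (Arr aMATE (Var 1)) (Lit 0)))) =
   unmatched cli_ord (comp st) (back cli_ord (comp st) (edge st) n i) k y.
  rewrite /unmatched [RHS]big_mkcond; apply: eq_bigr => w _.
  have -> : (if cli_ord w then
      ((comp st k w == comp st k y) && (back cli_ord (comp st) (edge st) n i w == None) : nat)
      else 0) = (clib w && ((comp st k w == comp st k y) &&
         (back cli_ord (comp st) (edge st) n i w == None))).
    by rewrite /cli_ord; case: (clib w).
  apply: ev_and => //; first exact: ev_cli.
  apply: ev_and => //; rewrite ev_eq !ev_arr ?ev_var ?ev_lit.
    rewrite (@ev_pair _ _ _ _ k w) // (@ev_pair _ _ _ _ k y) //.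
    by rewrite !fr3 // !lab.
  by rewrite /= m3; case: (back _ _ _ _ _ _).
case: ifP => _; last exact: m3.
exact: splice_correct.
Qed.

Theorem pairing_correct st (p : V -> V) : st aQ 0 = q ->
  (forall v, v < n -> st aMATE v = 0) -> (forall v, v < n -> st aD v = 0) ->
  ~~ odd #|cli_ord| ->
  (forall v, cli_ord v -> [/\ cli_ord (p v), p (p v) = v & p v != v]) ->
  exists m : V -> option V, [/\ mate_rep (run s [::] (Then moat_prog back_prog) st) m,
    mates m, forall v, (m v != None) = cli_ord v
    & mate_cost dist_ord m <= 4 * \sum_(a | cli_ord a) dist_ord a (p a)].
Proof.
move=> hq h0 d0 ev pP; exists (back cli_ord (comp st) (edge st) n n).
have Eedge k x y : edge st k = Some (x, y) ->
   [/\ [/\ act cli_ord (comp st) k x, cli_ord y, comp st k x != comp st k y,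
      dist_ord x y - (dd st k x + dd st k y) < (eps st k).+1 * (1 + act cli_ord (comp st) k y)
    & forall a b, act cli_ord (comp st) k a -> cli_ord b -> comp st k a != comp st k b ->
        eps st k * (1 + act cli_ord (comp st) k b) <= dist_ord a b - (dd st k a + dd st k b)],
     forall v, comp st k.+1 v = (if comp st k v == comp st k y then comp st k x else comp st k v)
    & forall v, dd st k.+1 v = dd st k v + eps st k * act cli_ord (comp st) k v].
  by move=> E; case: (edge_cases k hq) => [[[]]|[x' [y' [[]]]]]; rewrite E // => -[-> ->].
have [] := @moat_matching V dist_ord cli_ord (comp st) (dd st) (eps st) (edge st)
  _ _ _ _ _ _ _ _ _ ev n _ p pP.
- by move=> x y; apply: DD_sym.
- by move=> x y z; apply: DD_triangle.
- by move=> x y xy; apply: DD_gt1.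
- by move=> x y; rewrite /comp stage0 !run_tab // s_n !ltn_ord /= => /val_inj.
- by move=> v; rewrite /dd stage0 run_tab //= d0.
- by move=> k x y /Eedge [].
- by move=> k x y /Eedge [].
- by move=> k x y /Eedge [].
- by move=> k E; case: (edge_cases k hq) => [[_ //]|[x' [y' [[]]]]]; rewrite E.
- by apply: leq_trans (max_card _) _; rewrite card_ord.
move=> h1 h2 h3; split => //; rewrite run_then.
have -> : run s [::] moat_prog st = stage st n by rewrite -s_n.
exact: back_correct.
Qed.

Let fac_ord : pred V := fun x => facb x.
Let open_cost (x : V) := FF x.
Hypothesis open_cost_large : forall x, fac_ord x -> open_cost x = 0 \/ 2 * n <= open_cost x.
Hypothesis q_def : scale_factor = q.

(** * Comparison with an arbitrary feasible solution *)

Section Feasible.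
Variables (X : pred V) (sigma : V -> V).
Hypothesis X_fac : forall x, X x -> fac_ord x.
Hypothesis sigma_X : forall j, cli_ord j -> X (sigma j).
Hypothesis X_even : forall x, X x -> ~~ odd #|[set j | cli_ord j && (sigma j == x)]|.

Let opt := \sum_(x | X x) open_cost x + \sum_(j | cli_ord j) dist_ord (sigma j) j.

(** All fibres of [sigma] are even, those over unopened points being empty; clients are paired
    inside the fibres. *)
Lemma fibre_pairing : exists p : V -> V, forall v, cli_ord v ->
  [/\ cli_ord (p v), p (p v) = v, p v != v & sigma (p v) = sigma v].
Proof.
have [f hf] : exists f : V -> V -> V, forall x,
    forall v, v \in [set j | cli_ord j && (sigma j == x)] ->
     [/\ f x v \in [set j | cli_ord j && (sigma j == x)], f x (f x v) = v & f x v != v].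
  apply: (fin_all_exists (P := fun x f => forall v, v \in [set j | cli_ord j && (sigma j == x)] ->
     [/\ f v \in [set j | cli_ord j && (sigma j == x)], f (f v) = v & f v != v])) => x.
  apply: even_pairing; case hX: (X x); first exact: X_even.
  rewrite (_ : [set j | _] = set0) ?cards0 //; apply/setP => j; rewrite !inE.
  by apply/negP => /andP [cj /eqP hj]; move: hX; rewrite -hj sigma_X.
exists (fun v => f (sigma v) v) => v cv.
have := hf (sigma v) v; rewrite !inE cv eqxx => /(_ isT) [/andP [h1 /eqP h2] h3 h4].
by rewrite h2.
Qed.

(** Partners meet at their common facility: each pair costs at most its two connections and is
    counted from both ends. *)
Lemma sum_pairing p : (forall v, cli_ord v ->
    [/\ cli_ord (p v), p (p v) = v, p v != v & sigma (p v) = sigma v]) ->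
  \sum_(a | cli_ord a) dist_ord a (p a) <= 2 * \sum_(j | cli_ord j) dist_ord (sigma j) j.
Proof.
move=> pP; rewrite mul2n -addnn.
rewrite [X in _ <= _ + X](reindex_onto p p) /=; last by move=> a ca; have [] := pP a ca.
rewrite (eq_bigl cli_ord _ (P1 := fun j => _ && _)); last first.
  move=> a; apply/andP/idP => [[cp /eqP ppa]|ca]; last by have [? -> _ _] := pP a ca.
  by have [ca _ _ _] := pP _ cp; rewrite -ppa.
rewrite -big_split /=; apply: leq_sum => a ca; have [_ _ _ sa] := pP a ca.
rewrite sa /dist_ord; have := DD_triangle (ltn_ord a) (ltn_ord (sigma a)) (ltn_ord (p a)).
by rewrite (DD_sym (ltn_ord a) (ltn_ord (sigma a))).
Qed.

(** Rounding loses at most one unit per client, hence at most [n], which is at most half of a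
    nonzero opening cost. *)
Lemma radius_bounds st i : radius_ok st i -> i < n -> facb i -> forall x : V, x = i :> nat ->
  \sum_(j | cli_ord j) (st aR i - dist_ord x j) <= open_cost x /\
  open_cost x <= 2 * \sum_(j | cli_ord j) (st aR i - dist_ord x j).
Proof.
move=> [t [tn ct rt rmin]] hi fi x hx.
have E (t' : V) : radius i t' =
   (open_cost x + ball_sum dist_ord cli_ord x t') %/ ball_card dist_ord cli_ord x t'.
  rewrite /radius /ball_sum /ball_card /open_cost hx; congr ((_ + _) %/ _).
    rewrite [RHS]big_mkcond; apply: eq_bigr => j _; rewrite /nearer /dist_ord hx /cli_ord.
    by case: ifP; rewrite ?muln1 ?muln0.
  rewrite [RHS]big_mkcond; apply: eq_bigr => j _; rewrite /nearer /dist_ord hx /cli_ord.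
  by case: ifP.
split; first by apply: radius_leq => t' ct'; rewrite -E; apply: rmin.
have h := @radius_geq V dist_ord cli_ord open_cost x (Ordinal tn) (st aR i) ct.
rewrite -E -rt in h; have {}h := h erefl.
have fx : fac_ord x by rewrite /fac_ord hx.
case: (open_cost_large fx) => [-> //|h2].
have h3 : \sum_(j | cli_ord j) 1 <= n.
  by rewrite sum1_card; apply: leq_trans (max_card _) _; rewrite card_ord.
lia.
Qed.

Lemma final_correct st (m : V -> option V) : mate_rep st m ->
  (forall v : V, cli_ord v -> m v != None /\ st aNEAR v < n) ->
  mates m -> (forall v w, m v = Some w -> cli_ord w) ->
  exists sig : V -> V, [/\ forall v : V, run s [::] final_prog st aSIG v = sig v,
    forall v : V, run s [::] final_prog st aSOL v = [exists j, cli_ord j && (sig j == v)]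
  & forall v w, cli_ord v -> m v = Some w -> sig v = st aNEAR (minn v w) :> nat].
Proof.
move=> hm hn hmm hc; rewrite /final_prog run_then.
set st1 := run s _ (tab 0 aSIG _) st.
have v1 (v : V) : st1 aSIG v =
    (if cli_ord v then oapp (fun w : V => st aNEAR (minn v w)) 0 (m v) else 0).
  rewrite /st1 run_tab // s_n ltn_ord /=.
  rewrite (@ev_mul_bool _ _ _ _ _ (cli_ord v)) //; last exact: ev_cli.
  case cv : (cli_ord v); rewrite ?muln0 // muln1.
  rewrite ev_arr !ev_sub ev_var ev_arr ev_lit ev_var /= hm.
  have [mv _] := hn v cv; case: (m v) mv => [w|] //= _.
  by congr (st aNEAR _); lia.
have lt1 (v : V) : st1 aSIG v < n.
  rewrite v1; have n0 : 0 < n by apply: leq_ltn_trans (ltn_ord v).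
  case cv : (cli_ord v) => //; have [mv _] := hn v cv; case E: (m v) mv => [w|] //= _.
  have cw := hc _ _ E.
  by rewrite /minn; case: ifP => _; [have [] := hn v cv|have [] := hn w cw].
exists (fun v => Ordinal (lt1 v)); split.
- by move=> v; rewrite run_frame.
- move=> v; rewrite run_tab // s_n ltn_ord /= ev_lt ev_lit ev_sum s_n.
  congr nat_of_bool.
  have -> : \sum_(j < n) ev s st1 (rcons (rcons [::] (v : nat)) j)
     (mulX (cliX (Var 1)) (eqX (Arr aSIG (Var 1)) (Var 0))) =
     \sum_(j < n) (cli_ord j && (Ordinal (lt1 j) == v)).
    apply: eq_bigr => j _; apply: ev_and => //; first exact: ev_cli.
    by rewrite ev_eq.
  rewrite lt0n sum_nat_eq0 negb_forall; apply: eq_existsb => j.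
  by rewrite /= eqb0 negbK.
- by move=> v w cv E; rewrite /= v1 cv E.
Qed.

Theorem main_correct : exists sig : V -> V,
  [/\ forall v : V, run s [::] main_prog empty_store aSIG v = sig v,
      forall v : V, run s [::] main_prog empty_store aSOL v = [exists j, cli_ord j && (sig j == v)],
      forall j, cli_ord j -> fac_ord (sig j),
      forall x, ~~ odd #|[set j | cli_ord j && (sig j == x)]|
    & \sum_(x | [exists j, cli_ord j && (sig j == x)]) open_cost x +
      \sum_(j | cli_ord j) dist_ord (sig j) j <= 20 * opt].
Proof.
have [p pP] := fibre_pairing.
have sump := sum_pairing pP.
have pP' v : cli_ord v -> [/\ cli_ord (p v), p (p v) = v & p v != v].
  by move=> cv; have [? ? ? ?] := pP v cv.
have cli_even : ~~ odd #|cli_ord|.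
  rewrite -cardsE; apply: (@even_involution _ p) => v; rewrite !inE => cv.
  by have [? ? ? _] := pP v cv.
set st1 := run s [::] scale_prog empty_store.
have q1 : st1 aQ 0 = q by rewrite /st1 scale_correct.
set st2 := run s [::] radius_prog st1.
have q2 : st2 aQ 0 = q by rewrite /st2 run_frame.
set st3 := run s [::] open_prog st2.
have q3 : st3 aQ 0 = q by rewrite /st3 run_frame.
set st4 := run s [::] near_prog st3.
have q4 : st4 aQ 0 = q by rewrite /st4 run_frame.
have zero4 t l : (t == aMATE) || (t == aD) -> st4 t l = 0.
  by move=> /orP [] /eqP ->; rewrite /st4 /st3 /st2 /st1 !run_frame.
have [m [hm mm mc cost]] := @pairing_correct st4 p q4 (fun v _ => zero4 aMATE v isT)
  (fun v _ => zero4 aD v isT) cli_even pP'.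
set st5 := run s [::] (Then moat_prog back_prog) st4 in hm *.
have -> : run s [::] main_prog empty_store = run s [::] final_prog st5 by [].
have near5 l : st5 aNEAR l = st4 aNEAR l by rewrite /st5 run_frame.
have mcli v w : m v = Some w -> cli_ord w.
  by move=> /mm [h _]; rewrite -mc h.
have opn0 z : z < n -> st2 aOPN z = 0 by move=> _; rewrite /st2 /st1 !run_frame.
have [o [ho [o1 o2 o3] oc]] := open_correct q2 opn0.
have ho3 z : z < n -> st3 aOPN z = o z by apply: ho.
have near_all : forall j : V, cli_ord j -> near_ok o st4 j.
  move=> j cj; have [z [zn oz _ _]] := oc (sigma j) (ltn_ord _) (X_fac (sigma_X cj)).
  exact: (near_correct q3 ho3 zn oz (ltn_ord j)).
have final_hyp v : cli_ord v -> m v != None /\ st5 aNEAR v < n.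
  by move=> cv; rewrite mc near5; have [? _ _] := near_all v cv.
have [sig [sig1 sig2 sig3]] := final_correct hm final_hyp mm mcli.
have n_pos : forall j : V, cli_ord j -> st4 aNEAR j < n by move=> j /near_all [].
pose near (j : V) : V := insubd j (st4 aNEAR j).
have nearE (j : V) : cli_ord j -> near j = st4 aNEAR j :> nat.
  by move=> cj; rewrite /near insubdK //; apply: n_pos.
pose mate (j : V) : V := odflt j (m j).
have mateE j : cli_ord j -> m j = Some (mate j).
  by rewrite -mc /mate; case: (m j).
have mateP j : cli_ord j -> [/\ cli_ord (mate j), mate (mate j) = j & mate j != j].
  move=> cj; have := mateE j cj => E; have [E2 ne] := mm _ _ E; have cm := mcli _ _ E.
  by split => //; [rewrite {1}/mate E2|rewrite eq_sym].
(* Of two partners, the one with the smaller index decides for both. *)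
pose rep (j : V) : V := if j <= mate j then j else mate j.
have sigE j : cli_ord j -> sig j = near (rep j).
  move=> cj; apply: val_inj; rewrite /= (sig3 j (mate j) cj (mateE j cj)) near5.
  have [cm _ _] := mateP j cj.
  rewrite /rep /minn; case: (ltngtP j (mate j)) => h; rewrite ?nearE //.
  by congr (st4 aNEAR _); rewrite h.
have repP j : cli_ord j -> rep (mate j) = rep j.
  move=> cj; have [_ h _] := mateP j cj; rewrite /rep h.
  by case: (ltngtP j (mate j)) => // /val_inj.
have rep_cases j : rep j = j \/ rep j = mate j by rewrite /rep; case: ifP; [left|right].
have rep_cli j : cli_ord j -> cli_ord (rep j).
  by move=> cj; have [cm _ _] := mateP j cj; case: (rep_cases j) => ->.
have near_o j : cli_ord j -> o (near j).
  by move=> cj; rewrite nearE //; have [] := near_all j cj.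
exists sig; split => //.
- by move=> j cj; rewrite sigE //; apply: o1; [|apply/near_o/rep_cli].
(* [mate] preserves each fibre of [sig], because partners have the same [rep]. *)
- move=> x; apply: (@even_involution _ mate) => v; rewrite !inE => /andP [cv /eqP <-].
  by have [cm mm' mv] := mateP v cv; split => //; rewrite cm !sigE // repP /=.
(* Radii are minima over the clients, so the case without clients is apart; nothing is opened
   then. *)
case: (pickP cli_ord) => [c cc|nocli]; last first.
  rewrite big1 => [|x /existsP [j]]; last by rewrite nocli.
  by rewrite big1 // => j; rewrite nocli.
have rad (x : V) : fac_ord x -> radius_ok st2 x.
  by move=> fx; apply: (radius_correct q1 (ltn_ord c) cc).
have bounds (x : V) (fx : fac_ord x) := radius_bounds (rad x fx) (ltn_ord x) fx (erefl _).
have ufl : \sum_(z : V | o z) open_cost z + \sum_(j | cli_ord j) dist_ord (near j) j <= 6 * opt.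
  apply: (@mettu_plaxton V dist_ord cli_ord open_cost (fun x => st2 aR x) _ _ fac_ord
     (fun z : V => o z)) => //.
  - by move=> x y; apply: DD_sym.
  - by move=> x y z; apply: DD_triangle.
  - by move=> x /bounds [].
  - by move=> x /bounds [].
  - by move=> z; apply: o1.
  - move=> x fx; have [z [zn oz rz dz]] := oc x (ltn_ord x) fx.
    by exists (Ordinal zn); split => //; rewrite mul2n -addnn.
  - by move=> z z' oz oz' ne; rewrite mul2n -addnn; apply: o3.
  - move=> j z cj oz; rewrite /dist_ord nearE //.
    by have [_ _] := near_all j cj; apply.
have sum_open : \sum_(x | [exists j, cli_ord j && (sig j == x)]) open_cost x <=
    \sum_(z : V | o z) open_cost z.
  rewrite big_mkcond [X in _ <= X]big_mkcond; apply: leq_sum => x _.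
  case: existsP => // -[j /andP [cj /eqP <-]].
  by rewrite sigE // near_o // rep_cli.
have matched : \sum_(j | cli_ord j) dist_ord j (mate j) = mate_cost dist_ord m.
  rewrite /mate_cost big_mkcond; apply: eq_bigr => j _.
  by case cj : (cli_ord j); [rewrite mateE|move: (mc j); rewrite cj; case: (m j)].
have partner : \sum_(j | cli_ord j) dist_ord (near (mate j)) (mate j) =
    \sum_(j | cli_ord j) dist_ord (near j) j.
  rewrite [RHS](reindex_onto mate mate) /=; last by move=> a ca; have [] := mateP a ca.
  apply: eq_bigl => a; apply/idP/andP => [ca|[cm /eqP h]].
    by have [? -> _] := mateP a ca.
  by have [ca _ _] := mateP _ cm; rewrite -h.
have assign : \sum_(j | cli_ord j) dist_ord (sig j) j <=
    \sum_(j | cli_ord j) dist_ord (near j) j +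
    \sum_(j | cli_ord j) dist_ord (near (mate j)) (mate j) +
    \sum_(j | cli_ord j) dist_ord j (mate j).
  rewrite -!big_split /=; apply: leq_sum => j cj; rewrite sigE //.
  case: (rep_cases j) => ->; first by rewrite -addnA leq_addr.
  rewrite -addnA; apply: leq_trans (leq_addl _ _).
  have := DD_triangle (ltn_ord (near (mate j))) (ltn_ord (mate j)) (ltn_ord j).
  by rewrite /dist_ord (DD_sym (ltn_ord j) (ltn_ord (mate j))).
rewrite partner matched in assign.
(* Openings and two copies of the nearest distances are at most [2 * (6 * opt)]; the matching is at
   most [4 * (2 * opt)]. *)
move: ufl assign cost sump sum_open; rewrite /opt; lia.
Qed.
End Feasible.
End Pairing.

End Run.

(** * Encoded instances *)

Import Order.TTheory GRing.Theory Num.Theory.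

Lemma size_flatten_uniform (T : Type) (b : nat) (ss : seq (seq T)) :
  all (fun s => size s == b) ss -> size (flatten ss) = b * size ss.
Proof.
by elim: ss => [|s ss IH] /=; rewrite ?muln0 // size_cat mulnS => /andP [/eqP -> /IH ->].
Qed.

Lemma nth_flatten_uniform (T : Type) (x0 : T) (b : nat) (ss : seq (seq T)) i c :
  all (fun s => size s == b) ss -> i < size ss -> c < b ->
  nth x0 (flatten ss) (b * i + c) = nth x0 (nth [::] ss i) c.
Proof.
elim: ss i => //= s ss IH [|i] /andP [/eqP hs hss] hi hc; rewrite nth_cat hs.
  by rewrite muln0 add0n hc.
by rewrite mulnS -addnA ltnNge leq_addr /= addKn IH.
Qed.

Section Encoding.
Variable I : instance.
Let n := npts I.
Let s := encode_instance I.

(** Extends functions of points to all numbers, since the analysis of the program indexes points by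
    [nat]. *)
Definition on_point (T : Type) (x0 : T) (f : 'I_n -> T) (k : nat) : T := oapp f x0 (insub k).

Lemma on_pointE T x0 (f : 'I_n -> T) (i : 'I_n) : on_point x0 f i = f i.
Proof. by rewrite /on_point valK. Qed.

Definition opening_or0 i : rat := if i \in fac I then opening i else 0%R.
Definition fac_at := on_point false (fun i => i \in fac I).
Definition cli_at := on_point false (fun i => i \in cli I).
Definition open_num := on_point 0 (fun i => `|numq (opening_or0 i)|%N).
Definition open_den := on_point 0 (fun i => `|denq (opening_or0 i)|%N).
Definition dist_num i j := on_point 0 (fun i => on_point 0 (fun j => `|numq (dist i j)|%N) j) i.
Definition dist_den i j := on_point 0 (fun i => on_point 0 (fun j => `|denq (dist i j)|%N) j) i.

Let point_block (i : 'I_n) := [:: nat_of_bool (i \in fac I); nat_of_bool (i \in cli I);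
  nat_of_bool (i \in oddset I)] ++ encode_rat (opening_or0 i).
Let points := [seq point_block i | i <- enum 'I_n].
Let dists := [seq encode_rat (dist i j) | i <- enum 'I_n, j <- enum 'I_n].

Let encodeE : s = n :: flatten points ++ flatten dists. Proof. by []. Qed.

Let all_points : all (fun x => size x == 5) points.
Proof. by apply/allP => x /mapP [i _ ->]. Qed.

Let size_points : size (flatten points) = 5 * n.
Proof. by rewrite (size_flatten_uniform all_points) size_map size_enum_ord. Qed.

Let all_dists : all (fun x => size x == 2) dists.
Proof. by apply/allP => x /allpairsP [p [_ _ ->]]. Qed.

Let size_dists : size dists = n * n.
Proof. by rewrite size_allpairs size_enum_ord. Qed.

Lemma size_encode : size s = 1 + 5 * n + 2 * (n * n).
Proof. by rewrite encodeE /= size_cat size_points (size_flatten_uniform all_dists) size_dists. Qed.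

Let reg_point (i : 'I_n) c : c < 5 -> reg s (2 + c + 5 * i) = nth 0 (point_block i) c.
Proof.
move=> hc; have hi := ltn_ord i.
rewrite /reg (minn_idPl _); last first.
  by rewrite size_encode; lia.
rewrite (_ : 2 + c + _ = (5 * i + c).+2); last by lia.
rewrite -[LHS]/(nth 0 (flatten points ++ flatten dists) (5 * i + c)).
rewrite nth_cat size_points ifT; last by lia.
have hp : i < size points by rewrite size_map size_enum_ord.
rewrite (nth_flatten_uniform _ all_points) //.
by rewrite (nth_map i) ?size_enum_ord // nth_ord_enum.
Qed.

Let reg_dist (i j : 'I_n) c : c < 2 ->
  reg s (2 + 5 * n + ((n * i + j) + (n * i + j)) + c) = nth 0 (encode_rat (dist i j)) c.
Proof.
move=> hc; have hi := ltn_ord i; have hj := ltn_ord j.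
have hp : n * i + j < n * n.
  by apply: (@leq_trans (n * i + n)); [lia|rewrite -mulnSr leq_mul2l hi orbT].
rewrite /reg (minn_idPl _); last by rewrite size_encode; lia.
rewrite (_ : _ + c = (5 * n + (2 * (n * i + j) + c)).+2); last by lia.
rewrite -[LHS]/(nth 0 (flatten points ++ flatten dists) (5 * n + (2 * (n * i + j) + c))).
rewrite nth_cat size_points ltnNge leq_addr addKn.
rewrite (nth_flatten_uniform _ all_dists) ?size_dists //; congr nth.
rewrite (@nth_flatten_uniform _ [::] n) //; first last.
- by rewrite size_map size_enum_ord.
- by apply/allP => x /mapP [k _ ->]; rewrite size_map size_enum_ord.
by rewrite (nth_map i) ?size_enum_ord // (nth_map j) ?size_enum_ord // !nth_ord_enum.
Qed.

Lemma reg_fac_at k : k < n -> reg s (2 + 5 * k) = fac_at k.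
Proof.
move=> hk; rewrite -[k]/(val (Ordinal hk)) /fac_at on_pointE.
exact: (@reg_point (Ordinal hk) 0).
Qed.
Lemma reg_cli_at k : k < n -> reg s (3 + 5 * k) = cli_at k.
Proof.
move=> hk; rewrite -[k]/(val (Ordinal hk)) /cli_at on_pointE.
exact: (@reg_point (Ordinal hk) 1).
Qed.
Lemma reg_open_num k : k < n -> reg s (5 + 5 * k) = open_num k.
Proof.
move=> hk; rewrite -[k]/(val (Ordinal hk)) /open_num on_pointE.
exact: (@reg_point (Ordinal hk) 3).
Qed.
Lemma reg_open_den k : k < n -> reg s (6 + 5 * k) = open_den k.
Proof.
move=> hk; rewrite -[k]/(val (Ordinal hk)) /open_den on_pointE.
exact: (@reg_point (Ordinal hk) 4).
Qed.
Lemma reg_dist_num k l : k < n -> l < n ->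
  reg s (2 + 5 * n + ((n * k + l) + (n * k + l))) = dist_num k l.
Proof.
move=> hk hl; rewrite -[k]/(val (Ordinal hk)) -[l]/(val (Ordinal hl)) /dist_num !on_pointE.
by have := @reg_dist (Ordinal hk) (Ordinal hl) 0 isT; rewrite addn0.
Qed.
Lemma reg_dist_den k l : k < n -> l < n ->
  reg s (2 + 5 * n + ((n * k + l) + (n * k + l)) + 1) = dist_den k l.
Proof.
move=> hk hl; rewrite -[k]/(val (Ordinal hk)) -[l]/(val (Ordinal hl)) /dist_den !on_pointE.
exact: (@reg_dist (Ordinal hk) (Ordinal hl) 1).
Qed.

Definition factor := scale_factor n open_den dist_den.

Lemma denq_pos (x : rat) : 0 < `|denq x|%N.
Proof. by rewrite absz_gt0 denq_neq0. Qed.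

Let dens := (\prod_(i < n) open_den i) * \prod_(i < n) \prod_(j < n) dist_den i j.

Lemma factorE : factor = 2 * n * dens.
Proof. by rewrite /factor /scale_factor /dens -mulnA addnn mul2n. Qed.

Lemma dens_gt0 : 0 < dens.
Proof.
rewrite muln_gt0; apply/andP; split; apply: prodn_gt0 => i.
  by rewrite /open_den on_pointE denq_pos.
by apply: prodn_gt0 => j; rewrite /dist_den !on_pointE denq_pos.
Qed.

Lemma dvdn_prod_ord m (f : 'I_m -> nat) i : f i %| \prod_(j < m) f j.
Proof. by rewrite (bigD1 i) //= dvdn_mulr. Qed.

Lemma open_den_dvd (i : 'I_n) : open_den i %| dens.
Proof. by rewrite dvdn_mulr // (dvdn_prod_ord (fun i => open_den i)). Qed.

Lemma dist_den_dvd (i j : 'I_n) : dist_den i j %| dens.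
Proof.
rewrite dvdn_mull // (@dvdn_trans (\prod_(j < n) dist_den i j)) //.
  exact: (dvdn_prod_ord (fun j => dist_den i j)).
exact: (dvdn_prod_ord (fun i : 'I_n => \prod_(j < n) dist_den i j)).
Qed.

(** [factor] is [2 * n] times a common denominator, so a positive fraction becomes a positive
    multiple of [2 * n]. *)
Lemma scaled_geq d x : d %| dens -> 0 < d -> 0 < x -> 2 * n <= factor %/ d * x.
Proof.
move=> dv d0 x0; rewrite factorE -muln_divA // -mulnA leq_pmulr // muln_gt0 x0 andbT.
by rewrite divn_gt0 // dvdn_leq // dens_gt0.
Qed.

Lemma rat_fraction (x : rat) : (0 <= x)%R -> x = (`|numq x|%N%:R / `|denq x|%N%:R)%R.
Proof.
move=> x0; rewrite -[LHS]divq_num_den !pmulrn.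
by rewrite !gez0_abs ?denq_ge0 ?numq_ge0.
Qed.

Lemma scaled_rat d x : d %| dens -> 0 < d ->
  ((factor %/ d * x)%N%:R = factor%:R * (x%:R / d%:R) :> rat)%R.
Proof.
move=> dv d0; have dv' : d %| factor by rewrite factorE dvdn_mull.
rewrite natrM -{2}(divnK dv') natrM -!mulrA; congr (_ * _)%R.
by rewrite mulrCA mulfV ?mulr1 // pnatr_eq0 -lt0n.
Qed.

Local Notation DD := (scaled dist_num dist_den factor).
Local Notation FF := (scaled_open open_num open_den factor).

Lemma DD_rat (i j : 'I_n) : ((DD i j)%:R = factor%:R * dist i j :> rat)%R.
Proof.
rewrite [in RHS](rat_fraction (dist_ge0 i j)) scaled_rat ?dist_den_dvd //.
  by rewrite /dist_num /dist_den !on_pointE.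
by rewrite /dist_den !on_pointE denq_pos.
Qed.

Lemma FF_rat (i : 'I_n) : ((FF i)%:R = factor%:R * opening_or0 i :> rat)%R.
Proof.
have h : (0 <= opening_or0 i)%R by rewrite /opening_or0; case: ifP => // /opening_ge0.
rewrite [in RHS](rat_fraction h) scaled_rat ?open_den_dvd //.
  by rewrite /open_num /open_den !on_pointE.
by rewrite /open_den !on_pointE denq_pos.
Qed.

Lemma factor_gt0 : 0 < n -> 0 < factor.
Proof. by move=> n0; rewrite factorE muln_gt0 dens_gt0 andbT muln_gt0. Qed.

Lemma scaled_metric :
  [/\ forall i j, i < n -> j < n -> DD i j = DD j i,
      forall i, i < n -> DD i i = 0,
      forall i j k, i < n -> j < n -> k < n -> DD i k <= DD i j + DD j k
    & forall i j, i < n -> j < n -> i != j -> 1 < DD i j].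
Proof.
split.
- move=> i j hi hj; apply/eqP; rewrite -(eqr_nat rat).
  by rewrite (DD_rat (Ordinal hi) (Ordinal hj)) (DD_rat (Ordinal hj) (Ordinal hi)) dist_sym.
- move=> i hi; apply/eqP; rewrite -(eqr_nat rat) (DD_rat (Ordinal hi) (Ordinal hi)).
  by rewrite (proj2 (dist_eq0 _ _) (erefl _)) mulr0.
- move=> i j k hi hj hk; rewrite -(ler_nat rat) natrD.
  rewrite (DD_rat (Ordinal hi) (Ordinal hk)) (DD_rat (Ordinal hi) (Ordinal hj)).
  by rewrite (DD_rat (Ordinal hj) (Ordinal hk)) -mulrDr ler_wpM2l ?ler0n // dist_triangle.
- move=> i j hi hj ij; apply: (@leq_trans (2 * n)); first by lia.
  apply: (@scaled_geq (dist_den (Ordinal hi) (Ordinal hj)) (dist_num (Ordinal hi) (Ordinal hj))).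
  + exact: dist_den_dvd.
  + by rewrite /dist_den !on_pointE denq_pos.
  + rewrite /dist_num !on_pointE absz_gt0 numq_eq0; apply: contra ij.
    by move=> /eqP /dist_eq0 /(congr1 val) /= ->.
Qed.

Lemma scaled_open_large (x : 'I_n) : FF x = 0 \/ 2 * n <= FF x.
Proof.
case: (posnP (open_num x)) => [h|h]; first by left; rewrite /scaled_open h muln0.
right; apply: scaled_geq => //; first exact: open_den_dvd.
by rewrite /open_den !on_pointE denq_pos.
Qed.

(** Scaling multiplies the costs of all solutions by the same number, so ratios between them are
    preserved. *)
Lemma cost_rat (S : {set 'I_n}) (sigma : {ffun 'I_n -> 'I_n}) : S \subset fac I ->
  ((\sum_(x in S) FF x + \sum_(j in cli I) DD (sigma j) j)%N%:R =
   factor%:R * cost I S sigma :> rat)%R.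
Proof.
move=> /subsetP hS; rewrite natrD !natr_sum /cost mulrDr !mulr_sumr.
congr (_ + _)%R; apply: eq_bigr => i hi; last exact: DD_rat.
by rewrite FF_rat /opening_or0 hS.
Qed.

Definition feasibleb (p : {set 'I_n} * {ffun 'I_n -> 'I_n}) :=
  [&& p.1 \subset fac I, [forall j in cli I, p.2 j \in p.1]
    & [forall i in p.1, odd #|[set j in cli I | p.2 j == i]| == (i \in oddset I)]].

Lemma feasibleP p : reflect (feasible I p.1 p.2) (feasibleb p).
Proof.
apply: (iffP and3P) => [[h1 /forall_inP h2 /forall_inP h3]|[h1 h2 h3]]; split => //.
- by move=> i hi; apply/eqP/h3.
- exact/forall_inP.
- by apply/forall_inP => i hi; apply/eqP/h3.
Qed.

Lemma optimal_exists S sigma : feasible I S sigma ->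
  exists S' sigma', optimal I S' sigma'.
Proof.
move=> h; have h0 : feasibleb (S, sigma) by apply/feasibleP.
case: (arg_minP (fun p => cost I p.1 p.2) h0) => -[S' sigma'] /feasibleP /= h1 h2.
exists S', sigma'; split => // S2 sigma2 h3.
by apply: (h2 (S2, sigma2)); apply/feasibleP.
Qed.

End Encoding.

Theorem theorem1 :
  exists (alpha : rat) (A : program),
    approximation_algorithm (fun I => oddset I = set0) alpha A.
Proof.
have wf : wfc 0 main_prog by [].
have [a [k H]] := compile_correct aSOL aSIG wf.
exists 20%:R%R, (compile main_prog aSOL aSIG).
have good I : good_input (encode_instance I) /\
    nth 0 (encode_instance I) 0 + nth 0 (encode_instance I) 0 <= size (encode_instance I).
  rewrite /good_input size_encode /=; nia.
split.
  exists a, k => inp [I _ ->]; have [g1 g2] := good I.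
  by have [t ht hr] := H _ g1 g2; exists t; eexists; split; [exact: hr|].
move=> I I0 [S0 [sigma0 feas0]].
have [S' [sigma' opt]] := optimal_exists feas0.
have [[S'fac S'cli S'odd] _] := opt.
have [g1 g2] := good I; have [t ht hr] := H _ g1 g2.
have [m1 m2 m3 m4] := scaled_metric I.
have facE (x : 'I_(npts I)) : fac_at I x = (x \in fac I) by rewrite /fac_at on_pointE.
have cliE (x : 'I_(npts I)) : cli_at I x = (x \in cli I) by rewrite /cli_at on_pointE.
have [] := @main_correct (encode_instance I) (npts I) _ _ _ _ _ _ (erefl _)
  (size_encode I) (@reg_fac_at I) (@reg_cli_at I) (@reg_open_num I) (@reg_open_den I)
  (@reg_dist_num I) (@reg_dist_den I) (factor I) m1 m2 m3 m4
  (fun x _ => scaled_open_large x) (erefl _) (fun x => x \in S') sigma' _ _ _.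
- by move=> x /(subsetP S'fac); rewrite facE.
- by move=> j; rewrite cliE; apply: S'cli.
- move=> x /S'odd; rewrite I0 inE => /negbT.
  by congr (~~ odd #|pred_of_set _|); apply/setP => j; rewrite !inE cliE.
move=> sig [sigE solE sig_fac sig_even sig_cost].
pose S := [set x | [exists j, (j \in cli I) && (sig j == x)]].
pose sigma := [ffun j => sig j].
have Sfac : S \subset fac I.
  apply/subsetP => x; rewrite inE => /existsP [j /andP [cj /eqP <-]].
  by rewrite -facE; apply: sig_fac; rewrite cliE.
exists t, S, sigma; split.
- rewrite (_ : encode_solution _ _ = mkseq (run (encode_instance I) [::] main_prog empty_store aSOL)
    (npts I) ++ mkseq (run (encode_instance I) [::] main_prog empty_store aSIG) (npts I)) //.
  rewrite /encode_solution /mkseq -val_enum_ord -!map_comp; congr (_ ++ _); apply: eq_map => x /=.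
    rewrite solE inE; congr nat_of_bool; apply: eq_existsb => j; by rewrite cliE.
  by rewrite ffunE sigE.
- split => //.
    move=> j cj; rewrite inE ffunE; apply/existsP; exists j; by rewrite cj eqxx.
  move=> i _; rewrite I0 inE; apply/negbTE; move: (sig_even i).
  by congr (~~ odd #|pred_of_set _|); apply/setP => j; rewrite !inE cliE ffunE.
exists S', sigma'; split; first exact: opt.
(* [factor] contains [2 * npts I] and cannot be cancelled when there are no points; both costs are
   then empty sums. *)
have [n0|n0] := posnP (npts I).
  have no (x : 'I_(npts I)) : False by case: x => x; rewrite n0.
  by rewrite /cost !big1 ?mulr0 // => x; case: (no x).
have q0 : (0 < (factor I)%:R :> rat)%R by rewrite ltr0n factor_gt0.
have cost_leq x y : ((factor I)%:R * x <= 20%:R * ((factor I)%:R * y) -> x <= 20%:R * y :> rat)%R.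
  by rewrite mulrCA (ler_pM2l q0).
apply: cost_leq; rewrite -!cost_rat // -natrM ler_nat.
move: sig_cost.
under [X in _ <= 20 * (_ + X)]eq_bigl do rewrite cliE.
under [X in _ + X <= _]eq_bigl do rewrite cliE.
congr (_ <= _); congr (_ + _); last by apply: eq_bigr => j _; rewrite ffunE.
apply: eq_bigl => x; rewrite inE; apply: eq_existsb => j; by rewrite cliE.
Qed.
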